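(* Let $E$ be a locally compact Polish space, $\mathbb{M}$ the space of finite Borel measures on $E$ with the weak topology, $\nu\in\mathbb{M}$ with $\nu(E)>0$, and $\mathcal{G}$ the Gamma distribution on $\mathbb{M}$ with intensity measure $\nu$. Let $(\mathcal{E}_{\mathbf{1},0},\mathcal{D}(\mathcal{E}_{\mathbf{1},0}))$ be the closure in $L^2(\mathcal{G})$ of the form $$\mathcal{E}_{\mathbf{1},0}(F,G)=\int_{\mathbb{M}}\langle \nabla^{ext}F(\eta),\nabla^{ext}G(\eta)\rangle_{L^2(\eta)}\,\mathcal{G}(d\eta),\qquad F,G\in\mathcal{F}C_0^\infty,$$ with generator $\mathcal{L}_{\mathbf{1},0}$. Then: (1) $\mathrm{gap}(\mathcal{L}_{\mathbf{1},0})=1$, i.e. $\lambda=1$ is the largest constant such that $\mathcal{G}(F^2)\le \frac1\lambda\mathcal{E}_{\mathbf{1},0}(F,F)+\mathcal{G}(F)^2$ for all $F\in\mathcal{D}(\mathcal{E}_{\mathbf{1},0})$. (2) If $\mathrm{supp}\,\nu$ contains infinitely many points, then $\mathcal{E}_{\mathbf{1},0}$ does not satisfy the super Poincaré inequality, i.e. there is no function $\beta:(0,\infty)\to(0,\infty)$ such that $\mathcal{G}(F^2)\le r\,\mathcal{E}_{\mathbf{1},0}(F,F)+\beta(r)\mathcal{G}(|F|)^2$ for all $r>0$ and $F\in\mathcal{D}(\mathcal{E}_{\mathbf{1},0})$. (3) There exists a constant $c_0>0$ (independent of $\nu$) such that whenever $\mathrm{supp}\,\nu$ is a finite set, $$\mathcal{G}(F^2\log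 F^2)\le \frac{c_0}{1\wedge\delta}\,\mathcal{E}_{\mathbf{1},0}(F,F),\qquad F\in\mathcal{D}(\mathcal{E}_{\mathbf{1},0}),\ \mathcal{G}(F^2)=1,$$ where $\delta:=\min\{\nu(\{x\}):x\in\mathrm{supp}\,\nu\}$.
   Context: For a measure $\eta$ and $f\in L^1(\eta)$ write $\eta(f)=\int f\,d\eta$. The Gamma distribution $\mathcal{G}$ with intensity $\nu$ is the unique probability measure on $\mathbb{M}$ such that for any disjoint measurable $A_1,\dots,A_n\subset E$, the variables $\eta\mapsto\eta(A_i)$, $1\le i\le n$, are independent under $\mathcal{G}$ and $\eta(A_i)$ has law $\gamma_{\nu(A_i)}$, where $\gamma_r(ds)=1_{[0,\infty)}(s)\frac{s^{r-1}e^{-s}}{\Gamma(r)}ds$ for $r>0$ and $\gamma_0=\delta_0$. A measurable $F:\mathbb{M}\to\mathbb{R}$ is extrinsically differentiable at $\eta$ if $\nabla^{ext}F(\eta)(x):=\frac{d}{ds}F(\eta+s\delta_x)|_{s=0}$ exists for all $x\in E$ and $\|\nabla^{ext}F(\eta)\|_{L^2(\eta)}<\infty$. $\mathcal{F}C_0^\infty$ is the class of functions $F(\eta)=f(\eta(A_1),\dots,\eta(A_n))$ with $n\ge1$, $f\in C_0^\infty(\mathbb{R}^n)$ and $\{A_i\}_{1\le i\le n}$ a measurable partition of $E$. The form above is closable in $L^2(\mathcal{G})$; $\mathcal{D}(\mathcal{E}_{\mathbf{1},0})$ denotes the domain of the closure. $\mathrm{gap}(\mathcal{L}_{\mathbf{1},0})$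 is the largest $\lambda>0$ for which the stated Poincaré inequality holds (and $0$ if none exists). *)

(* Defs.v *)
From HB Require Import structures.
From mathcomp Require Import all_boot all_order all_algebra.
From mathcomp Require Import all_classical all_reals all_analysis.
Import Order.TTheory GRing.Theory Num.Theory.
Import numFieldNormedType.Exports.

Set Implicit Arguments.
Unset Strict Implicit.
Unset Printing Implicit Defensive.

Local Open Scope classical_set_scope.
Local Open Scope ring_scope.

Definition separable_space (T : topologicalType) : Prop :=
  exists D : set T, countable D /\ closure D = setT.

Section gamma_setting.
Context {R : realType} {E : completePseudoMetricType R}.

Definition EB : Type := g_sigma_algebraType (@open E).

Record fmeas := FMeas {
  fm : {measure set EB -> \bar R} ;
  fm_fin : (fm setT < +oo)%E }.

Lemma mzero_fin : ((@mzero _ EB R) setT < +oo)%E.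
Proof. by rewrite /mzero /= ltry. Qed.

HB.instance Definition _ := gen_eqMixin fmeas.
HB.instance Definition _ := gen_choiceMixin fmeas.
HB.instance Definition _ := isPointed.Build fmeas (FMeas mzero_fin).

Definition nnabs (s : R) : {nonneg R} := (Num.norm s)%:nng.

(* eta + |s| delta_x  (equal to eta + s delta_x for s >= 0) *)
Lemma shift_fin (eta : fmeas) (s : R) (x : EB) :
  ((measure_add (fm eta) (mscale (nnabs s) (@dirac _ EB x R))) setT < +oo)%E.
Proof.
rewrite measure_addE /dirac.
rewrite lte_add_pinfty ?fm_fin //.
by rewrite /mscale /= ltry.
Qed.

Definition shift (eta : fmeas) (s : R) (x : EB) : fmeas :=
  FMeas (shift_fin eta s x).

Definition cyl_sets : set (set fmeas) :=
  [set S | exists (A : set EB) (B : set R),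
     [/\ measurable A, measurable B & S = [set eta | B (fine (fm eta A))]]].

Definition MT : Type := g_sigma_algebraType cyl_sets.

Definition Gamma_fn (r : R) : \bar R :=
  (\int[@lebesgue_measure R]_(s in [set s : R | (0 <= s)%R])
      (powR s (r - 1) * expR (- s))%R%:E)%E.

Definition gamma_law (r : R) (B : set R) : \bar R :=
  if r == 0 then (\1_B (0 : R))%:E
  else ((fine (Gamma_fn r))^-1%:E *
        \int[@lebesgue_measure R]_(s in B `&` [set s : R | (0 <= s)%R])
            (powR s (r - 1) * expR (- s))%R%:E)%E.

Definition is_gamma_distribution (nu : fmeas) (G : probability MT R) : Prop :=
  forall (n : nat) (A : 'I_n -> set EB) (B : 'I_n -> set R),
    (forall i, measurable (A i)) ->
    (forall i j, i != j -> A i `&` A j = set0) ->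
    (forall i, measurable (B i)) ->
    G [set eta : MT | forall i, B i (fine (fm eta (A i)))] =
      (\prod_(i < n) gamma_law (fine (fm nu (A i))) (B i))%E.

Definition iter_dir_deriv (n : nat) (vs : seq 'rV[R]_n) (f : 'rV[R]_n -> R) :
  'rV[R]_n -> R := foldr (fun v g => 'D_v g) f vs.

Definition smooth_fun (n : nat) (f : 'rV[R]_n -> R) : Prop :=
  forall vs : seq 'rV[R]_n,
    continuous (iter_dir_deriv vs f) /\
    forall (v x : 'rV[R]_n), derivable (iter_dir_deriv vs f) x v.

Definition compact_support (n : nat) (f : 'rV[R]_n -> R) : Prop :=
  compact (closure [set x | f x != 0]).

Definition is_cylinder (F : fmeas -> R) : Prop :=
  exists (n : nat) (A : 'I_n -> set EB) (f : 'rV[R]_n -> R),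
    (0 < n)%N /\
    (forall i, measurable (A i)) /\
    (forall i j, i != j -> A i `&` A j = set0) /\
    \bigcup_i A i = setT /\
    smooth_fun f /\ compact_support f /\
    (forall eta, F eta = f (\row_i fine (fm eta (A i)))).

Definition grad_ext (F : fmeas -> R) (eta : fmeas) (x : EB) : R :=
  lim ((fun s => (F (shift eta s x) - F eta) / s) @ at_right (0 : R)).

Definition form0 (G : probability MT R) (F : fmeas -> R) : \bar R :=
  (\int[G]_eta \int[fm eta]_x ((grad_ext F eta x) ^+ 2)%:E)%E.

Definition in_L2 (G : probability MT R) (F : fmeas -> R) : Prop :=
  measurable_fun [set: MT] (F : MT -> R) /\
  (\int[G]_eta ((F eta) ^+ 2)%:E < +oo)%E.

Definition approx_seq (G : probability MT R) (u : nat -> fmeas -> R)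
    (F : fmeas -> R) : Prop :=
  [/\ forall k, is_cylinder (u k),
      forall e : R, 0 < e -> exists N, forall k, (N <= k)%N ->
        (\int[G]_eta ((u k eta - F eta) ^+ 2)%:E <= e%:E)%E &
      forall e : R, 0 < e -> exists N, forall k m, (N <= k)%N -> (N <= m)%N ->
        (form0 G (fun eta => u k eta - u m eta)%R <= e%:E)%E].

Definition in_domain (G : probability MT R) (F : fmeas -> R) : Prop :=
  in_L2 G F /\ exists u, approx_seq G u F.

(* value of the closed form E_{1,0}(F,F): the limit of form0 (u k) along
   approximating sequences (unique by closability) *)
Definition form_closure (G : probability MT R) (F : fmeas -> R) : \bar R :=
  ereal_inf [set l%:E | l in [set l : R | exists u, approx_seq G u F /\
                 (form0 G (u k) @[k --> \oo] --> l%:E)%E]].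

Definition Gint (G : probability MT R) (F : fmeas -> R) : \bar R :=
  (\int[G]_eta (F eta)%:E)%E.

Definition poincare (G : probability MT R) (lam : R) : Prop :=
  forall F, in_domain G F ->
    (Gint G (fun eta => F eta ^+ 2)%R <=
       lam^-1%:E * form_closure G F + Gint G F * Gint G F)%E.

Definition super_poincare (G : probability MT R) (beta : R -> R) : Prop :=
  (forall r, 0 < r -> 0 < beta r) /\
  forall r, 0 < r -> forall F, in_domain G F ->
    (Gint G (fun eta => F eta ^+ 2)%R <=
       r%:E * form_closure G F +
       (beta r)%:E * (Gint G (fun eta => `|F eta|)%R * Gint G (fun eta => `|F eta|)%R))%E.

Definition msupport (nu : fmeas) : set E :=
  [set x | forall U : set E, open U -> U x -> (0 < fm nu U)%E].

Definition min_atom (nu : fmeas) : R :=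
  fine (ereal_inf [set fm nu [set x] | x in msupport nu]).

End gamma_setting.

(* Main.v *)
Require Import Defs.
From HB Require Import structures.
From mathcomp Require Import all_boot all_order all_algebra.
From mathcomp Require Import all_classical all_reals all_analysis.
From mathcomp Require Import measurable_realfun.
From mathcomp Require Import ring lra.
Import Order.TTheory GRing.Theory Num.Theory.
Import numFieldNormedType.Exports.

Set Implicit Arguments.
Unset Strict Implicit.
Unset Printing Implicit Defensive.

Local Open Scope classical_set_scope.
Local Open Scope ring_scope.

(* The closed form at F is an infimum of limits of form0 (u_k) over approximating sequences
   u_k of cylinder functions, so that closability plays no role, and an inequality for
   cylinder functions passes to the domain as soon as its left-hand side is stable under
   L^2 limits.  For the variance this is clear; for the entropy it follows from the Gibbs
   variational formula with ln of F^2 clamped between e and M as test function, then e -> 0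
   and M -> oo by monotone convergence.

   A cylinder function is f(X_1, ..., X_n) with X_i = eta(A_i) independent of law
   gamma_(nu A_i), and its energy is the sum of the E[X_i (d_i f)^2].  Variance and entropy
   tensorize, so one is left with the one-dimensional inequalities for gamma_r and the energy
   E[X f'(X)^2].  With u = s^r e^-s and w = s^(r-1) e^-s one has u' = (r - s) w; integrating
   the derivative of (f - f r)^2 / (s - r) u gives the Poincare inequality with constant 1.
   For r <= 1, pointwise and weighted moment estimates for f - f r, all consequences of the
   fundamental theorem of calculus for u, give the log-Sobolev inequality with constant 300 / r; for
   larger r one uses gamma_r * gamma_r = gamma_(2 r).

   Sharpness of 1 and the failure of the super Poincare inequality are tested on smooth
   truncations of eta(A), for which the variance, the energy and the mean all tend to
   nu(A); in the second case nu(A) is positive and arbitrarily small.  A finite support,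
   on the other hand, forces nu(A) = 0 or nu(A) >= delta for all A. *)

(** * Variance and entropy on product spaces *)

Section log_facts.
Context {R : realType}.
Implicit Types a b c x : R.

Definition xlnx a := a * ln a.

Lemma ln_le_subr1 x : 0 < x -> ln x <= x - 1.
Proof.
move=> x0; have := @expR_ge1Dx R (ln x); rewrite lnK ?posrE//; lra.
Qed.

Lemma xlnx_tangent a b : 0 <= a -> 0 < b -> a - b <= xlnx a - a * ln b.
Proof.
rewrite /xlnx le_eqVlt => /predU1P[<-|a0] b0; first by rewrite !mul0r; lra.
have := @ln_le_subr1 (b / a) (divr_gt0 b0 a0).
rewrite ln_div ?posrE// -mulrBr => /(ler_wpM2l (ltW a0)).
have -> : a * (b / a - 1) = b - a by field; rewrite gt_eqF.
lra.
Qed.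

Lemma log_sum2 a1 a2 b1 b2 : 0 <= a1 -> 0 <= a2 -> 0 < b1 -> 0 < b2 ->
  xlnx (a1 + a2) - (a1 + a2) * ln (b1 + b2) <=
  (xlnx a1 - a1 * ln b1) + (xlnx a2 - a2 * ln b2).
Proof.
move=> a10 a20 b10 b20.
have [s0|s0] := eqVneq (a1 + a2) 0.
  have a1E : a1 = 0 by lra.
  have a2E : a2 = 0 by lra.
  by rewrite s0 a1E a2E /xlnx !mul0r; lra.
have sp : 0 < a1 + a2 by rewrite lt_neqAle eq_sym s0/= addr_ge0.
have bp : 0 < b1 + b2 by lra.
have key a b : 0 <= a -> 0 < b ->
    a - b * ((a1 + a2) / (b1 + b2)) <=
    xlnx a - a * (ln b + ln (a1 + a2) - ln (b1 + b2)).
  move=> a_0 b_0; rewrite -lnM ?posrE// -ln_div ?posrE ?mulr_gt0//.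
  by rewrite -mulrA; apply: xlnx_tangent => //; rewrite mulr_gt0 ?divr_gt0.
have := key _ _ a10 b10; have := key _ _ a20 b20.
have : (b1 + b2) * ((a1 + a2) / (b1 + b2)) = a1 + a2.
  by field; rewrite gt_eqF.
rewrite [xlnx (_ + _)]/xlnx; nra.
Qed.

Lemma xlnx_ge a : 0 <= a -> -1 <= xlnx a.
Proof.
by move=> a0; have := xlnx_tangent a0 ltr01; rewrite ln1 mulr0; lra.
Qed.

Lemma xlnx_superadd a b : 0 <= a -> 0 < b -> xlnx a + xlnx b <= xlnx (a + b).
Proof.
move=> a0 b0; rewrite /xlnx mulrDl lerD//; last first.
  by rewrite ler_wpM2l ?ler_ln ?posrE//; lra.
move: a0; rewrite le_eqVlt => /predU1P[<-|a0]; first by rewrite !mul0r.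
by rewrite ler_wpM2l ?ler_ln ?posrE//; lra.
Qed.

Lemma xlnx_sqr_ge c : 0 < c -> - (2 * c) <= xlnx (c ^+ 2).
Proof.
move=> c0; rewrite /xlnx lnXn//.
have := @ln_le_subr1 c^-1; rewrite invr_gt0 => /(_ c0); rewrite lnV ?posrE// => h.
have : c * c^-1 = 1 by rewrite divff ?gt_eqF.
rewrite mulr2n; nra.
Qed.

Lemma xlnx_le_sqr a : 0 <= a -> xlnx a <= a ^+ 2.
Proof.
rewrite le_eqVlt => /predU1P[<-|a0]; first by rewrite /xlnx mul0r expr0n.
by have := @ln_le_subr1 _ a0; rewrite /xlnx; nra.
Qed.

Lemma measurable_xlnx : measurable_fun [set: R] xlnx.
Proof. by apply: measurable_funM => //; exact: measurable_ln. Qed.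

End log_facts.

Section bounded_measurable.
Context {d} {T : measurableType d} {R : realType}.
Implicit Types f g : T -> R.

Definition bm f := measurable_fun [set: T] f /\ exists K, forall x, `|f x| <= K.

Lemma bm_cst c : bm (fun=> c).
Proof. by split; [exact: measurable_cst|exists `|c|]. Qed.

Lemma bmD f g : bm f -> bm g -> bm (fun x => f x + g x).
Proof.
move=> [mf [K hK]] [mg [L hL]]; split; first exact: measurable_funD.
by exists (K + L) => x; rewrite (le_trans (ler_normD _ _))// lerD.
Qed.

Lemma bmN f : bm f -> bm (fun x => - f x).
Proof.
move=> [mf [K hK]]; split; first exact: measurableT_comp.
by exists K => x; rewrite normrN.
Qed.

Lemma bmB f g : bm f -> bm g -> bm (fun x => f x - g x).
Proof. by move=> bf bg; apply: bmD => //; exact: bmN. Qed.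

Lemma bmM f g : bm f -> bm g -> bm (fun x => f x * g x).
Proof.
move=> [mf [K hK]] [mg [L hL]]; split; first exact: measurable_funM.
by exists (K * L) => x; rewrite normrM ler_pM.
Qed.

Lemma bm_sqr f : bm f -> bm (fun x => f x ^+ 2).
Proof. by move=> bf; under eq_fun do rewrite expr2; exact: bmM. Qed.

Lemma bm_xlnx f : bm f -> (forall x, 0 <= f x) -> bm (fun x => xlnx (f x)).
Proof.
move=> [mf [K hK]] f0; split.
  exact: (measurableT_comp measurable_xlnx mf).
exists (1 + K ^+ 2) => x; have f0x := f0 x; have := hK x; rewrite ger0_norm// => fK.
rewrite ler_norml; apply/andP; split.
  by have := @xlnx_ge _ _ f0x; nra.
by have := @xlnx_le_sqr _ _ f0x; nra.
Qed.

Lemma bm_ln f e : 0 < e -> bm f -> (forall x, e <= f x) -> bm (fun x => ln (f x)).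
Proof.
move=> e0 [mf [K hK]] fe; split.
  exact: (measurableT_comp (@measurable_ln R) mf).
exists (`|ln e| + K) => x.
have fx0 : 0 < f x by exact: lt_le_trans (fe x).
have h1 : ln e <= ln (f x) by rewrite ler_ln ?posrE.
have h2 := @ln_le_subr1 _ _ fx0.
have := hK x; rewrite (gtr0_norm fx0) => fK.
have := ler_norm (ln e); have := ler_norm (- ln e); rewrite normrN.
by rewrite ler_norml; lra.
Qed.

Variable P : probability T R.

Lemma bm_integrable f : bm f -> P.-integrable setT (EFin \o f).
Proof.
move=> [mf [K hK]]; apply: measurable_bounded_integrable => //.
  exact: le_lt_trans (probability_le1 P measurableT) (ltry 1).
by exists K; split; [exact: num_real|move=> M KM x _; exact: le_trans (hK x) (ltW KM)].
Qed.

Definition Ex f : R := (\int[P]_x f x)%R.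

Lemma EFin_Ex f : bm f -> (Ex f)%:E = (\int[P]_x (f x)%:E)%E.
Proof.
move=> bf; rewrite /Ex /Rintegral fineK//.
exact: (integrable_fin_num measurableT (bm_integrable bf)).
Qed.

Lemma Ex_cst c : Ex (fun=> c) = c.
Proof. rewrite /Ex Rintegral_cst//.
by rewrite [X in fine X](probability_setT P) mulr1. Qed.

Lemma ExD f g : bm f -> bm g -> Ex (fun x => f x + g x) = Ex f + Ex g.
Proof. by move=> bf bg; rewrite /Ex RintegralD//; exact: bm_integrable. Qed.

Lemma ExB f g : bm f -> bm g -> Ex (fun x => f x - g x) = Ex f - Ex g.
Proof. by move=> bf bg; rewrite /Ex RintegralB//; exact: bm_integrable. Qed.

Lemma ExZ c f : bm f -> Ex (fun x => c * f x) = c * Ex f.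
Proof. by move=> bf; rewrite /Ex RintegralZl//; exact: bm_integrable. Qed.

Lemma le_Ex f g : bm f -> bm g -> (forall x, f x <= g x) -> Ex f <= Ex g.
Proof.
move=> bf bg fg; apply: le_Rintegral => //; exact: bm_integrable.
Qed.

Lemma Ex_ge0 f : (forall x, 0 <= f x) -> 0 <= Ex f.
Proof. by move=> f0; exact: Rintegral_ge0. Qed.

Lemma eq_Ex f g : f =1 g -> Ex f = Ex g.
Proof. by move=> fg; apply: eq_Rintegral => x _. Qed.

Lemma Ex_norm_le f K : bm f -> (forall x, `|f x| <= K) -> `|Ex f| <= K.
Proof.
move=> bf fK; rewrite ler_norml; apply/andP; split.
  rewrite -(Ex_cst (- K)); apply: le_Ex => //; first exact: bm_cst.
  by move=> x; have := fK x; rewrite ler_norml => /andP[].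
rewrite -(Ex_cst K); apply: le_Ex => //; first exact: bm_cst.
by move=> x; have := fK x; rewrite ler_norml => /andP[].
Qed.

Definition bvariance f := Ex (fun x => f x ^+ 2) - (Ex f) ^+ 2.

Definition entropy f := Ex (fun x => xlnx (f x)) - xlnx (Ex f).

Lemma variance_le f c : bm f -> bvariance f <= Ex (fun x => (f x - c) ^+ 2).
Proof.
move=> bf; rewrite /bvariance.
have bs := bm_sqr bf; have bl : bm (fun x => 2 * c * f x) by apply: bmM => //; exact: bm_cst.
have -> : Ex (fun x => (f x - c) ^+ 2) = Ex (fun x => (f x ^+ 2 - 2 * c * f x) + c ^+ 2).
  by apply: eq_Ex => x; ring.
rewrite (ExD (bmB bs bl) (bm_cst _)) (ExB bs bl) (ExZ _ bf) Ex_cst.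
by have := sqr_ge0 (Ex f - c); nra.
Qed.

Lemma integral_prob1 : (\int[P]_x 1%:E = 1)%E.
Proof. by have := EFin_Ex (bm_cst 1); rewrite Ex_cst. Qed.

Lemma entropy_ge0 f : bm f -> (forall x, 0 <= f x) -> 0 <= entropy f.
Proof.
move=> bf f0; have bx := bm_xlnx bf f0.
have N0 : 0 <= Ex f by exact: Ex_ge0.
have key c : 0 < c -> 0 <= Ex (fun x => xlnx (f x)) - ln c * Ex f - Ex f + c.
  move=> c0; have bl : bm (fun x => ln c * f x) by apply: bmM => //; exact: bm_cst.
  have := @Ex_ge0 (fun x => (xlnx (f x) - ln c * f x) - f x + c).
  rewrite (ExD (bmB (bmB bx bl) bf) (bm_cst _)) (ExB (bmB bx bl) bf) (ExB bx bl) (ExZ _ bf) Ex_cst.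
  by apply=> x; have := xlnx_tangent (f0 x) c0; lra.
rewrite /entropy; move: N0; rewrite le_eqVlt => /predU1P[N0|/key]; last by rewrite /xlnx; lra.
apply/ler_addgt0Pr => c /key; rewrite -N0 /xlnx mul0r; lra.
Qed.

Lemma entropy_le f c : 0 < c -> bm f -> (forall x, 0 <= f x) ->
  entropy f <= Ex (fun x => xlnx (f x) - f x * ln c - f x + c).
Proof.
move=> c0 bf f0; have bx := bm_xlnx bf f0; have bc := bm_cst (ln c).
have bfc : bm (fun x => f x * ln c) by exact: bmM.
have b1 : bm (fun x => xlnx (f x) - f x * ln c) by exact: bmB.
have b2 : bm (fun x => xlnx (f x) - f x * ln c - f x) by exact: bmB.
rewrite (@ExD (fun x => xlnx (f x) - f x * ln c - f x))//; last exact: bm_cst.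
rewrite Ex_cst (@ExB (fun x => xlnx (f x) - f x * ln c))// (@ExB (fun x => xlnx (f x)))//.
have -> : Ex (fun x => f x * ln c) = ln c * Ex f.
  by rewrite -ExZ//; apply: eq_Ex => x; rewrite mulrC.
have /xlnx_tangent-/(_ _ c0) := Ex_ge0 f0.
rewrite /entropy; lra.
Qed.

Lemma gibbs f g : bm f -> (forall x, 0 <= f x) -> bm g ->
  Ex (fun x => f x * g x) <=
    entropy f + Ex f * ln (Ex (fun x => expR (g x))).
Proof.
move=> bf f0 bg.
have be : bm (fun x => expR (g x)).
  case: bg => mg [K hK]; split.
    by apply: measurableT_comp => //; exact: measurable_expR.
  exists (expR K) => x; rewrite ger0_norm ?expR_ge0// ler_expR.
  by rewrite (le_trans (ler_norm _)).
have bx := bm_xlnx bf f0.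
set Z := Ex (fun x => expR (g x)); set N := Ex f.
have Z0 : 0 < Z.
  case: bg => mg [K hK].
  apply: (@lt_le_trans _ _ (expR (- K))); first exact: expR_gt0.
  rewrite -(Ex_cst (expR (- K))); apply: le_Ex => //; first exact: bm_cst.
  by move=> x; rewrite ler_expR; have := hK x; rewrite ler_norml => /andP[].
have N0 : 0 <= N by exact: Ex_ge0.
(* the tangent inequality at [N e^g / Z], perturbed to allow [N = 0] *)
suff key c : 0 < c -> Ex (fun x => f x * g x) <=
    Ex (fun x => xlnx (f x)) - N * ln c + N * ln Z + c - N.
  move: N0; rewrite le_eqVlt => /predU1P[N0|N0]; last first.
    by have := key _ N0; rewrite /entropy -/N /xlnx; lra.
  apply/ler_addgt0Pr => e e0; have := key _ e0.
  by rewrite /entropy -/N -N0 /xlnx !mul0r; lra.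
move=> c0.
have bfc k : bm (fun x => f x * k) by apply: bmM => //; exact: bm_cst.
have ExfM k : Ex (fun x => f x * k) = N * k.
  by rewrite mulrC -ExZ//; apply: eq_Ex => x; rewrite mulrC.
have : Ex (fun x => f x - (c / Z) * expR (g x)) <=
       Ex (fun x => (xlnx (f x) - f x * (ln c - ln Z)) - f x * g x).
  apply: le_Ex.
  - by apply: bmB => //; apply: bmM => //; exact: bm_cst.
  - by apply: bmB; [exact: bmB|exact: bmM].
  move=> x.
  have := @xlnx_tangent R (f x) ((c / Z) * expR (g x)) (f0 x) _.
  rewrite lnM ?posrE ?divr_gt0 ?expR_gt0// expRK ln_div ?posrE// => H.
  by rewrite -addrA -opprD -mulrDr; apply: H; rewrite mulr_gt0 ?divr_gt0 ?expR_gt0.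
rewrite ExB//; last by apply: bmM => //; exact: bm_cst.
rewrite ExZ// -/Z divfK ?gt_eqF// ExB//; [|exact: bmB|exact: bmM].
rewrite ExB// ExfM -/N; lra.
Qed.

End bounded_measurable.

Section products.
Context {d1 d2} {T1 : measurableType d1} {T2 : measurableType d2} {R : realType}.
Variables (P1 : probability T1 R) (P2 : probability T2 R).
Implicit Type f : T1 * T2 -> R.

Let PP : probability (T1 * T2)%type R := (P1 \x P2)%E.

Lemma bm_pair1 f y : bm f -> bm (fun x => f (x, y)).
Proof.
by move=> [mf [K hK]]; split; [exact: measurable_fun_pair1|exists K => x].
Qed.

Lemma bm_pair2 f x : bm f -> bm (fun y => f (x, y)).
Proof.
by move=> [mf [K hK]]; split; [exact: measurable_fun_pair2|exists K => y].
Qed.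

Lemma bm_Ex1 f : bm f -> bm (fun y => Ex P1 (fun x => f (x, y))).
Proof.
move=> bf; split; last first.
  case: (bf) => _ [K hK]; exists K => y; apply: Ex_norm_le => //; exact: bm_pair1.
have h := measurable_fubini_G (bm_integrable PP bf).
exact: (measurableT_comp (fine_measurable measurableT) h).
Qed.

Lemma bm_Ex2 f : bm f -> bm (fun x => Ex P2 (fun y => f (x, y))).
Proof.
move=> bf; split; last first.
  case: (bf) => _ [K hK]; exists K => y; apply: Ex_norm_le => //; exact: bm_pair2.
have h := measurable_fubini_F (bm_integrable PP bf).
exact: (measurableT_comp (fine_measurable measurableT) h).
Qed.

Lemma Ex_prod21 f : bm f -> Ex PP f = Ex P2 (fun y => Ex P1 (fun x => f (x, y))).
Proof.
move=> bf; apply: EFin_inj; rewrite !EFin_Ex//; last exact: bm_Ex1.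
rewrite -(integral21_prod_meas1 (bm_integrable PP bf)).
by apply: eq_integral => y _; rewrite EFin_Ex//; exact: bm_pair1.
Qed.

Lemma Ex_prod12 f : bm f -> Ex PP f = Ex P1 (fun x => Ex P2 (fun y => f (x, y))).
Proof.
move=> bf; apply: EFin_inj; rewrite !EFin_Ex//; last exact: bm_Ex2.
rewrite -(integral12_prod_meas1 (bm_integrable PP bf)).
by apply: eq_integral => y _; rewrite EFin_Ex//; exact: bm_pair2.
Qed.

Lemma bm_variance1 f : bm f -> bm (fun y => bvariance P1 (fun x => f (x, y))).
Proof.
move=> bf; apply: bmB; last exact/bm_sqr/bm_Ex1.
exact: (@bm_Ex1 (fun z => f z ^+ 2) (bm_sqr bf)).
Qed.

Lemma bm_variance2 f : bm f -> bm (fun x => bvariance P2 (fun y => f (x, y))).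
Proof.
move=> bf; apply: bmB; last exact/bm_sqr/bm_Ex2.
exact: (@bm_Ex2 (fun z => f z ^+ 2) (bm_sqr bf)).
Qed.

Lemma variance_tensor f : bm f ->
  bvariance PP f <= Ex P2 (fun y => bvariance P1 (fun x => f (x, y))) +
                   Ex P1 (fun x => bvariance P2 (fun y => f (x, y))).
Proof.
move=> bf; have bf2 := bm_sqr bf.
set a := fun y => Ex P1 (fun x => f (x, y)).
have ba : bm a by exact: bm_Ex1.
have ba2 := bm_sqr ba.
have bV2 := bm_variance2 bf.
(* for each [x], [Var (f x) >= 2 Cov (f x, a) - Var a]; then average over [x] *)
have key x : 2 * (Ex P2 (fun y => f (x, y) * a y) - Ex P2 (fun y => f (x, y)) * Ex P2 a)
    - bvariance P2 a <= bvariance P2 (fun y => f (x, y)).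
  have bfx := bm_pair2 x bf.
  have bfx2 := bm_sqr bfx.
  have bfa : bm (fun y => f (x, y) * a y) by exact: bmM.
  have : 0 <= bvariance P2 (fun y => f (x, y) - a y).
    rewrite /bvariance; set m := Ex P2 (fun y => f (x, y) - a y).
    have bg : bm (fun y => f (x, y) - a y) by exact: bmB.
    have bm2 : bm (fun y => 2 * m * (f (x, y) - a y)) by apply: bmM => //; exact: bm_cst.
    have : 0 <= Ex P2 (fun y => ((f (x, y) - a y) ^+ 2 - 2 * m * (f (x, y) - a y)) + m ^+ 2).
      apply: Ex_ge0 => y.
      by have := sqr_ge0 (f (x, y) - a y - m); congr (_ <= _); ring.
    rewrite (ExD _ (bmB (bm_sqr bg) bm2) (bm_cst _)) (ExB _ (bm_sqr bg) bm2) (ExZ _ _ bg) Ex_cst -/m.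
    by congr (_ <= _); ring.
  rewrite /bvariance ExB//.
  have -> : Ex P2 (fun y => (f (x, y) - a y) ^+ 2) =
            Ex P2 (fun y => (f (x, y) ^+ 2 - 2 * (f (x, y) * a y)) + a y ^+ 2).
    by apply: eq_Ex => y; ring.
  have b2 : bm (fun y => 2 * (f (x, y) * a y)) by apply: bmM => //; exact: bm_cst.
  rewrite (ExD _ (bmB bfx2 b2) ba2) (ExB _ bfx2 b2) (ExZ _ _ bfa); lra.
have bfa : bm (fun z => f z * a z.2).
  apply: bmM => //; case: ba => ma [K hK]; split; last by exists K => z.
  exact: measurableT_comp.
have bc : bm (fun x => Ex P2 (fun y => f (x, y) * a y)) by exact: (bm_Ex2 bfa).
have be := bm_Ex2 bf.
have be' : bm (fun x => Ex P2 (fun y => f (x, y)) * Ex P2 a) by apply: bmM => //; exact: bm_cst.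
have Efa : Ex P1 (fun x => Ex P2 (fun y => f (x, y) * a y)) = Ex P2 (fun y => a y ^+ 2).
  rewrite -(Ex_prod12 bfa) (Ex_prod21 bfa); apply: eq_Ex => y /=.
  rewrite expr2 -[in RHS](ExZ _ _ (bm_pair1 y bf)).
  by apply: eq_Ex => x; rewrite mulrC.
have Ef : Ex P1 (fun x => Ex P2 (fun y => f (x, y)) * Ex P2 a) = Ex P2 a ^+ 2.
  have -> : Ex P2 a = Ex P1 (fun x => Ex P2 (fun y => f (x, y))).
    by rewrite -(Ex_prod21 bf) (Ex_prod12 bf).
  by rewrite expr2 -[in RHS](ExZ _ _ be); apply: eq_Ex => x; rewrite mulrC.
have b2c : bm (fun x => 2 * (Ex P2 (fun y => f (x, y) * a y) - Ex P2 (fun y => f (x, y)) * Ex P2 a)).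
  by apply: bmM; [exact: bm_cst|exact: bmB].
have := le_Ex P1 (bmB b2c (bm_cst (bvariance P2 a))) bV2 key.
rewrite (ExB _ b2c (bm_cst _)) (ExZ _ _ (bmB bc be')) (ExB _ bc be') Efa Ef Ex_cst.
rewrite [X in _ <= X + _](ExB _ (bm_Ex1 bf2) (bm_sqr ba)).
rewrite /bvariance (Ex_prod21 bf2) (Ex_prod21 bf) -/a; lra.
Qed.

Lemma bm_entropy1 f : bm f -> (forall z, 0 <= f z) ->
  bm (fun y => entropy P1 (fun x => f (x, y))).
Proof.
move=> bf f0; apply: bmB.
  exact: (@bm_Ex1 (fun z => xlnx (f z)) (bm_xlnx bf f0)).
by apply: bm_xlnx (bm_Ex1 bf) _ => y; exact: Ex_ge0.
Qed.

Lemma bm_entropy2 f : bm f -> (forall z, 0 <= f z) ->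
  bm (fun x => entropy P2 (fun y => f (x, y))).
Proof.
move=> bf f0; apply: bmB.
  exact: (@bm_Ex2 (fun z => xlnx (f z)) (bm_xlnx bf f0)).
by apply: bm_xlnx (bm_Ex2 bf) _ => y; exact: Ex_ge0.
Qed.

Lemma entropy_tensor_pos f e : 0 < e -> bm f -> (forall z, e <= f z) ->
  entropy PP f <= Ex P2 (fun y => entropy P1 (fun x => f (x, y))) +
                  Ex P1 (fun x => entropy P2 (fun y => f (x, y))).
Proof.
move=> e0 bf fe.
have f0 z : 0 <= f z by exact: le_trans (ltW e0) (fe z).
set a := fun y => Ex P1 (fun x => f (x, y)).
have ba : bm a by exact: bm_Ex1.
have ae y : e <= a y.
  rewrite -(Ex_cst P1 e); apply: le_Ex => //; [exact: bm_cst|exact: bm_pair1].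
have bla := bm_ln e0 ba ae.
have a0 y : 0 < a y by exact: lt_le_trans (ae y).
have expla : (fun y => expR (ln (a y))) = a.
  by apply/funext => y; rewrite lnK// posrE.
have key x : Ex P2 (fun y => f (x, y) * ln (a y)) - Ex P2 (fun y => f (x, y)) * ln (Ex P2 a)
     <= entropy P2 (fun y => f (x, y)).
  have := gibbs P2 (bm_pair2 x bf) (fun y => f0 (x, y)) bla.
  by rewrite expla; lra.
have bfa : bm (fun z => f z * ln (a z.2)).
  apply: bmM => //; case: bla => ma [K hK]; split; last by exists K => z.
  exact: (measurableT_comp ma).
have bc : bm (fun x => Ex P2 (fun y => f (x, y) * ln (a y))) by exact: (bm_Ex2 bfa).
have be := bm_Ex2 bf.
have be' : bm (fun x => Ex P2 (fun y => f (x, y)) * ln (Ex P2 a)) by apply: bmM => //; exact: bm_cst.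
have Efa : Ex P1 (fun x => Ex P2 (fun y => f (x, y) * ln (a y))) = Ex P2 (fun y => xlnx (a y)).
  rewrite -(Ex_prod12 bfa) (Ex_prod21 bfa); apply: eq_Ex => y /=.
  rewrite /xlnx mulrC -[in RHS](ExZ _ _ (bm_pair1 y bf)).
  by apply: eq_Ex => x; rewrite mulrC.
have Ef : Ex P1 (fun x => Ex P2 (fun y => f (x, y)) * ln (Ex P2 a)) = xlnx (Ex P2 a).
  have -> : Ex P2 a = Ex P1 (fun x => Ex P2 (fun y => f (x, y))).
    by rewrite -(Ex_prod21 bf) (Ex_prod12 bf).
  by rewrite /xlnx mulrC -[in RHS](ExZ _ _ be); apply: eq_Ex => x; rewrite mulrC.
have := le_Ex P1 (bmB bc be') (bm_entropy2 bf f0) key.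
rewrite (ExB _ bc be') Efa Ef.
have bxa : bm (fun y => xlnx (a y)) by apply: bm_xlnx ba _ => y; exact: ltW.
have bxf := bm_xlnx bf f0.
rewrite [X in _ <= X + _](ExB _ (bm_Ex1 bxf) bxa).
by rewrite [entropy PP f]/entropy (Ex_prod21 bxf) (Ex_prod21 bf) -/a; lra.
Qed.

End products.

Section entropy_shift.
Context {d} {T : measurableType d} {R : realType} (P : probability T R).
Implicit Type f : T -> R.

Lemma entropy_shift_le f e : 0 < e -> bm f -> (forall x, 0 <= f x) ->
  entropy P (fun x => f x + e) <= entropy P f + e.
Proof.
move=> e0 bf f0.
set N := Ex P f; have N0 : 0 <= N by exact: Ex_ge0.
have bfe : bm (fun x => f x + e) by apply: bmD => //; exact: bm_cst.
have fe0 x : 0 <= f x + e by have := f0 x; lra.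
have EfM k (g : T -> R) : bm g -> Ex P (fun x => g x * k) = Ex P g * k.
  by move=> bg; rewrite mulrC -ExZ//; apply: eq_Ex => x; rewrite mulrC.
have bM (g : T -> R) (k : R) : bm g -> bm (fun x : T => g x * k) by move=> bg; apply: bmM => //; exact: bm_cst.
have h x : xlnx (f x + e) - (f x + e) * ln (N + e + e) <= xlnx (f x) - f x * ln (N + e).
  have Ne : 0 < N + e by lra.
  have := @log_sum2 R (f x) e (N + e) e (f0 x) (ltW e0) Ne e0.
  by rewrite /xlnx; lra.
have := le_Ex P (bmB (bm_xlnx bfe fe0) (bM _ _ bfe)) (bmB (bm_xlnx bf f0) (bM _ _ bf)) h.
rewrite (ExB _ (bm_xlnx bfe fe0) (bM _ _ bfe)) (ExB _ (bm_xlnx bf f0) (bM _ _ bf)) !EfM//.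
rewrite /entropy (ExD _ bf (bm_cst e)) Ex_cst -/N => H.
have h1 : xlnx N <= N * ln (N + e).
  move: N0; rewrite /xlnx le_eqVlt => /predU1P[<-|N0]; first by rewrite !mul0r.
  by rewrite ler_wpM2l ?ler_ln ?posrE; lra.
have h2 : (N + e) * ln (N + e + e) - xlnx (N + e) <= e.
  have Ne : 0 < N + e by lra.
  have Ne2 : 0 < N + e + e by lra.
  have := xlnx_tangent (ltW Ne) Ne2; lra.
lra.
Qed.

Lemma entropy_shift_ge f K c : 0 < c <= 1 -> bm f -> (forall x, 0 <= f x <= K) ->
  entropy P f <= entropy P (fun x => f x + c ^+ 2) + (K + 4) * c.
Proof.
move=> /andP[c0 c1] bf fK.
have f0 x : 0 <= f x by have /andP[] := fK x.
have e0 : 0 < c ^+ 2 by rewrite exprn_gt0.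
set e := c ^+ 2 in e0 *.
set N := Ex P f; have N0 : 0 <= N by exact: Ex_ge0.
have NK : N <= K.
  by rewrite -(Ex_cst P K); apply: le_Ex => //; [exact: bm_cst|move=> x; have /andP[] := fK x].
have bfe : bm (fun x => f x + e) by apply: bmD => //; exact: bm_cst.
have fe0 x : 0 <= f x + e by have := f0 x; lra.
have h x : xlnx (f x) + xlnx e <= xlnx (f x + e) by exact: xlnx_superadd.
have := le_Ex P (bmD (bm_xlnx bf f0) (bm_cst (xlnx e))) (bm_xlnx bfe fe0) h.
rewrite (ExD _ (bm_xlnx bf f0) (bm_cst _)) Ex_cst.
rewrite /entropy (ExD _ bf (bm_cst e)) Ex_cst -/N => H.
have h2 : xlnx (N + e) <= xlnx N + e * (N + e).
  have Ne : 0 < N + e by lra.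
  have := xlnx_tangent N0 Ne; have := ln_le_subr1 Ne; rewrite /xlnx; nra.
have := @xlnx_sqr_ge R c c0; rewrite -/e => h3.
have ec : e <= c by rewrite /e expr2; nra.
nra.
Qed.

End entropy_shift.

Lemma entropy_tensor d1 d2 (T1 : measurableType d1) (T2 : measurableType d2) (R : realType)
  (P1 : probability T1 R) (P2 : probability T2 R) (f : T1 * T2 -> R) :
  bm f -> (forall z, 0 <= f z) ->
  entropy (P1 \x P2)%E f <= Ex P2 (fun y => entropy P1 (fun x => f (x, y))) +
                  Ex P1 (fun x => entropy P2 (fun y => f (x, y))).
Proof.
have aux (E E' A A' B B' K c e r : R) : E <= E' + (K + 4) * c -> E' <= A' + B' ->
    A' <= A + e -> B' <= B + e -> e <= c -> c * (K + 6) <= r -> E <= A + B + r by lra.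
move=> bf f0; have [_ [K hK]] := bf.
have fK z : 0 <= f z <= K by rewrite f0 (le_trans (ler_norm _) (hK z)).
apply/ler_addgt0Pr => r r0.
have K0 : 0 <= K by have := fK (point, point); lra.
pose c := Num.min 1 (r / (K + 6)).
have K6 : 0 < K + 6 by lra.
have c0 : 0 < c by rewrite /c lt_min ltr01 divr_gt0.
have c1 : c <= 1 by rewrite /c ge_min lexx.
have cr : c * (K + 6) <= r by rewrite -ler_pdivlMr// /c ge_min lexx orbT.
have e0 : 0 < c ^+ 2 by rewrite exprn_gt0.
have ec : c ^+ 2 <= c by rewrite expr2 ler_piMl// ltW.
have bfe : bm (fun z => f z + c ^+ 2) by apply: bmD => //; exact: bm_cst.
have fe z : c ^+ 2 <= f z + c ^+ 2 by have := f0 z; lra.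
have fe0 z : 0 <= f z + c ^+ 2 by have := f0 z; lra.
have h0 := entropy_shift_ge (P1 \x P2)%E (introT andP (conj c0 c1)) bf fK.
have h1 := entropy_tensor_pos P1 P2 e0 bfe fe.
have h2 := le_Ex P2 (bm_entropy1 P1 P2 bfe fe0) (bmD (bm_entropy1 P1 P2 bf f0) (bm_cst (c ^+ 2)))
  (fun y => entropy_shift_le P1 e0 (bm_pair1 y bf) (fun x => f0 (x, y))).
have h3 := le_Ex P1 (bm_entropy2 P1 P2 bfe fe0) (bmD (bm_entropy2 P1 P2 bf f0) (bm_cst (c ^+ 2)))
  (fun x => entropy_shift_le P2 e0 (bm_pair2 x bf) (fun y => f0 (x, y))).
rewrite (ExD _ (bm_entropy1 P1 P2 bf f0) (bm_cst _)) Ex_cst in h2.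
rewrite (ExD _ (bm_entropy2 P1 P2 bf f0) (bm_cst _)) Ex_cst in h3.
exact: (aux _ _ _ _ _ _ _ _ _ _ h0 h1 h2 h3 ec cr).
Qed.

(** * One-dimensional inequalities for the Gamma laws *)

Section derivative_rules.
Context {R : realType}.
Implicit Types (f g : R -> R) (x a b : R).

Definition dv f x a : Prop := is_derive x 1 f a.

Definition ct f x : Prop := {for x, continuous f}.

Lemma dv_ct f x a : dv f x a -> ct f x.
Proof. by case=> df_ _; apply/differentiable_continuous/derivable1_diffP. Qed.

Lemma dv_eq f x a b : dv f x a -> a = b -> dv f x b.
Proof. by move=> + <-. Qed.

Lemma dvM f g x a b : dv f x a -> dv g x b ->
  dv (fun t => f t * g t) x (a * g x + f x * b).
Proof.
move=> df dg; have h := is_deriveM df dg; apply: (@dv_eq _ _ _ _ h).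
by rewrite /GRing.scale/=; ring.
Qed.

Lemma dvD f g x a b : dv f x a -> dv g x b ->
  dv (fun t => f t + g t) x (a + b).
Proof. by move=> df dg; exact: is_deriveD. Qed.

Lemma dvN f x a : dv f x a -> dv (fun t => - f t) x (- a).
Proof. by move=> df; exact: is_deriveN. Qed.

Lemma dv_cst x c : dv (fun=> c : R) x 0.
Proof. exact: is_derive_cst. Qed.

Lemma dv_id x : dv (fun t => t) x 1.
Proof. exact: is_derive_id. Qed.

Lemma dvB f g x a b : dv f x a -> dv g x b ->
  dv (fun t => f t - g t) x (a - b).
Proof. by move=> df dg; apply: dvD => //; exact: dvN. Qed.

Lemma dv_sqr f x a : dv f x a -> dv (fun t => f t ^+ 2) x (2 * f x * a).
Proof.
move=> df; rewrite (_ : (fun t => _) = (fun t => f t * f t)); last by apply/funext => t; rewrite expr2.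
by apply: dv_eq; [apply: dvM; exact: df|ring].
Qed.

Lemma dv_comp f g x a b : dv f (g x) a -> dv g x b ->
  dv (fun t => f (g t)) x (a * b).
Proof. by move=> df dg; exact: is_derive1_comp. Qed.

Lemma dv_expRN x : dv (fun t => expR (- t)) x (- expR (- x)).
Proof.
apply: dv_eq; first by apply: dv_comp; [exact: is_derive_expR|exact: dvN (dv_id x)].
by rewrite mulrN1.
Qed.

Lemma dvV f x a : f x != 0 -> dv f x a ->
  dv (fun t => (f t)^-1) x (- a / f x ^+ 2).
Proof.
move=> fx0 df; apply: dv_eq; first exact: (is_deriveV fx0 df).
by rewrite /GRing.scale/= mulNr mulNr mulrC.
Qed.

Lemma ctM f g x : ct f x -> ct g x ->
  ct (fun t => f t * g t) x.
Proof. by move=> cf cg; exact: (@continuousM R R f g x). Qed.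

Lemma ctD f g x : ct f x -> ct g x ->
  ct (fun t => f t + g t) x.
Proof. by move=> cf cg; exact: (@continuousD R R R f g x). Qed.

Lemma ctN f x : ct f x -> ct (fun t => - f t) x.
Proof. by move=> cf; exact: (@continuousN R R R f x). Qed.

Lemma ctB f g x : ct f x -> ct g x ->
  ct (fun t => f t - g t) x.
Proof. by move=> cf cg; apply: ctD => //; exact: ctN. Qed.

Lemma ct_cst x c : ct (fun=> c : R) x.
Proof. exact: cst_continuous. Qed.

Lemma ct_id x : ct (fun t => t : R) x.
Proof. by []. Qed.

Lemma ct_sqr f x : ct f x -> ct (fun t => f t ^+ 2) x.
Proof.
move=> cf; rewrite (_ : (fun t => _) = (fun t => f t * f t)); first exact: ctM.
by apply/funext => t; rewrite expr2.
Qed.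

Lemma ctV f x : f x != 0 -> ct f x -> ct (fun t => (f t)^-1) x.
Proof. by move=> f0 cf; exact: (@cvgV R R). Qed.

End derivative_rules.

Section ftc_tools.
Context {R : realType}.
Local Notation mu := (@lebesgue_measure R).
Implicit Types (f p q Phi phi : R -> R) (a b c d : R).

Lemma cont_within a b f : (forall x, a <= x <= b -> ct f x) ->
  {within `[a, b], continuous f}.
Proof.
move=> cf; apply: continuous_in_subspaceT => x; rewrite inE/= in_itv/=; exact: cf.
Qed.

Lemma cont_integrable a b f : (forall x, a <= x <= b -> ct f x) ->
  mu.-integrable `[a, b] (EFin \o f).
Proof.
move=> cf; apply: continuous_compact_integrable; first exact: segment_compact.
exact: cont_within.
Qed.

Lemma ftc_cc Phi phi a b : a < b ->
  (forall x, a <= x <= b -> dv Phi x (phi x)) ->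
  (forall x, a <= x <= b -> ct phi x) ->
  (\int[mu]_(x in `[a, b]) (phi x)%:E = (Phi b - Phi a)%:E)%E.
Proof.
move=> ab dPhi cphi; rewrite EFinB.
have cPhi x : a <= x <= b -> ct Phi x.
  by move=> /dPhi; exact: dv_ct.
apply: continuous_FTC2 => //.
- exact: cont_within.
- split.
  + by move=> x; rewrite in_itv/= => /andP[/ltW ax /ltW xb]; have [] := dPhi x; rewrite ?ax.
  + by apply: cvg_at_right_filter; apply: cPhi; rewrite lexx ltW.
  + by apply: cvg_at_left_filter; apply: cPhi; rewrite lexx ltW.
- move=> x; rewrite in_itv/= => /andP[/ltW ax /ltW xb].
  by rewrite derive1E; have [|_ ->] := dPhi x; rewrite ?ax.
Qed.

Lemma ftc_le p q Phi phi a b : a < b ->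
  (forall x, a <= x <= b -> dv Phi x (phi x)) ->
  (forall x, a <= x <= b -> ct phi x) ->
  (forall x, a <= x <= b -> ct p x) ->
  (forall x, a <= x <= b -> ct q x) ->
  (forall x, a <= x <= b -> p x + phi x <= q x) ->
  (\int[mu]_(x in `[a, b]) (p x)%:E + (Phi b - Phi a)%:E <=
   \int[mu]_(x in `[a, b]) (q x)%:E)%E.
Proof.
move=> ab dPhi cphi cp cq pq; rewrite -(ftc_cc ab dPhi cphi) -integralD_EFin//; last 2 first.
- exact: cont_integrable.
- exact: cont_integrable.
apply: le_integral => //.
- have h : forall x, a <= x <= b -> ct (fun x => p x + phi x) x.
    by move=> x xab; apply: continuousD; [exact: cp|exact: cphi].
  exact: (cont_integrable h).
- exact: cont_integrable.
- by move=> x; rewrite inE/= in_itv/= lee_fin; exact: pq.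
Qed.

Lemma exhaust_le (D : set R) (a_ b_ : R^nat) p (K : \bar R) :
  (forall n, a_ n.+1 <= a_ n) -> (forall n, b_ n <= b_ n.+1) ->
  D = \bigcup_n `[a_ n, b_ n]%classic ->
  measurable_fun D p -> (forall x, D x -> 0 <= p x) ->
  (forall n e, 0 < e -> exists a b, [/\ a <= a_ n, b_ n <= b, `[a, b]%classic `<=` D &
    (\int[mu]_(x in `[a, b]) (p x)%:E <= K + e%:E)%E]) ->
  (\int[mu]_(x in D) (p x)%:E <= K)%E.
Proof.
move=> a_dec b_inc DE mp p0 H.
have nd : nondecreasing_seq (fun n => `[a_ n, b_ n]%classic).
  apply/nondecreasing_seqP => n; apply/subsetPset => x /=; rewrite !in_itv/= => /andP[ax xb].
  by rewrite (le_trans (a_dec n))//= (le_trans xb).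
have sD n : `[a_ n, b_ n]%classic `<=` D by rewrite DE => x; exists n.
have mD : measurable D by rewrite DE; exact: bigcup_measurable.
have m1 n : measurable_fun `[a_ n, b_ n] (EFin \o p).
  by apply/measurable_EFinP; exact: measurable_funS (sD n) mp.
have m2 n x : `[a_ n, b_ n]%classic x -> (0 <= (EFin \o p) x)%E.
  by move=> /sD /p0; rewrite lee_fin.
have cv := @ge0_nondecreasing_set_cvg_integral _ (measurableTypeR R) _
  (fun n => `[a_ n, b_ n]%classic) (EFin \o p) mu nd (fun n => measurable_itv _) m1 m2.
rewrite -DE in cv; rewrite -(cvg_lim _ cv)//.
apply: lime_le; first by apply/cvg_ex; eexists; exact: cv.
apply: nearW => n /=.
apply/lee_addgt0Pr => e e0.
have [a [b [aa bb abD h]]] := H n e e0.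
apply: le_trans h; apply: ge0_subset_integral => //.
- by apply/measurable_EFinP; exact: measurable_funS abD mp.
- by move=> x /abD /p0; rewrite lee_fin.
- move=> x /=; rewrite !in_itv/= => /andP[ax xb].
  by rewrite (le_trans aa)//= (le_trans xb).
Qed.

Lemma exhaust_oy c p (K : \bar R) :
  measurable_fun `]c, +oo[ p -> (forall x, c < x -> 0 <= p x) ->
  (forall a b e, c < a -> a < b -> 0 < e -> exists a' b', [/\ c < a', a' <= a, b <= b' &
    (\int[mu]_(x in `[a', b']) (p x)%:E <= K + e%:E)%E]) ->
  (\int[mu]_(x in `]c, +oo[) (p x)%:E <= K)%E.
Proof.
move=> mp p0 H.
pose a_ n : R := c + (n%:R + 2)^-1; pose b_ n : R := c + n%:R + 1.
have n2 n : 0 < n%:R + 2 :> R by have := ler0n R n; lra.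
have ca n : c < a_ n by rewrite /a_ ltrDl invr_gt0.
have ab n : a_ n < b_ n.
  rewrite /a_ /b_ -addrA ltrD2l; have := ler0n R n.
  have : (n%:R + 2)^-1 < (1 : R) by rewrite invf_lt1//; have := ler0n R n; lra.
  lra.
apply: (@exhaust_le _ a_ b_) => //.
- move=> n; rewrite /a_ lerD2l lef_pV2 ?posrE// -(natr1 n); lra.
- by move=> n; rewrite /b_ -(natr1 n); lra.
- apply/seteqP; split=> [x|x [n _]] /=; rewrite !in_itv/= ?andbT.
    move=> cx; pose N := Num.trunc (Num.max (x - c) (x - c)^-1).
    have M0 : 0 <= Num.max (x - c) (x - c)^-1 by rewrite le_max subr_ge0 ltW.
    have NE := truncnS_gt (Num.max (x - c) (x - c)^-1); rewrite -/N in NE.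
    rewrite gt_max in NE; have {NE} /andP[N1 N2] := NE.
    rewrite -natr1 in N1; rewrite -natr1 in N2.
    exists N => //=; rewrite in_itv/= /a_ /b_; apply/andP; split; last lra.
    rewrite -lerBrDl -[leRHS]invrK lef_pV2 ?posrE ?invr_gt0 ?subr_gt0//; lra.
  by move=> /andP[ax _]; exact: lt_le_trans ax.
- by move=> x /=; rewrite in_itv/= andbT; exact: p0.
- move=> n e e0; have [a [b [ca' aa bb h]]] := H _ _ _ (ca n) (ab n) e0.
  exists a, b; split=> // x /=; rewrite !in_itv/= andbT => /andP[ax _].
  exact: lt_le_trans ax.
Qed.

Lemma exhaust_oo c d p (K : \bar R) : c < d ->
  measurable_fun `]c, d[ p -> (forall x, c < x < d -> 0 <= p x) ->
  (forall a b e, c < a -> a < b -> b < d -> 0 < e ->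
    exists a' b', [/\ c < a', a' <= a, b <= b' & b' < d /\
    (\int[mu]_(x in `[a', b']) (p x)%:E <= K + e%:E)%E]) ->
  (\int[mu]_(x in `]c, d[) (p x)%:E <= K)%E.
Proof.
move=> cd mp p0 H.
pose h n : R := (d - c) * (n%:R + 3)^-1.
pose a_ n : R := c + h n; pose b_ n : R := d - h n.
have n2 n : 0 < n%:R + 3 :> R by have := ler0n R n; lra.
have dc : 0 < d - c by rewrite subr_gt0.
have h0 n : 0 < h n by rewrite /h mulr_gt0// invr_gt0.
have hle n : h n.+1 <= h n.
  by rewrite /h ler_wpM2l ?(ltW dc)// lef_pV2 ?posrE// -(natr1 n); lra.
have h3 n : h n * 3 <= d - c.
  rewrite /h -mulrA ler_piMr ?(ltW dc)// mulrC ler_pdivrMr//; have := ler0n R n; lra.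
have ca n : c < a_ n by rewrite /a_ ltrDl.
have bd n : b_ n < d by rewrite /b_ ltrBlDr ltrDl.
have ab n : a_ n < b_ n by rewrite /a_ /b_; have := h3 n; have := h0 n; lra.
apply: (@exhaust_le _ a_ b_) => //.
- by move=> n; rewrite /a_ lerD2l.
- by move=> n; rewrite /b_ lerD2l lerN2.
- apply/seteqP; split=> [x|x [n _]] /=; rewrite !in_itv/= ?andbT.
    move=> /andP[cx xd]; pose m := Num.min (x - c) (d - x).
    have m0 : 0 < m by rewrite lt_min !subr_gt0 cx.
    pose N := Num.trunc ((d - c) / m).
    have := truncnS_gt ((d - c) / m); rewrite -/N ltr_pdivrMr// => NE.
    have hN : h N <= m.
      rewrite /h ler_pdivrMr// mulrC (le_trans (ltW NE))// ler_wpM2r ?(ltW m0)// -natr1; lra.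
    exists N => //=; rewrite in_itv/= /a_ /b_.
    have [m1 m2] : m <= x - c /\ m <= d - x by split; rewrite /m ge_min lexx ?orbT.
    by apply/andP; split; lra.
  by move=> /andP[ax xb]; rewrite (lt_le_trans _ ax)//= (le_lt_trans xb).
- move=> n e e0; have [a [b [ca' aa bb [bd' hh]]]] := H _ _ _ (ca n) (ab n) (bd n) e0.
  exists a, b; split=> // x /=; rewrite !in_itv/= => /andP[ax xb].
  by rewrite (lt_le_trans _ ax)//= (le_lt_trans xb).
Qed.

End ftc_tools.

Section gamma_weight.
Context {R : realType}.
Variable r : R.
Hypothesis r0 : 0 < r.
Local Notation mu := (@lebesgue_measure R).

Definition gw (s : R) : R := powR s (r - 1) * expR (- s).
Definition gu (s : R) : R := powR s r * expR (- s).

Lemma gw_ge0 s : 0 <= gw s.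
Proof. by rewrite /gw mulr_ge0 ?powR_ge0 ?expR_ge0. Qed.

Lemma gu_ge0 s : 0 <= gu s.
Proof. by rewrite /gu mulr_ge0 ?powR_ge0 ?expR_ge0. Qed.

Lemma measurable_gw : measurable_fun [set: R] gw.
Proof.
apply: measurable_funM; first exact: measurable_powR.
by apply: measurableT_comp => //; exact: measurable_expR.
Qed.

Lemma guE s : 0 < s -> gu s = s * gw s.
Proof.
move=> s0; rewrite /gu /gw mulrA; congr (_ * _).
by rewrite -[X in X * _](powRr1 (ltW s0)) -powRD ?gt_eqF ?implybT// addrC subrK.
Qed.

Lemma dv_gu (s : R) : 0 < s -> dv gu s ((r - s) * gw s).
Proof.
move=> s0; apply: dv_eq; first by apply: dvM; [exact: is_derive1_powR|exact: dv_expRN].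
rewrite /gw.
have -> : powR s r = s * powR s (r - 1).
  by rewrite -[X in X * _](powRr1 (ltW s0)) -powRD ?gt_eqF ?implybT// addrC subrK.
by ring.
Qed.

Lemma ct_gw s : 0 < s -> ct gw s.
Proof.
move=> s0; exact: (dv_ct (dvM (is_derive1_powR (r - 1) s0) (dv_expRN s))).
Qed.

Lemma gu_small e : 0 < e -> exists2 d, 0 < d & forall s, 0 < s -> s <= d -> gu s <= e.
Proof.
move=> e0; exists (powR e r^-1); first exact: powR_gt0.
move=> s s0 sd; rewrite /gu.
have : powR s r <= e.
  rewrite -[leRHS](powRr1 (ltW e0)) -(mulVf (lt0r_neq0 r0)) powRrM.
  by rewrite ge0_ler_powR ?nnegrE ?powR_ge0 ?(ltW r0) ?(ltW s0).
have : expR (- s) <= 1 by rewrite -expR0 ler_expR oppr_le0 ltW.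
by have := powR_ge0 s r; have := expR_ge0 (- s); nra.
Qed.

Lemma powR_le_expR (q : R) : 0 < q -> exists2 M, 0 < M & forall s, 0 < s -> powR s q <= M * expR (s / 2).
Proof.
move=> q0; exists (expR (q * ln (2 * q))); first exact: expR_gt0.
move=> s s0; rewrite /powR gt_eqF// -expRD ler_expR.
have h : 0 < s / (2 * q) by rewrite divr_gt0// mulr_gt0.
have := ln_le_subr1 h; rewrite ln_div ?posrE ?mulr_gt0// => H.
have := ler_wpM2l (ltW q0) H.
have -> : q * (s / (2 * q) - 1) = s / 2 - q by field; rewrite gt_eqF.
lra.
Qed.

Lemma gu_large e b : 0 < e -> exists2 c, b <= c & 0 < c /\ gu c <= e.
Proof.
move=> e0; have [M M0 HM] := powR_le_expR r0.
pose c := Num.max (Num.max b 1) (2 * (M / e)).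
have c1 : 1 <= c by rewrite /c !le_max lexx orbT.
have c0 : 0 < c by lra.
exists c; first by rewrite /c !le_max lexx.
split => //; rewrite /gu.
have h1 := HM c c0.
have h2 : expR (- c) = expR (- (c / 2)) * expR (- (c / 2)).
  by rewrite -expRD; congr expR; lra.
have h3 : expR (c / 2) * expR (- (c / 2)) = 1 by rewrite -expRD subrr expR0.
have h4 : powR c r * expR (- c) <= M * expR (- (c / 2)).
  apply: (@le_trans _ _ (M * expR (c / 2) * expR (- c))).
    by rewrite ler_wpM2r ?expR_ge0.
  by rewrite h2 mulrA -(mulrA M) h3 mulr1.
apply: (le_trans h4).
rewrite expRN ler_pdivrMr ?expR_gt0// mulrC -ler_pdivrMr//.
apply: (@le_trans _ _ (c / 2)).
  by rewrite ler_pdivlMr// mulrC /c le_max lexx orbT.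
by have := @expR_ge1Dx R (c / 2); lra.
Qed.

End gamma_weight.

Section gamma_inequalities.
Context {R : realType}.
Variable r : R.
Hypothesis r0 : 0 < r.
Local Notation mu := (@lebesgue_measure R).
Local Notation w := (gw r).
Local Notation u := (gu r).

Variables (g g' : R -> R).
Hypothesis dg : forall x, dv g x (g' x).
Hypothesis cg' : forall x, ct g' x.

Let cg x : ct g x. Proof. exact: dv_ct. Qed.

Let mcont (f : R -> R) : (forall x, ct f x) -> measurable_fun [set: R] f.
Proof. by move=> cf; apply: continuous_measurable_fun => x; exact: cf. Qed.

Let mw (f : R -> R) (D : set R) : measurable_fun [set: R] f ->
  measurable_fun D (fun s => f s * w s).
Proof.
move=> mf; apply: measurable_funTS; apply: measurable_funM => //.
exact: measurable_gw.
Qed.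

Let mg := mcont cg.
Let mg' := mcont cg'.

Let ms_g'2 : measurable_fun [set: R] (fun s => s * g' s ^+ 2).
Proof. by apply: measurable_funM => //; exact: measurable_funX. Qed.

Let mg2 : measurable_fun [set: R] (fun s => g s ^+ 2).
Proof. exact: measurable_funX. Qed.

Let ms_g2 : measurable_fun [set: R] (fun s => s * g s ^+ 2).
Proof. exact: measurable_funM. Qed.

Lemma sub_pos (a b : R) : 0 < a -> `[a, b]%classic `<=` `]0, +oo[%classic.
Proof.
by move=> a0 x /=; rewrite !in_itv/= andbT => /andP[ax _]; exact: lt_le_trans ax.
Qed.

Lemma int_sub_pos (f : R -> R) (a b : R) : 0 < a -> measurable_fun [set: R] f ->
  (forall s, 0 < s -> 0 <= f s) ->
  (\int[mu]_(s in `[a, b]) (f s)%:E <= \int[mu]_(s in `]0%R, +oo[) (f s)%:E)%E.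
Proof.
move=> a0 mf f0; apply: ge0_subset_integral => //.
- by apply/measurable_EFinP; exact: measurable_funTS.
- by move=> x /=; rewrite in_itv/= andbT lee_fin; exact: f0.
- exact: sub_pos.
Qed.

Let sw_ge0 (s x : R) : 0 <= s -> (0 <= (s * x ^+ 2 * w s)%:E)%E.
Proof.
by move=> s0; rewrite lee_fin; exact: mulr_ge0 (mulr_ge0 s0 (sqr_ge0 x)) (gw_ge0 r s).
Qed.

Let N := (\int[mu]_(s in `]0%R, +oo[) (g s ^+ 2 * w s)%:E)%E.
Let D := (\int[mu]_(s in `]0%R, +oo[) (s * g' s ^+ 2 * w s)%:E)%E.
Let S := (\int[mu]_(s in `]0%R, +oo[) (s * g s ^+ 2 * w s)%:E)%E.

(* With [F = g - g r] and [h = F^2 / (s - r)] one has [(h u)' = (s h' - F^2) w] and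
   [s h' <= s F'^2]: the centre [r] is the zero of the first Laguerre polynomial. *)
Lemma gamma_poincare_off (a b : R) : 0 < a -> a < b -> (r < a \/ b < r) ->
  (\int[mu]_(s in `[a, b]) ((g s - g r) ^+ 2 * w s)%:E
     + ((g b - g r) ^+ 2 * (b - r)^-1 * u b - (g a - g r) ^+ 2 * (a - r)^-1 * u a)%:E
   <= \int[mu]_(s in `[a, b]) (s * g' s ^+ 2 * w s)%:E)%E.
Proof.
move=> a0 ab rab.
have s0 s : a <= s <= b -> 0 < s by move=> /andP[+ _]; exact: lt_le_trans.
have sr s : a <= s <= b -> s - r != 0.
  by move=> /andP[as_ sb]; rewrite subr_eq0; case: rab => h; [rewrite gt_eqF|rewrite lt_eqF]; lra.
pose phi s := (2 * (g s - g r) * g' s * (s - r)^-1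
  + (g s - g r) ^+ 2 * (- 1 * ((s - r)^-1) ^+ 2)) * u s
  + (g s - g r) ^+ 2 * (s - r)^-1 * ((r - s) * w s).
have cF s : ct (fun s => g s - g r) s by apply: ctB => //; exact: ct_cst.
have csr s : ct (fun s => s - r) s by apply: ctB; [exact: ct_id|exact: ct_cst].
have csrV s : a <= s <= b -> ct (fun s => (s - r)^-1) s.
  by move=> sab; apply: ctV => //; exact: sr.
have cw s : a <= s <= b -> ct w s by move=> /s0; exact: ct_gw.
have cu s : a <= s <= b -> ct u s by move=> /s0 h; apply: (dv_ct (dv_gu r0 h)).
apply: (@ftc_le _ (fun s => (g s - g r) ^+ 2 * w s) (fun s => s * g' s ^+ 2 * w s)
  (fun s => (g s - g r) ^+ 2 * (s - r)^-1 * u s) phi) => //.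
- move=> s sab; apply: dvM; last exact/dv_gu/s0.
  apply: dvM.
    apply: dv_eq; first by apply: dv_sqr; apply: dvB; [exact: dg|exact: dv_cst].
    by rewrite subr0.
  apply: dv_eq; first by apply: dvV; [exact: sr|apply: dvB; [exact: dv_id|exact: dv_cst]].
  by rewrite subr0 exprVn.
- move=> s sab; apply: ctD.
    apply: ctM; last exact: cu.
    apply: ctD.
      apply: ctM; last exact: csrV.
      by apply: ctM => //; apply: ctM => //; exact: ct_cst.
    apply: ctM; first exact: ct_sqr.
    by apply: ctM; [exact: ct_cst|apply: ct_sqr; exact: csrV].
  apply: ctM.
    by apply: ctM; [exact: ct_sqr|exact: csrV].
  by apply: ctM; [apply: ctB; [exact: ct_cst|exact: ct_id]|exact: cw].
- by move=> s sab; apply: ctM; [exact: ct_sqr|exact: cw].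
- move=> s sab; apply: ctM; last exact: cw.
  by apply: ctM; [exact: ct_id|exact: ct_sqr].
- move=> s sab; rewrite /phi (guE r0 (s0 _ sab)).
  set F := g s - g r; set k := (s - r)^-1.
  have kE : k * (s - r) = 1 by rewrite mulVf// sr.
  have w0 : 0 <= w s by exact: gw_ge0.
  have -> : F ^+ 2 * w s + ((2 * F * g' s * k + F ^+ 2 * (-1 * k ^+ 2)) * (s * w s) +
    F ^+ 2 * k * ((r - s) * w s)) = s * (2 * (F * k) * g' s - (F * k) ^+ 2) * w s
      + F ^+ 2 * w s * (1 - k * (s - r)) by ring.
  rewrite kE subrr mulr0 addr0 ler_wpM2r// ler_wpM2l ?(ltW (s0 _ sab))//.
  by have := sqr_ge0 (F * k - g' s); nra.
Qed.

Let quot_near e : 0 < e -> exists2 d, 0 < d &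
  forall s, s != r -> `|s - r| < d -> `|(g s - g r) ^+ 2 * (s - r)^-1 * u s| <= e.
Proof.
move=> e0.
have /(is_derive1_caratheodory g r (g' r))[q [qE cq qr]] := dg r.
have c1 : ct (fun s => (g s - g r) * q s * u s) r.
  have cu : ct u r by exact: (dv_ct (dv_gu r0 r0)).
  apply: ctM; last exact: cu.
  by apply: ctM => //; apply: ctB => //; exact: ct_cst.
move/cvgrPdist_le : c1 => /(_ _ e0).
rewrite subrr !mul0r => -[d /= d0 H]; exists d => // s sr sd.
have : ball r d s by rewrite /ball/= distrC.
move/H; rewrite sub0r normrN; congr (`| _ | <= _).
congr (_ * _); rewrite expr2 -!mulrA; congr (_ * _).
by rewrite [in RHS]qE mulfK// subr_eq0.
Qed.

Theorem gamma_pointed_poincare :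
  (\int[mu]_(s in `]0%R, +oo[) ((g s - g r) ^+ 2 * w s)%:E <= D)%E.
Proof.
have mF : measurable_fun [set: R] (fun s => (g s - g r) ^+ 2).
  by apply: measurable_funX; apply: measurable_funB.
have h1 : (\int[mu]_(s in `]0%R, r[) ((g s - g r) ^+ 2 * w s)%:E <=
    \int[mu]_(s in `]0%R, r[) (s * g' s ^+ 2 * w s)%:E)%E.
  apply: exhaust_oo => //.
  - exact: mw.
  - by move=> x _; rewrite mulr_ge0 ?sqr_ge0 ?gw_ge0.
  - move=> a b e a0 ab br e0.
    have [d d0 H] := quot_near e0.
    pose b' := Num.max b (r - d / 2).
    have b'r : b' < r by rewrite /b' gt_max br/=; lra.
    have bb' : b <= b' by rewrite /b' le_max lexx.
    have rb' : r - d / 2 <= b' by rewrite /b' le_max lexx orbT.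
    exists a, b'; split => //; split => //.
    have ab' : a < b' by exact: lt_le_trans bb'.
    have := @gamma_poincare_off a b' a0 ab' (or_intror b'r).
    set I := (X in (X + _)%E); set J := (X in (_ <= X)%E) => IJ.
    have JK : (J <= \int[mu]_(s in `]0%R, r[) (s * g' s ^+ 2 * w s)%:E)%E.
      apply: ge0_subset_integral => //.
      - by apply/measurable_EFinP; exact: mw.
      - move=> x /=; rewrite in_itv/= => /andP[x0 _].
        exact/sw_ge0/ltW.
      - move=> x /=; rewrite !in_itv/= => /andP[ax xb].
        by rewrite (lt_le_trans a0)//= (le_lt_trans xb).
    have Hb := H b'; rewrite lt_eqF// ltr0_norm ?subr_lt0// in Hb.
    have {}Hb := Hb isT ltac:(lra).
    set x := (g b' - g r) ^+ 2 / (b' - r) * u b' in IJ Hb.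
    set y := (g a - g r) ^+ 2 / (a - r) * u a in IJ.
    have y0 : y <= 0.
      rewrite /y mulr_le0_ge0 ?gu_ge0// mulr_ge0_le0 ?sqr_ge0// invr_le0; lra.
    have xe : - e <= x by move: Hb; rewrite ler_norml => /andP[].
    rewrite -leeBlDr//.
    apply: le_trans JK; apply: le_trans IJ.
    by rewrite leeD2l// -EFinN lee_fin; lra.
have h2 : (\int[mu]_(s in `]r, +oo[) ((g s - g r) ^+ 2 * w s)%:E <=
    \int[mu]_(s in `]r, +oo[) (s * g' s ^+ 2 * w s)%:E)%E.
  apply: exhaust_oy => //.
  - exact: mw.
  - by move=> x _; rewrite mulr_ge0 ?sqr_ge0 ?gw_ge0.
  - move=> a b e ra ab e0.
    have [d d0 H] := quot_near e0.
    pose a' := Num.min a (r + d / 2).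
    have ra' : r < a' by rewrite /a' lt_min ra/=; lra.
    have aa' : a' <= a by rewrite /a' ge_min lexx.
    have da' : a' <= r + d / 2 by rewrite /a' ge_min lexx orbT.
    exists a', b; split => //.
    have a'b : a' < b by exact: le_lt_trans ab.
    have a'0 : 0 < a' by exact: lt_trans r0 ra'.
    have := @gamma_poincare_off a' b a'0 a'b (or_introl ra').
    set I := (X in (X + _)%E); set J := (X in (_ <= X)%E) => IJ.
    have JK : (J <= \int[mu]_(s in `]r, +oo[) (s * g' s ^+ 2 * w s)%:E)%E.
      apply: ge0_subset_integral => //.
      - by apply/measurable_EFinP; exact: mw.
      - move=> x /=; rewrite in_itv/= andbT => rx.
        by apply/sw_ge0/ltW; exact: lt_trans rx.
      - move=> x /=; rewrite !in_itv/= andbT => /andP[ax xb].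
        by rewrite (lt_le_trans ra').
    have Hb := H a'; rewrite gt_eqF// gtr0_norm ?subr_gt0// in Hb.
    have {}Hb := Hb isT ltac:(lra).
    set x := (g b - g r) ^+ 2 / (b - r) * u b in IJ.
    set y := (g a' - g r) ^+ 2 / (a' - r) * u a' in IJ Hb.
    have x0 : 0 <= x.
      rewrite /x mulr_ge0 ?gu_ge0// mulr_ge0 ?sqr_ge0// invr_ge0; lra.
    have ye : y <= e by move: Hb; rewrite ler_norml => /andP[].
    rewrite -leeBlDr//.
    apply: le_trans JK; apply: le_trans IJ.
    by rewrite leeD2l// -EFinN lee_fin; lra.
have split_r (f : R -> R) : measurable_fun [set: R] f -> (forall s, 0 < s -> 0 <= f s) ->
    (\int[mu]_(s in `]0%R, +oo[) (f s)%:E = \int[mu]_(s in `]0%R, r[) (f s)%:E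
       + \int[mu]_(s in `]r, +oo[) (f s)%:E)%E.
  move=> mf f0.
  rewrite (@integral_itv_obnd_cbnd _ r); last first.
    by apply/measurable_EFinP; exact: measurable_funTS.
  rewrite -ge0_integral_setU//=.
  - by rewrite -itv_bndbnd_setU// bnd_simp ltW.
  - by apply/measurable_EFinP; exact: measurable_funTS.
  - move=> x [] /=; rewrite in_itv/= ?andbT => h; rewrite lee_fin f0//; first by case/andP: h.
    exact: lt_le_trans h.
  - apply/disj_setPS => x [] /=; rewrite !in_itv/= andbT => /andP[_ xr] rx.
    by move: (lt_le_trans xr rx); rewrite ltxx.
rewrite /D !split_r; [exact: leeD| | | |].
- exact: mw.
- by move=> s /ltW s0; have := sw_ge0 (g' s) s0; rewrite lee_fin.
- exact: mw.
- by move=> s s0; rewrite mulr_ge0 ?sqr_ge0 ?gw_ge0.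
Qed.

Let int_lin (f h : R -> R) (x y a b : R) : 0 < a -> 0 <= x -> 0 <= y ->
  measurable_fun [set: R] f -> measurable_fun [set: R] h ->
  (forall s, 0 < s -> 0 <= f s) -> (forall s, 0 < s -> 0 <= h s) ->
  (\int[mu]_(s in `[a, b]) (x * f s + y * h s)%:E <=
   x%:E * \int[mu]_(s in `]0%R, +oo[) (f s)%:E + y%:E * \int[mu]_(s in `]0%R, +oo[) (h s)%:E)%E.
Proof.
move=> a0 x0 y0 mf mh f0 h0.
have pos s : `[a, b]%classic s -> 0 < s.
  by rewrite /= in_itv/= => /andP[as_ _]; exact: lt_le_trans as_.
have mfe (D' : set R) : measurable_fun D' (EFin \o f) by apply/measurable_EFinP; exact: measurable_funTS.
have mhe (D' : set R) : measurable_fun D' (EFin \o h) by apply/measurable_EFinP; exact: measurable_funTS.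
under eq_integral do rewrite EFinD !EFinM.
rewrite ge0_integralD//.
- rewrite !ge0_integralZl_EFin//.
    by apply: leeD; rewrite lee_wpmul2l ?lee_fin//; exact: int_sub_pos.
  all: try by move=> s sab; rewrite lee_fin; first [exact: f0 (pos _ sab)|exact: h0 (pos _ sab)].
  exact: mhe.
  exact: mfe.
- by move=> s sab; rewrite -EFinM lee_fin; exact: mulr_ge0 x0 (f0 _ (pos _ sab)).
- by apply: measurable_funeM; exact: mfe.
- by move=> s sab; rewrite -EFinM lee_fin; exact: mulr_ge0 y0 (h0 _ (pos _ sab)).
- by apply: measurable_funeM; exact: mhe.
Qed.

Let gw_pos s x : 0 < s -> 0 <= x ^+ 2 * w s.
Proof. by move=> _; exact: mulr_ge0 (sqr_ge0 x) (gw_ge0 r s). Qed.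

Let sgw_pos s x : 0 < s -> 0 <= s * x ^+ 2 * w s.
Proof. by move=> /ltW/sw_ge0-/(_ x); rewrite lee_fin. Qed.

Let cw s : 0 < s -> ct w s. Proof. exact: ct_gw. Qed.

Let cu s : 0 < s -> ct u s. Proof. by move=> s0; exact: dv_ct (dv_gu r0 s0). Qed.

Let dg2u s : 0 < s -> dv (fun s => g s ^+ 2 * u s) s
  (2 * g s * g' s * u s + g s ^+ 2 * ((r - s) * w s)).
Proof. by move=> s0; apply: dvM; [exact: dv_sqr|exact: dv_gu]. Qed.

Let cdg2u s : 0 < s ->
  ct (fun s => 2 * g s * g' s * u s + g s ^+ 2 * ((r - s) * w s)) s.
Proof.
move=> s0; apply: ctD.
  by apply: ctM; [apply: ctM => //; apply: ctM => //; exact: ct_cst|exact: cu].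
apply: ctM; first exact: ct_sqr.
by apply: ctM; [apply: ctB; [exact: ct_cst|exact: ct_id]|exact: cw].
Qed.

Let cg2w s : 0 < s -> ct (fun s => g s ^+ 2 * w s) s.
Proof. by move=> s0; apply: ctM; [exact: ct_sqr|exact: cw]. Qed.

Let csg2w s : 0 < s -> ct (fun s => s * g s ^+ 2 * w s) s.
Proof.
by move=> s0; apply: ctM; [apply: ctM; [exact: ct_id|exact: ct_sqr]|exact: cw].
Qed.

Let csg'2w s : 0 < s -> ct (fun s => s * g' s ^+ 2 * w s) s.
Proof.
by move=> s0; apply: ctM; [apply: ctM; [exact: ct_id|exact: ct_sqr]|exact: cw].
Qed.

Let ctlin x y (f h : R -> R) s : ct f s -> ct h s -> ct (fun s => x * f s + y * h s) s.
Proof. by move=> cf ch; apply: ctD; apply: ctM => //; exact: ct_cst. Qed.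

Variable K : R.
Hypothesis gK : forall s, `|g s| <= K.

Let g2K s : g s ^+ 2 <= K ^+ 2.
Proof. by rewrite -real_normK ?num_real// lerXn2r ?nnegrE// (le_trans _ (gK s)). Qed.

Lemma gamma_first_moment_le : (S <= (2 * r)%:E * N + 4%:E * D)%E.
Proof.
apply: exhaust_oy.
- exact: mw.
- by move=> s s0; exact: sgw_pos.
move=> a b e a0 ab e0.
have K1 : 0 < 2 * K ^+ 2 + 1 by have := sqr_ge0 K; lra.
have [d d0 H] := gu_small r0 (divr_gt0 e0 K1).
pose a' := Num.min a d.
have a'0 : 0 < a' by rewrite /a' lt_min a0.
have a'a : a' <= a by rewrite /a' ge_min lexx.
have a'd : a' <= d by rewrite /a' ge_min lexx orbT.
have a'b : a' < b by exact: le_lt_trans ab.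
exists a', b; split => //.
have pos s : a' <= s <= b -> 0 < s by move=> /andP[+ _]; exact: lt_le_trans.
have h := @ftc_le _ (fun s => s * g s ^+ 2 * w s)
  (fun s => (2 * r) * (g s ^+ 2 * w s) + 4 * (s * g' s ^+ 2 * w s))
  (fun s => 2 * (g s ^+ 2 * u s))
  (fun s => 0 * (g s ^+ 2 * u s) + 2 * (2 * g s * g' s * u s + g s ^+ 2 * ((r - s) * w s))) a' b a'b.
have {h}h := h (fun s sab => dvM (dv_cst _ _) (dg2u (pos s sab))).
have {h}h := h (fun s sab => ctD (ctM (@ct_cst R _ _) (ctM (ct_sqr (@cg s)) (cu (pos s sab))))
   (ctM (@ct_cst R _ _) (cdg2u (pos s sab)))).
have {h}h := h (fun s sab => csg2w (pos s sab))
  (fun s sab => @ctlin _ _ _ _ _ (cg2w (pos s sab)) (csg'2w (pos s sab))).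
have {}h := h _.
have hp s : a' <= s <= b -> s * g s ^+ 2 * w s + (0 * (g s ^+ 2 * u s) +
    2 * (2 * g s * g' s * u s + g s ^+ 2 * ((r - s) * w s))) <=
    2 * r * (g s ^+ 2 * w s) + 4 * (s * g' s ^+ 2 * w s).
  move=> sab; rewrite (guE r0 (pos _ sab)) mul0r add0r -subr_ge0.
  have -> : 2 * r * (g s ^+ 2 * w s) + 4 * (s * g' s ^+ 2 * w s) -
     (s * g s ^+ 2 * w s + 2 * (2 * g s * g' s * (s * w s) + g s ^+ 2 * ((r - s) * w s)))
     = s * (2 * g' s - g s) ^+ 2 * w s by ring.
  exact/sgw_pos/pos.
have {h hp} := h hp.
set I := (X in (X + _)%E) => h.
have x0 : 0 <= 2 * (g b ^+ 2 * u b).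
  by apply: mulr_ge0 => //; exact: mulr_ge0 (sqr_ge0 _) (gu_ge0 _ _).
have ye : 2 * (g a' ^+ 2 * u a') <= e.
  have := H _ a'0 a'd; rewrite ler_pdivlMr// => ue.
  have := g2K a'; have := gu_ge0 r a'; have := sqr_ge0 (g a'); nra.
rewrite -leeBlDr//.
apply: (le_trans _ (le_trans h _)).
  by rewrite leeD2l// -EFinN lee_fin; lra.
apply: int_lin => //.
- by rewrite mulr_ge0// ltW.
- exact: mw.
- exact: mw.
- by move=> s s0; exact: gw_pos.
- by move=> s s0; exact: sgw_pos.
Qed.

Lemma gamma_pointwise_le x : 0 < x -> ((g x ^+ 2 * u x)%:E <= D + 2%:E * S)%E.
Proof.
move=> x0; apply/lee_addgt0Pr => e e0.
have K1 : 0 < K ^+ 2 + 1 by have := sqr_ge0 K; lra.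
have [b xb [b0 ub]] := gu_large r0 (x + 1) (divr_gt0 e0 K1).
have {}xb : x < b by lra.
have pos s : x <= s <= b -> 0 < s by move=> /andP[+ _]; exact: lt_le_trans.
have h := @ftc_le _ (fun=> 0)
  (fun s => 1 * (s * g' s ^+ 2 * w s) + 2 * (s * g s ^+ 2 * w s))
  (fun s => - (g s ^+ 2 * u s))
  (fun s => - (2 * g s * g' s * u s + g s ^+ 2 * ((r - s) * w s))) x b xb.
have {h}h := h (fun s sab => dvN (dg2u (pos s sab))) (fun s sab => ctN (cdg2u (pos s sab))).
have {h}h := h (fun s sab => @ct_cst R _ _)
  (fun s sab => @ctlin _ _ _ _ _ (csg'2w (pos s sab)) (csg2w (pos s sab))).
have hp s : x <= s <= b -> 0 - (2 * g s * g' s * u s + g s ^+ 2 * ((r - s) * w s)) <=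
    1 * (s * g' s ^+ 2 * w s) + 2 * (s * g s ^+ 2 * w s).
  move=> sab; rewrite (guE r0 (pos _ sab)) -subr_ge0.
  have -> : 1 * (s * g' s ^+ 2 * w s) + 2 * (s * g s ^+ 2 * w s) -
    (0 - (2 * g s * g' s * (s * w s) + g s ^+ 2 * ((r - s) * w s))) =
    s * (g' s + g s) ^+ 2 * w s + r * (g s ^+ 2 * w s) by ring.
  by apply: addr_ge0; [exact/sgw_pos/pos|exact: mulr_ge0 (ltW r0) (gw_pos _ (pos _ sab))].
have {hp}h := h hp.
rewrite integral0_eq ?add0e// in h.
apply: (@le_trans _ _ ((- (g b ^+ 2 * u b) - - (g x ^+ 2 * u x))%:E + e%:E)%E).
  rewrite -EFinD lee_fin.
  have : g b ^+ 2 * u b <= e.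
    move: ub; rewrite ler_pdivlMr// => ue.
    have := g2K b; have := gu_ge0 r b; have := sqr_ge0 (g b); nra.
  lra.
rewrite leeD2r//; apply: (le_trans h).
rewrite -[X in (_ <= X + _)%E]mul1e; apply: int_lin => //.
- exact: mw.
- exact: mw.
- by move=> s s0; exact: sgw_pos.
- by move=> s s0; exact: sgw_pos.
Qed.

Definition ell (s : R) := ln (1 + s^-1).

Lemma ell_ge0 s : 0 < s -> 0 <= ell s.
Proof. by move=> s0; rewrite /ell ln_ge0// lerDl invr_ge0 ltW. Qed.

Lemma ell_le s : 0 < s -> s * ell s <= 1.
Proof.
move=> s0; have p : 0 < 1 + s^-1 by rewrite addr_gt0 ?invr_gt0.
have := ln_le_subr1 p; rewrite -/(ell s) => h.
have : s * s^-1 = 1 by rewrite divff ?gt_eqF.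
nra.
Qed.

Lemma ell_sqr_le s : 0 < s -> s * ell s ^+ 2 <= 4.
Proof.
move=> s0; pose q := Num.sqrt s; have q0 : 0 < q by rewrite sqrtr_gt0.
have qs : q ^+ 2 = s by rewrite sqr_sqrtr// ltW.
have qV : q * q^-1 = 1 by rewrite divff ?gt_eqF.
have p : 0 < 1 + q^-1 by rewrite addr_gt0 ?invr_gt0.
have p' : 0 < 1 + s^-1 by rewrite addr_gt0 ?invr_gt0.
have h : ell s <= 2 * q^-1.
  have -> : 2 * q^-1 = 2 * (1 + q^-1 - 1) by ring.
  apply: le_trans (_ : 2 * ln (1 + q^-1) <= _); last by rewrite ler_wpM2l// ln_le_subr1.
  have -> : 2 * ln (1 + q^-1) = ln ((1 + q^-1) ^+ 2) by rewrite lnXn// mulr_natl.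
  rewrite ler_ln ?posrE ?exprn_gt0// -qs -exprVn.
  have : 0 < q^-1 by rewrite invr_gt0.
  nra.
have := ell_ge0 s0; rewrite -{2}qs; set l := ell _ in h *; move=> l0.
have : q * l <= 2 by apply: le_trans (_ : q * (2 * q^-1) <= _); [rewrite ler_wpM2l ?(ltW q0)|nra].
move=> ql; have ql0 : 0 <= q * l by rewrite mulr_ge0// ltW.
rewrite -exprMn (_ : 4 = 2 ^+ 2 :> R); last by ring.
by rewrite lerXn2r ?nnegrE.
Qed.

Let dell s : 0 < s -> dv ell s ((1 + s^-1)^-1 * (0 + - 1 / s ^+ 2)).
Proof.
move=> s0; have p : 0 < 1 + s^-1 by rewrite addr_gt0 ?invr_gt0.
apply: (@dv_comp _ (@ln R) (fun s => 1 + s^-1)); first exact: is_derive1_ln.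
by apply: dvD; [exact: dv_cst|apply: dvV; [rewrite gt_eqF|exact: dv_id]].
Qed.

Lemma measurable_ell : measurable_fun (`]0%R, +oo[%classic : set R) ell.
Proof.
apply: open_continuous_measurable_fun => //.
by move=> x; rewrite inE/= in_itv/= andbT => /dell; exact: dv_ct.
Qed.

Lemma gamma_log_moment_le :
  (\int[mu]_(s in `]0%R, +oo[) (r * (g s ^+ 2 * (ell s * w s)))%:E <= 6%:E * N + D)%E.
Proof.
apply: exhaust_oy.
- apply: measurable_funM => //; apply: measurable_funM; first exact: measurable_funTS.
  apply: measurable_funM; first exact: measurable_ell.
  by apply: measurable_funTS; exact: measurable_gw.
- move=> s s0; apply: mulr_ge0 (ltW r0) _; apply: mulr_ge0 (sqr_ge0 _) _.
  exact: mulr_ge0 (ell_ge0 s0) (gw_ge0 r s).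
move=> a b e a0 ab e0.
have K1 : 0 < K ^+ 2 + 1 by have := sqr_ge0 K; lra.
have [b' bb' [b'0 ub]] := gu_large r0 (b + 1) (divr_gt0 e0 K1).
have b'1 : 1 <= b' by have := lt_trans a0 ab; lra.
have {}bb' : b <= b' by lra.
have ab' : a < b' by exact: lt_le_trans bb'.
exists a, b'; split => //.
have pos s : a <= s <= b' -> 0 < s by move=> /andP[+ _]; exact: lt_le_trans.
pose phi s := - ((2 * g s * g' s * u s + g s ^+ 2 * ((r - s) * w s)) * ell s
   + g s ^+ 2 * u s * ((1 + s^-1)^-1 * (0 + - 1 / s ^+ 2))).
have cell s : 0 < s -> ct ell s by move=> /dell; exact: dv_ct.
have h := @ftc_le _ (fun s => r * (g s ^+ 2 * (ell s * w s)))
  (fun s => 6 * (g s ^+ 2 * w s) + 1 * (s * g' s ^+ 2 * w s))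
  (fun s => - (g s ^+ 2 * u s * ell s)) phi a b' ab'.
have {h}h := h (fun s sab => dvN (dvM (dg2u (pos s sab)) (dell (pos s sab)))).
have {h}h : (\int[mu]_(x in `[a, b']) (r * (g x ^+ 2 * (ell x * w x)))%:E +
    (- (g b' ^+ 2 * u b' * ell b') - - (g a ^+ 2 * u a * ell a))%:E <=
    \int[mu]_(x in `[a, b']) (6 * (g x ^+ 2 * w x) + 1 * (x * g' x ^+ 2 * w x))%:E)%E.
  apply: h.
  - move=> s sab; have s0 := pos s sab; apply: ctN; apply: ctD.
      by apply: ctM; [exact: cdg2u|exact: cell].
    apply: ctM; first by apply: ctM; [exact: ct_sqr|exact: cu].
    apply: ctM.
      apply: ctV; first by rewrite gt_eqF// addr_gt0 ?invr_gt0.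
      by apply: ctD; [exact: ct_cst|apply: ctV; [rewrite gt_eqF|exact: ct_id]].
    apply: ctD; first exact: ct_cst.
    apply: ctM; first exact: ct_cst.
    by apply: ctV; [rewrite expf_neq0// gt_eqF|apply: ct_sqr; exact: ct_id].
  - move=> s sab; have s0 := pos s sab; apply: ctM; first exact: ct_cst.
    apply: ctM; first exact: ct_sqr.
    by apply: ctM; [exact: cell|exact: cw].
  - by move=> s sab; have s0 := pos s sab; apply: ctlin; [exact: cg2w|exact: csg'2w].
  - move=> s sab; have s0 := pos s sab; rewrite /phi (guE r0 s0) add0r.
    set l := ell s; have l0 := ell_ge0 s0; have l1 := ell_le s0; have l2 := ell_sqr_le s0.
    rewrite -/l in l0 l1 l2.
    set X := (1 + s^-1)^-1 * _.
    have sX : s * X = - (s + 1)^-1.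
      by rewrite /X; field; rewrite !gt_eqF//; lra.
    have sV : (s + 1)^-1 <= 1 by rewrite invf_le1//; lra.
    rewrite -subr_ge0.
    have -> : 6 * (g s ^+ 2 * w s) + 1 * (s * g' s ^+ 2 * w s) -
      (r * (g s ^+ 2 * (l * w s)) + - ((2 * g s * g' s * (s * w s) + g s ^+ 2 * ((r - s) * w s)) * l
         + g s ^+ 2 * (s * w s) * X)) =
      (s * (g' s + g s * l) ^+ 2 + g s ^+ 2 * (6 - s * l - s * l ^+ 2 + s * X)) * w s by ring.
    apply: mulr_ge0 _ (gw_ge0 r s); apply: addr_ge0.
      exact: mulr_ge0 (ltW s0) (sqr_ge0 _).
    by apply: mulr_ge0 (sqr_ge0 _) _; rewrite sX; lra.
set I := (X in (X + _)%E) in h *.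
have x0 : 0 <= g a ^+ 2 * u a * ell a.
  exact: mulr_ge0 (mulr_ge0 (sqr_ge0 _) (gu_ge0 _ _)) (ell_ge0 a0).
have ye : g b' ^+ 2 * u b' * ell b' <= e.
  have l1 : ell b' <= 1 by have := ell_le b'0; have := ell_ge0 b'0; nra.
  have h1 : g b' ^+ 2 * u b' <= e.
    move: ub; rewrite ler_pdivlMr// => ue.
    have := g2K b'; have := gu_ge0 r b'; have := sqr_ge0 (g b'); nra.
  have h2 := mulr_ge0 (sqr_ge0 (g b')) (gu_ge0 r b').
  by have := ell_ge0 b'0; nra.
rewrite -leeBlDr//.
apply: (le_trans _ (le_trans h _)).
  by rewrite leeD2l// -EFinN lee_fin; lra.
rewrite -[X in (_ <= _ + X)%E]mul1e; apply: int_lin => //.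
- exact: mw.
- exact: mw.
- by move=> s s0; exact: gw_pos.
- by move=> s s0; exact: sgw_pos.
Qed.

End gamma_inequalities.

Section density.
Context d (T : measurableType d) (R : realType).
Variables (m nu : {measure set T -> \bar R}) (D : set T) (c : R) (w : T -> R).
Hypotheses (mD : measurable D) (mw : measurable_fun [set: T] w).
Hypothesis w0 : forall x, 0 <= w x.
Hypothesis nuE : forall A, measurable A ->
  nu A = (c%:E * \int[m]_(x in A `&` D) (w x)%:E)%E.

Import HBNNSimple.

Let integral_density_nnsfun (h : {nnsfun T >-> R}) :
  (\int[nu]_x (h x)%:E = c%:E * \int[m]_(x in D) (h x * w x)%:E)%E.
Proof.
have mhk k : measurable (h @^-1` [set k]) by exact: measurable_sfunP.
transitivity (\sum_(k \in range h) k%:E * nu (h @^-1` [set k]))%E.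
  by rewrite integralT_nnsfun sintegralE.
transitivity (\sum_(k \in range h) c%:E * \int[m]_(x in D) (k * \1_(h @^-1` [set k]) x * w x)%:E)%E.
  apply: eq_fsbigr => k; rewrite inE => -[x _ <-].
  rewrite nuE// muleCA; congr (_ * _)%E.
  rewrite setIC integral_mkcondr.
  under [RHS]eq_integral do rewrite -mulrA EFinM.
  rewrite ge0_integralZl_EFin//.
  - by congr (_ * _)%E; apply: eq_integral => y _; rewrite patchE indicE; case: ifPn; rewrite ?mul1r ?mul0r.
  - by move=> y _; rewrite lee_fin mulr_ge0.
  - apply/measurable_EFinP; apply: measurable_funTS; apply: measurable_funM => //.
rewrite -ge0_mule_fsumr; last first.
  move=> k; apply: integral_ge0 => x _.
  by have := nnfun_muleindic_ge0 h k x; rewrite !lee_fin => hk; exact: mulr_ge0.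
congr (_ * _)%E.
rewrite -ge0_integral_fsum//.
- apply: eq_integral => x _; rewrite fsumEFin//; congr EFin.
  rewrite [in RHS](fimfunE h x).
  by rewrite mulr_fsuml.
- move=> k; apply/measurable_EFinP; apply: measurable_funTS.
  by apply: measurable_funM => //; apply: measurable_funM.
- by move=> k x _; have := nnfun_muleindic_ge0 h k x; rewrite !lee_fin => hk; exact: mulr_ge0.
Qed.

Lemma integral_density (h : T -> R) : measurable_fun [set: T] h -> (forall x, 0 <= h x) ->
  (\int[nu]_x (h x)%:E = c%:E * \int[m]_(x in D) (h x * w x)%:E)%E.
Proof.
move=> mh h0.
have meh : measurable_fun [set: T] (EFin \o h) by exact/measurable_EFinP.
pose h_ := nnsfun_approx measurableT meh.
have cv x : (EFin \o h_^~ x) n @[n --> \oo] --> (h x)%:E.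
  by apply: cvg_nnsfun_approx => // y _; rewrite /= lee_fin.
have cvw x : ((h_ n x * w x)%:E)%E @[n --> \oo] --> (h x * w x)%:E.
  under eq_fun do rewrite EFinM.
  rewrite EFinM; apply: cvgeZr => //; exact: cv.
have -> : (\int[nu]_x (h x)%:E = \int[nu]_x limn (fun n => (h_ n x)%:E))%E.
  by apply: eq_integral => x _; apply/esym/cvg_lim => //; exact: cv.
have -> : (\int[m]_(x in D) (h x * w x)%:E = \int[m]_(x in D) limn (fun n => (h_ n x * w x)%:E))%E.
  by apply: eq_integral => x _; apply/esym/cvg_lim => //; exact: cvw.
rewrite monotone_convergence//; last 3 first.
- by move=> n; exact/measurable_EFinP.
- by move=> n x _; rewrite lee_fin.
- by move=> x _ a b ab; rewrite lee_fin; exact/lefP/nd_nnsfun_approx.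
rewrite monotone_convergence//; last 3 first.
- by move=> n; apply/measurable_EFinP; apply: measurable_funTS; exact: measurable_funM.
- by move=> n x _; rewrite lee_fin mulr_ge0.
- move=> x _ a b ab; rewrite lee_fin ler_wpM2r//; exact/lefP/nd_nnsfun_approx.
under eq_fun do rewrite integral_density_nnsfun.
rewrite limeMl//.
apply: ereal_nondecreasing_is_cvgn => a b ab; apply: ge0_le_integral => //.
- by move=> x _; rewrite lee_fin mulr_ge0.
- by apply/measurable_EFinP; apply: measurable_funTS; exact: measurable_funM.
- by apply/measurable_EFinP; apply: measurable_funTS; exact: measurable_funM.
- move=> x _; rewrite lee_fin ler_wpM2r//; exact/lefP/nd_nnsfun_approx.
Qed.

End density.

Section gamma_mass.
Context {R : realType}.
Local Notation mu := (@lebesgue_measure R).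
Implicit Types r : R.

Definition Gw r : \bar R := (\int[mu]_(s in `]0%R, +oo[) (gw r s)%:E)%E.

Lemma Gw_ge0 r : (0 <= Gw r)%E.
Proof. by apply: integral_ge0 => s _; rewrite lee_fin gw_ge0. Qed.

(* [(s / (1 + s)) ^ r / r] has derivative [s ^ (r - 1) (1 + s) ^ (- r - 1)], which
   dominates the Gamma weight up to the constant [e ^ c]. *)
Lemma Gw_le_gen r c : 0 < r -> (forall s, 0 < s -> (r + 1) * ln (1 + s) <= s + c) ->
  (Gw r <= (expR c / r)%:E)%E.
Proof.
move=> r0 Hc; apply: exhaust_oy.
- by apply: measurable_funTS; exact: measurable_gw.
- by move=> s _; exact: gw_ge0.
move=> a b e a0 ab e0; exists a, b; split => //.
have pos s : a <= s <= b -> 0 < s by move=> /andP[+ _]; exact: lt_le_trans.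
pose k (s : R) := s * (1 + s)^-1.
pose dk (s : R) := 1 * (1 + s)^-1 + s * (- (0 + 1) / (1 + s) ^+ 2).
have k0 s : 0 < s -> 0 < k s by move=> s0; rewrite /k divr_gt0//; lra.
have dkP s : 0 < s -> dv k s (dk s).
  move=> s0; apply: dvM; first exact: dv_id.
  apply: (@dvV _ (fun s => 1 + s)); first by rewrite gt_eqF//; lra.
  by apply: dvD; [exact: dv_cst|exact: dv_id].
have dP s : 0 < s -> dv (fun s => powR (k s) r) s (r * powR (k s) (r - 1) * dk s).
  move=> s0; have h := @dv_comp R (@powR R ^~ r) k s _ _ (is_derive1_powR r (k0 _ s0)) (dkP _ s0).
  exact: h.
pose C := expR c / r.
have h := @ftc_le _ (gw r) (fun=> 0) (fun s => - (C * powR (k s) r))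
   (fun s => - (0 * powR (k s) r + C * (r * powR (k s) (r - 1) * dk s))) a b ab.
have {h}h : (\int[mu]_(x in `[a, b]) (gw r x)%:E +
    (- (C * powR (k b) r) - - (C * powR (k a) r))%:E <= \int[mu]_(x in `[a, b]) 0%:E)%E.
  apply: h.
  - by move=> s /pos s0; apply: dvN; apply: dvM; [exact: dv_cst|exact: dP].
  - move=> s /pos s0; have ck : ct k s by exact: dv_ct (dkP _ s0).
    have ci : ct (fun s => (1 + s)^-1) s.
      apply: (@ctV _ (fun s => 1 + s)); first by rewrite gt_eqF//; lra.
      by apply: ctD; [exact: ct_cst|exact: ct_id].
    apply: ctN; apply: ctD.
      by apply: ctM; [exact: ct_cst|exact: dv_ct (dP _ s0)].
    apply: ctM; first exact: ct_cst.
    apply: ctM.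
      apply: ctM; first exact: ct_cst.
      apply: (@dv_ct _ (fun s => powR (k s) (r - 1)) s (((r - 1) * powR (k s) (r - 1 - 1)) * dk s)).
      have h := @dv_comp R (@powR R ^~ (r - 1)) k s _ _ (is_derive1_powR (r - 1) (k0 _ s0)) (dkP _ s0).
      exact: h.
    apply: ctD; first by apply: ctM; [exact: ct_cst|].
    apply: ctM; first exact: ct_id.
    apply: ctM; first exact: ct_cst.
    apply: (@ctV _ (fun s => (1 + s) ^+ 2)); first by rewrite gt_eqF// exprn_gt0//; lra.
    by apply: ct_sqr; apply: ctD; [exact: ct_cst|exact: ct_id].
  - by move=> s /pos s0; exact: ct_gw.
  - by move=> s _; exact: ct_cst.
  - move=> s /pos s0; rewrite mul0r add0r subr_le0.
    have s1 : 0 < 1 + s by lra.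
    have dkE : dk s = expR (- (2 * ln (1 + s))).
      rewrite expRN mulr_natl -lnXn// lnK ?posrE ?exprn_gt0// /dk.
      by field; rewrite gt_eqF.
    have kE : powR (k s) (r - 1) = powR s (r - 1) * expR (- ((r - 1) * ln (1 + s))).
      rewrite /k powRM ?(ltW s0)// ?invr_ge0 ?(ltW s1)//; congr (_ * _).
      by rewrite /powR gt_eqF ?invr_gt0// lnV ?posrE// mulrN.
    have -> : C * (r * powR (k s) (r - 1) * dk s) = expR c * powR (k s) (r - 1) * dk s.
      by rewrite /C; field; rewrite gt_eqF.
    rewrite dkE kE /gw (mulrC (expR c)) -!mulrA ler_wpM2l ?powR_ge0// -!expRD ler_expR.
    by have := Hc _ s0; lra.
rewrite [X in (_ <= X)%E]integral0_eq// in h.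
have C0 : 0 <= C by rewrite /C divr_ge0 ?expR_ge0 ?(ltW r0).
have kb : powR (k b) r <= 1.
  have b0 : 0 < b by exact: lt_trans ab.
  apply: (@le_trans _ _ (powR 1 r)); last by rewrite powR1.
  rewrite ge0_ler_powR ?nnegrE ?(ltW r0)//; first exact/ltW/k0.
  by rewrite /k ler_pdivrMr; lra.
have ka := powR_ge0 (k a) r.
apply: (@le_trans _ _ (C%:E)); last by rewrite leeDl// lee_fin ltW.
rewrite -[leRHS]add0e -leeBlDr//.
apply: le_trans h; rewrite leeD2l// -EFinN lee_fin.
nra.
Qed.

Lemma Gw_le r : 0 < r -> r <= 1 -> (Gw r <= (4 / r)%:E)%E.
Proof.
move=> r0 r1; rewrite -[4](@lnK R) ?posrE//; apply: Gw_le_gen => // s s0.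
have s1 : 0 < (1 + s) / 2 by rewrite divr_gt0//; lra.
have := ln_le_subr1 s1; rewrite ln_div ?posrE//; last lra.
have -> : ln 4 = 2 * ln 2 :> R by rewrite (_ : 4 = 2 ^+ 2 :> R) ?lnXn ?mulr_natl//; ring.
have l0 : 0 <= ln (1 + s) by rewrite ln_ge0//; lra.
move=> h; nra.
Qed.

Lemma Gw_lty r : 0 < r -> (Gw r < +oo)%E.
Proof.
move=> r0; have q0 : 0 < r + 1 by lra.
apply: (le_lt_trans (@Gw_le_gen r (1 + (r + 1) * ln (r + 1)) r0 _)); last exact: ltry.
move=> s s0; have s1 : 0 < 1 + s by lra.
have := ln_le_subr1 (divr_gt0 s1 q0); rewrite ln_div ?posrE// => /(ler_wpM2l (ltW q0)).
have -> : (r + 1) * ((1 + s) / (r + 1) - 1) = s - r by field; rewrite gt_eqF.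
lra.
Qed.

Lemma Gw_gt0 r : (0 < Gw r)%E.
Proof.
pose k := expR (- (`|r - 1| + 2)).
have k0 : 0 < k by exact: expR_gt0.
apply: (@lt_le_trans _ _ (k%:E)); first by rewrite lte_fin.
apply: (@le_trans _ _ (\int[mu]_(s in `[1%R, 2%R]) (gw r s)%:E)%E); last first.
  apply: ge0_subset_integral => //.
  - by apply/measurable_EFinP; apply: measurable_funTS; exact: measurable_gw.
  - by move=> s _; rewrite lee_fin gw_ge0.
  - by move=> s /=; rewrite !in_itv/= andbT => /andP[+ _]; apply: lt_le_trans.
apply: (@le_trans _ _ (\int[mu]_(s in `[1%R, 2%R]) k%:E)%E).
  rewrite integral_cst//= lebesgue_measure_itv/= lte_fin ltr1n.
  by rewrite -EFinB -EFinM lee_fin; lra.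
apply: ge0_le_integral => //.
- by move=> s _; rewrite lee_fin ltW.
- by apply/measurable_EFinP; apply: measurable_funTS; exact: measurable_gw.
- move=> s /=; rewrite in_itv/= => /andP[s1 s2]; rewrite lee_fin /gw.
  have s0 : 0 < s by lra.
  rewrite /powR gt_eqF// -expRD ler_expR.
  have l0 : 0 <= ln s by rewrite ln_ge0.
  have l1 : ln s <= 1 by have := ln_le_subr1 s0; lra.
  have : - `|r - 1| <= (r - 1) * ln s.
    have := ler_norm (- (r - 1)); rewrite normrN => h.
    have := normr_ge0 (r - 1); nra.
  lra.
Qed.

Lemma fine_Gw r : 0 < r -> (fine (Gw r))%:E = Gw r.
Proof. by move=> r0; rewrite fineK// ge0_fin_numE ?Gw_ge0// Gw_lty. Qed.

Lemma fine_Gw_gt0 r : 0 < r -> 0 < fine (Gw r).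
Proof. by move=> r0; rewrite -lte_fin fine_Gw// Gw_gt0. Qed.

Lemma Gamma_fnE r : Gamma_fn r = Gw r.
Proof.
rewrite /Gamma_fn /Gw integral_itv_obnd_cbnd//; last first.
  by apply/measurable_EFinP; apply: measurable_funTS; exact: measurable_gw.
by congr integral; apply/seteqP; split=> x /=; rewrite in_itv/= andbT.
Qed.

End gamma_mass.

Section log_sobolev_small.
Context {R : realType}.

Lemma entropy_deviation (m g k L : R) : 0 < k -> 0 <= L -> 4 * g ^+ 2 <= k * expR L ->
  xlnx ((m + g) ^+ 2) - (m + g) ^+ 2 * ln (m ^+ 2 + k) - (m + g) ^+ 2 + (m ^+ 2 + k)
  <= 20 * g ^+ 2 + 3 * k + 4 * g ^+ 2 * L.
Proof.
move=> k0 L0 gL; set c := m ^+ 2 + k; set u := (m + g) ^+ 2.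
have m2 := sqr_ge0 m; have g2 := sqr_ge0 g.
have c0 : 0 < c by rewrite /c; lra.
have u0 : 0 <= u by exact: sqr_ge0.
have gL0 : 0 <= g ^+ 2 * L by exact: mulr_ge0.
have [u00|un0] := eqVneq u 0; first rewrite u00.
  rewrite /xlnx !mul0r subrr oppr0 !add0r /c.
  have : m = - g by apply/eqP; rewrite -addr_eq0 -sqrf_eq0 -/u u00.
  by move=> ->; rewrite sqrrN; lra.
have up : 0 < u by rewrite lt_neqAle eq_sym un0.
have cV : c * c^-1 = 1 by rewrite divff ?gt_eqF.
have xE : xlnx u - u * ln c = u * ln (u / c) by rewrite /xlnx ln_div ?posrE// mulrBr.
rewrite xE.
have [gc|gc] := leP (g ^+ 2) c.
  have h := ln_le_subr1 (divr_gt0 up c0).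
  have h2 : u * ln (u / c) - u + c <= (u - c) ^+ 2 / c.
    have -> : (u - c) ^+ 2 / c = u * (u / c - 1) - u + c by field; rewrite gt_eqF.
    by rewrite lerD2r lerD2r ler_wpM2l.
  apply: (le_trans h2); rewrite ler_pdivrMr//.
  have -> : u - c = 2 * m * g + g ^+ 2 - k by rewrite /u /c; ring.
  have h3 : (2 * m * g + g ^+ 2 - k) ^+ 2 <= 3 * (4 * m ^+ 2 * g ^+ 2 + g ^+ 2 * g ^+ 2 + k ^+ 2).
    have := sqr_ge0 (2 * m * g - g ^+ 2); have := sqr_ge0 (2 * m * g + k).
    by have := sqr_ge0 (g ^+ 2 + k); nra.
  have h4 : m ^+ 2 * g ^+ 2 <= c * g ^+ 2 by rewrite ler_wpM2r// /c; lra.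
  have h5 : g ^+ 2 * g ^+ 2 <= c * g ^+ 2 by rewrite ler_wpM2r.
  have h6 : k ^+ 2 <= k * c by rewrite expr2 ler_wpM2l ?(ltW k0)// /c; lra.
  have h7 : 0 <= g ^+ 2 * L * c by rewrite mulr_ge0// ltW.
  have h8 : 0 <= g ^+ 2 * c by rewrite mulr_ge0// ltW.
  apply: (le_trans h3).
  have -> : (20 * g ^+ 2 + 3 * k + 4 * g ^+ 2 * L) * c =
    20 * (g ^+ 2 * c) + 3 * (k * c) + 4 * (g ^+ 2 * L * c) by ring.
  by lra.
have u4 : u <= 4 * g ^+ 2.
  have : m ^+ 2 < g ^+ 2 by move: gc; rewrite /c; lra.
  by have := sqr_ge0 (m - g); rewrite /u; nra.
have h : u * ln (u / c) <= u * L.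
  rewrite ler_wpM2l// -(expRK L) ler_ln ?posrE ?divr_gt0 ?expR_gt0// ler_pdivrMr//.
  apply: (le_trans u4); apply: (le_trans gL); rewrite mulrC ler_wpM2l ?expR_ge0// /c; lra.
have h' : u * L <= 4 * g ^+ 2 * L by rewrite ler_wpM2r.
lra.
Qed.

Lemma int_pos_lin (f h : R -> R) (x y : R) : 0 <= x -> 0 <= y ->
  measurable_fun (`]0%R, +oo[%classic : set R) f -> measurable_fun (`]0%R, +oo[%classic : set R) h ->
  (forall s, 0 < s -> 0 <= f s) -> (forall s, 0 < s -> 0 <= h s) ->
  (\int[lebesgue_measure]_(s in `]0%R, +oo[) (x * f s + y * h s)%:E =
   x%:E * \int[lebesgue_measure]_(s in `]0%R, +oo[) (f s)%:E
   + y%:E * \int[lebesgue_measure]_(s in `]0%R, +oo[) (h s)%:E)%E.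
Proof.
move=> x0 y0 mf mh f0 h0.
have pos (s : R) : `]0%R, +oo[%classic s -> 0 < s by rewrite /= in_itv/= andbT.
have mfe : measurable_fun (`]0%R, +oo[%classic : set R) (EFin \o f) by exact/measurable_EFinP.
have mhe : measurable_fun (`]0%R, +oo[%classic : set R) (EFin \o h) by exact/measurable_EFinP.
under eq_integral do rewrite EFinD !EFinM.
rewrite ge0_integralD//.
- rewrite !ge0_integralZl_EFin//.
  all: try by move=> s /pos s0; rewrite lee_fin; first [exact: f0|exact: h0].
- by move=> s /pos s0; rewrite -EFinM lee_fin; exact: mulr_ge0 x0 (f0 _ s0).
- by apply: measurable_funeM; exact: mfe.
- by move=> s /pos s0; rewrite -EFinM lee_fin; exact: mulr_ge0 y0 (h0 _ s0).
- by apply: measurable_funeM; exact: mhe.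
Qed.

End log_sobolev_small.

Definition lsi_cst {R : realType} : R := 300.

Lemma lsi_cst_gt0 (R : realType) : 0 < lsi_cst :> R.
Proof. by rewrite /lsi_cst ltr0n. Qed.

Section gamma_probability.
Context {R : realType}.
Local Notation mu := (@lebesgue_measure R).
Implicit Types r : R.

Lemma integral_gamma_law (nu : {measure set (measurableTypeR R) -> \bar R}) r (h : R -> R) : 0 < r ->
  (forall B, measurable B -> nu B = gamma_law r B) ->
  measurable_fun [set: R] h -> (forall x, 0 <= h x) ->
  (\int[nu]_x (h x)%:E =
   (fine (Gw r))^-1%:E * \int[mu]_(s in `]0%R, +oo[) (h s * gw r s)%:E)%E.
Proof.
move=> r0 nuE mh h0.
pose D : set (measurableTypeR R) := `[0%R, +oo[%classic.
have mD : measurable D by exact: measurable_itv.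
have H A : measurable A -> nu A = ((fine (Gw r))^-1%:E * \int[mu]_(x in A `&` D) (gw r x)%:E)%E.
  move=> mA; rewrite nuE// /gamma_law gt_eqF// Gamma_fnE; congr (_ * integral _ (_ `&` _) _)%E.
  by apply/seteqP; split=> x /=; rewrite /D /= in_itv/= andbT.
rewrite (integral_density mD (measurable_gw r) (gw_ge0 r) H mh h0); congr (_ * _)%E.
rewrite -integral_itv_obnd_cbnd//.
by apply/measurable_EFinP; apply: measurable_funTS; apply: measurable_funM => //; exact: measurable_gw.
Qed.

Variables (r : R) (P : probability (measurableTypeR R) R) (f f' : R -> R) (K : R).
Hypothesis r0 : 0 < r.
Hypothesis PE : forall B, measurable B -> P B = gamma_law r B.
Hypothesis df : forall x, dv f x (f' x).
Hypothesis cf' : forall x, ct f' x.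
Hypothesis fK : forall x, `|f x| <= K.

Let mf : measurable_fun [set: R] f.
Proof. by apply: continuous_measurable_fun => x; exact: (dv_ct (df x)). Qed.

Let mf' : measurable_fun [set: R] f'.
Proof. by apply: continuous_measurable_fun => x; exact: cf'. Qed.

Let bf : bm (f : measurableTypeR R -> R).
Proof. by split => //; exists K. Qed.

Let I := (fine (Gw r))^-1.

Let I0 : 0 < I. Proof. by rewrite invr_gt0 fine_Gw_gt0. Qed.

Let energyE : (\int[P]_x (`|x| * f' x ^+ 2)%:E =
   I%:E * \int[mu]_(s in `]0%R, +oo[) (s * f' s ^+ 2 * gw r s)%:E)%E.
Proof.
rewrite (@integral_gamma_law P r (fun x => `|x| * f' x ^+ 2))//.
- congr (_ * _)%E; apply: eq_integral => s; rewrite inE/= in_itv/= andbT => s0.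
  by rewrite gtr0_norm.
- apply: measurable_funM; first exact: normr_measurable.
  exact: measurable_funX.
- by move=> x; exact: mulr_ge0 (normr_ge0 x) (sqr_ge0 _).
Qed.

Lemma gamma_poincare :
  ((bvariance P f)%:E <= \int[P]_x (`|x| * f' x ^+ 2)%:E)%E.
Proof.
have bF : bm (fun x : measurableTypeR R => f x - f r) by apply: bmB => //; exact: bm_cst.
apply: (@le_trans _ _ (Ex P (fun x => (f x - f r) ^+ 2))%:E).
  by rewrite lee_fin; exact: variance_le.
rewrite (EFin_Ex P (bm_sqr bF)) energyE (@integral_gamma_law P r (fun x => (f x - f r) ^+ 2))//.
- rewrite lee_wpmul2l ?lee_fin ?(ltW I0)//; exact: gamma_pointed_poincare.
- by apply: measurable_funX; exact: measurable_funB.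
- by move=> x; exact: sqr_ge0.
Qed.

Let lsi_kappa d k : r <= 1 ->
  (\int[mu]_(s in `]0%R, +oo[) (s * f' s ^+ 2 * gw r s)%:E = d%:E)%E ->
  0 < k -> d <= k * fine (Gw r) ->
  entropy P (fun x => f x ^+ 2) <= (280 + 4 * fine (Gw r)) * (d * I) + 3 * k.
Proof.
move=> r1 Dd k0 dk; set G := fine (Gw r).
have G0 : 0 < G by exact: fine_Gw_gt0.
set m := f r; set c := m ^+ 2 + k.
have c0 : 0 < c by rewrite /c ltr_wpDl ?sqr_ge0.
pose g x := f x - m.
have dg x : dv g x (f' x).
  by apply: dv_eq; [apply: dvB; [exact: df|exact: dv_cst]|rewrite subr0].
have gK x : `|g x| <= K + `|m|.
  by rewrite (le_trans (ler_normB _ _))// lerD2r.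
have mg : measurable_fun [set: R] g by exact: measurable_funB.
have d0 : 0 <= d.
  rewrite -lee_fin -Dd; apply: integral_ge0 => s /=; rewrite in_itv/= andbT => /ltW s0.
  by rewrite lee_fin; exact: mulr_ge0 (mulr_ge0 s0 (sqr_ge0 _)) (gw_ge0 r s).
set N := (\int[mu]_(s in `]0%R, +oo[) (g s ^+ 2 * gw r s)%:E)%E.
set S := (\int[mu]_(s in `]0%R, +oo[) (s * g s ^+ 2 * gw r s)%:E)%E.
set Q := (\int[mu]_(s in `]0%R, +oo[) (r * (g s ^+ 2 * (ell s * gw r s)))%:E)%E.
have Nd : (N <= d%:E)%E by rewrite -Dd; exact: gamma_pointed_poincare.
have N0 : (0 <= N)%E.
  by apply: integral_ge0 => s _; rewrite lee_fin; exact: mulr_ge0 (sqr_ge0 _) (gw_ge0 r s).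
have [n nN nd] : exists2 n, N = n%:E & 0 <= n <= d.
  case: (N) N0 Nd => [n| |]//; rewrite !lee_fin => n0 nd; by exists n => //; rewrite n0.
have Sd : (S <= (6 * d)%:E)%E.
  apply: (le_trans (gamma_first_moment_le r0 dg cf' gK)).
  rewrite -/N nN Dd -!EFinM -EFinD lee_fin; case/andP: nd => n0 nd; nra.
have Qd : (Q <= (7 * d)%:E)%E.
  apply: (le_trans (gamma_log_moment_le r0 dg cf' gK)).
  rewrite -/N nN Dd -!EFinM -EFinD lee_fin; case/andP: nd => n0 nd; lra.
have gu_le x : 0 < x -> g x ^+ 2 * gu r x <= 13 * d.
  move=> x0; rewrite -lee_fin; apply: (le_trans (gamma_pointwise_le r0 dg cf' gK x0)).
  rewrite Dd; apply: (@le_trans _ _ (d%:E + 2%:E * (6 * d)%:E)%E).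
    by rewrite leeD2l// lee_wpmul2l ?lee_fin.
  by rewrite -EFinM -EFinD lee_fin; lra.
pose L s := 52 + G + s + r * ell s.
have L0 s : 0 < s -> 0 <= L s.
  by move=> s0; rewrite /L; have := mulr_ge0 (ltW r0) (ell_ge0 s0); lra.
have gL s : 0 < s -> 4 * g s ^+ 2 <= k * expR (L s).
  move=> s0.
  have h1 : 1 <= gu r s * (expR s * expR (r * ell s)).
    rewrite /gu mulrA -(mulrA (powR s r)) -expRD addNr expR0 mulr1.
    rewrite {1}/powR gt_eqF// -expRD -mulrDr -{1}expR0 ler_expR.
    apply: mulr_ge0 (ltW r0) _; rewrite /ell -lnM ?posrE// ?addr_gt0 ?invr_gt0//.
    by rewrite mulrDr mulr1 divff ?gt_eqF// ln_ge0//; lra.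
  have h2 : 52 * G <= expR 52 * expR G.
    apply: ler_pM => //; first exact: ltW.
      by have := @expR_ge1Dx R 52; lra.
    by have := @expR_ge1Dx R G; lra.
  set E := expR s * expR (r * ell s) in h1.
  have E0 : 0 <= E by rewrite mulr_ge0 ?expR_ge0.
  have -> : expR (L s) = expR 52 * expR G * E by rewrite /L /E -!expRD; congr expR; ring.
  have h3 : 4 * g s ^+ 2 <= 4 * (g s ^+ 2 * gu r s) * E.
    rewrite -(mulrA 4) ler_wpM2l// -mulrA; have := ler_wpM2l (sqr_ge0 (g s)) h1.
    by rewrite mulr1.
  apply: (le_trans h3).
  have dkG : d <= k * G by [].
  have h4 : 4 * (g s ^+ 2 * gu r s) <= k * (52 * G) by have := gu_le _ s0; lra.
  apply: (@le_trans _ _ (k * (52 * G) * E)); first by rewrite ler_wpM2r.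
  by rewrite (mulrA k (expR 52 * expR G)) ler_wpM2r// ler_wpM2l// ltW.
have bf2 : bm (fun x : measurableTypeR R => f x ^+ 2) by exact: bm_sqr.
have f20 (x : measurableTypeR R) : 0 <= f x ^+ 2 by exact: sqr_ge0.
apply: (le_trans (entropy_le P c0 bf2 f20)).
set h := fun x : measurableTypeR R => xlnx (f x ^+ 2) - f x ^+ 2 * ln c - f x ^+ 2 + c.
have bh : bm h.
  apply: bmD; last exact: bm_cst.
  by apply: bmB => //; apply: bmB; [exact: bm_xlnx|apply: bmM => //; exact: bm_cst].
have h0 x : 0 <= h x by have := xlnx_tangent (f20 x) c0; rewrite /h; lra.
have A0 : 0 <= 20 + 4 * (52 + G) by lra.
have mw := measurable_gw r.
have mw' (D : set R) : measurable_fun D (gw r) by exact: measurable_funTS.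
have mg2 (D : set R) : measurable_fun D (fun s => g s ^+ 2 * gw r s).
  by apply: measurable_funM => //; apply: measurable_funTS; exact: measurable_funX.
have msg2 (D : set R) : measurable_fun D (fun s => s * g s ^+ 2 * gw r s).
  apply: measurable_funM => //; apply: measurable_funTS; apply: measurable_funM => //.
  exact: measurable_funX.
have mQ : measurable_fun (`]0%R, +oo[%classic : set R) (fun s => r * (g s ^+ 2 * (ell s * gw r s))).
  apply: measurable_funM => //; apply: measurable_funM.
    by apply: measurable_funTS; exact: measurable_funX.
  by apply: measurable_funM => //; exact: measurable_ell.
have p1 s : 0 < s -> 0 <= g s ^+ 2 * gw r s by move=> _; exact: mulr_ge0 (sqr_ge0 _) (gw_ge0 r s).
have p2 s : 0 < s -> 0 <= gw r s by move=> _; exact: gw_ge0.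
have p3 s : 0 < s -> 0 <= s * g s ^+ 2 * gw r s.
  by move=> /ltW s0; exact: mulr_ge0 (mulr_ge0 s0 (sqr_ge0 _)) (gw_ge0 r s).
have p4 s : 0 < s -> 0 <= r * (g s ^+ 2 * (ell s * gw r s)).
  move=> s0; apply: mulr_ge0 (ltW r0) _; apply: mulr_ge0 (sqr_ge0 _) _.
  exact: mulr_ge0 (ell_ge0 s0) (gw_ge0 r s).
pose F12 s := (20 + 4 * (52 + G)) * (g s ^+ 2 * gw r s) + (3 * k) * gw r s.
pose F34 s := 4 * (s * g s ^+ 2 * gw r s) + 4 * (r * (g s ^+ 2 * (ell s * gw r s))).
have mF12 (D : set R) : measurable_fun D F12.
  by apply: measurable_funD; apply: measurable_funM.
have mF34 : measurable_fun (`]0%R, +oo[%classic : set R) F34.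
  by apply: measurable_funD; apply: measurable_funM.
have p12 s : 0 < s -> 0 <= F12 s.
  by move=> s0; have := mulr_ge0 A0 (p1 _ s0); have := mulr_ge0 (ltW k0) (p2 _ s0); rewrite /F12; lra.
have p34 s : 0 < s -> 0 <= F34 s.
  by move=> s0; have := p3 _ s0; have := p4 _ s0; rewrite /F34; lra.
rewrite -lee_fin (EFin_Ex P bh) (@integral_gamma_law P r h)//; last by case: bh.
have key : (\int[mu]_(s in `]0%R, +oo[) (h s * gw r s)%:E <=
    \int[mu]_(s in `]0%R, +oo[) (1 * F12 s + 1 * F34 s)%:E)%E.
  have pos (s : R) : `]0%R, +oo[%classic s -> 0 < s by rewrite /= in_itv/= andbT.
  apply: ge0_le_integral => //.
  - by move=> s _; rewrite lee_fin; exact: mulr_ge0 (h0 s) (gw_ge0 r s).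
  - apply/measurable_EFinP; apply: measurable_funM; last exact: mw'.
    by apply: measurable_funTS; case: bh.
  - apply/measurable_EFinP; apply: measurable_funD.
      by apply: measurable_funM; [exact: measurable_cst|exact: mF12].
    by apply: measurable_funM; [exact: measurable_cst|exact: mF34].
  - move=> s /pos s0; rewrite lee_fin.
    have := entropy_deviation m k0 (L0 _ s0) (gL _ s0).
    rewrite (_ : m + g s = f s); last by rewrite /g addrC subrK.
    rewrite -/c -/(h s) => hs.
    apply: (le_trans (ler_wpM2r (gw_ge0 r s) hs)).
    by rewrite /F12 /F34 /L le_eqVlt; apply/orP; left; apply/eqP; ring.
apply: (@le_trans _ _ (I%:E * ((280 + 4 * G) * d + 3 * k * G)%:E)%E); last first.
  rewrite -EFinM lee_fin.
  have IG : I * G = 1 by rewrite mulVf// gt_eqF.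
  rewrite le_eqVlt; apply/orP; left; apply/eqP.
  have -> : I * ((280 + 4 * G) * d + 3 * k * G) = (280 + 4 * G) * (d * I) + 3 * k * (I * G) by ring.
  by rewrite IG mulr1.
rewrite lee_wpmul2l ?lee_fin ?(ltW I0)//.
apply: (le_trans key).
rewrite int_pos_lin// !mul1e /F12 /F34 int_pos_lin//; last by rewrite mulr_ge0// ltW.
have GwE : (\int[mu]_(s in `]0%R, +oo[) (gw r s)%:E = G%:E)%E by rewrite /G fine_Gw.
rewrite int_pos_lin// -/N -/S -/Q nN GwE.
apply: (@le_trans _ _ (((20 + 4 * (52 + G))%:E * n%:E + (3 * k)%:E * G%:E)
   + (4%:E * (6 * d)%:E + 4%:E * (7 * d)%:E))%E).
  by rewrite leeD2l// leeD// lee_wpmul2l ?lee_fin.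
rewrite -!EFinM -!EFinD lee_fin; case/andP: nd => n0 nd.
have := ler_wpM2l A0 nd; lra.
Qed.

Theorem gamma_lsi_small : r <= 1 ->
  ((entropy P (fun x => f x ^+ 2))%:E <=
   (lsi_cst / r)%:E * \int[P]_x (`|x| * f' x ^+ 2)%:E)%E.
Proof.
move=> r1; rewrite energyE.
have D0 : (0 <= \int[mu]_(s in `]0%R, +oo[) (s * f' s ^+ 2 * gw r s)%:E)%E.
  apply: integral_ge0 => s /=; rewrite in_itv/= andbT => /ltW s0.
  by rewrite lee_fin; exact: mulr_ge0 (mulr_ge0 s0 (sqr_ge0 _)) (gw_ge0 r s).
case Dd : (\int[mu]_(s in `]0%R, +oo[) (s * f' s ^+ 2 * gw r s)%:E)%E D0 => [d| |] //; last first.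
  have h1 : (0 < I%:E)%E by rewrite lte_fin; exact: I0.
  have h2 : (0 < (lsi_cst / r)%:E)%E by rewrite lte_fin divr_gt0// lsi_cst_gt0.
  by move=> _; rewrite (gt0_muley h1) (gt0_muley h2); exact: leey.
rewrite lee_fin => d0; rewrite -!EFinM lee_fin.
set G := fine (Gw r); have G0 : 0 < G by exact: fine_Gw_gt0.
have GI : G * I = 1 by rewrite divff// gt_eqF.
have dI0 : 0 <= d * I by rewrite mulr_ge0// ltW.
have G4 : G <= 4 / r by rewrite -lee_fin fine_Gw// Gw_le.
have r1' : 1 <= r^-1 by rewrite invf_ge1.
apply/ler_addgt0Pr => e e0.
have k0 : 0 < d * I + e / 3 by rewrite ltr_wpDl// divr_gt0.
apply: (le_trans (lsi_kappa r1 Dd k0 _)).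
  rewrite -/G mulrDl -mulrA (mulrC I) GI mulr1 lerDl.
  by rewrite mulr_ge0 ?divr_ge0 ?(ltW G0) ?(ltW e0).
rewrite -/G (mulrC I d).
have : (283 + 4 * G) * (d * I) <= lsi_cst / r * (d * I).
  by rewrite ler_wpM2r// /lsi_cst; lra.
have -> : e = 3 * (e / 3) by field.
lra.
Qed.

End gamma_probability.

Section mdensity.
Context d (T : measurableType d) (R : realType) (m : {measure set T -> \bar R}).
Variables (D : set T) (w : T -> R).
Hypotheses (mD : measurable D) (w0 : forall x, 0 <= w x) (mw : measurable_fun [set: T] w).

Definition mdensity of measurable D & (forall x, 0 <= w x) & measurable_fun [set: T] w :=
  fun A : set T => (\int[m]_(x in A `&` D) (w x)%:E)%E.

Local Notation md := (mdensity mD w0 mw).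

Let md0 : md set0 = 0%E.
Proof. by rewrite /mdensity set0I integral_set0. Qed.

Let md_ge0 A : (0 <= md A)%E.
Proof. by apply: integral_ge0 => x _; rewrite lee_fin. Qed.

Let md_sigma_additive : semi_sigma_additive md.
Proof.
move=> F mF tF mUF; rewrite /mdensity; apply: cvg_toP.
  apply: ereal_nondecreasing_is_cvgn => k n kn.
  apply: lee_sum_nneg_natr => // i _ _; apply: integral_ge0 => x _.
  by rewrite lee_fin.
rewrite setI_bigcupl ge0_integral_bigcup//=.
- by move=> k; exact: measurableI.
- by apply/measurable_EFinP; exact: measurable_funTS.
- by move=> x _; rewrite lee_fin.
- exact: trivIset_setIr.
Qed.

HB.instance Definition _ := isMeasure.Build _ _ _ md md0 md_ge0 md_sigma_additive.

End mdensity.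

Section gamma_existence.
Context {R : realType}.
Implicit Type r : R.

Lemma gamma_law_setT r : 0 < r -> gamma_law r setT = 1%E.
Proof.
move=> r0; rewrite /gamma_law gt_eqF// setTI -/(Gamma_fn r) Gamma_fnE -fine_Gw//=.
by rewrite -EFinM mulVf// gt_eqF// fine_Gw_gt0.
Qed.

Lemma ex_gamma_prob r : 0 < r -> exists P : probability (measurableTypeR R) R,
  forall B, measurable B -> P B = gamma_law r B.
Proof.
move=> r0.
pose D : set (measurableTypeR R) := `[0%R, +oo[%classic.
have DE : D = [set s : R | 0 <= s].
  by apply/seteqP; split=> x /=; rewrite /D /= in_itv/= andbT.
have mD : measurable D by exact: measurable_itv.
have V0 : 0 <= (fine (Gw r))^-1 by rewrite invr_ge0 ltW// fine_Gw_gt0.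
have QE B : mscale (NngNum V0) (mdensity (@lebesgue_measure R) mD (gw_ge0 r) (measurable_gw r)) B
    = gamma_law r B.
  by rewrite /gamma_law gt_eqF// Gamma_fnE -DE.
have QT : mscale (NngNum V0) (mdensity (@lebesgue_measure R) mD (gw_ge0 r) (measurable_gw r)) setT = 1%E.
  by rewrite QE gamma_law_setT.
pose mx := Measure_isProbability.Build _ _ _
  (mscale (NngNum V0) (mdensity (@lebesgue_measure R) mD (gw_ge0 r) (measurable_gw r))) QT.
pose P : probability (measurableTypeR R) R := HB.pack
  (mscale (NngNum V0) (mdensity (@lebesgue_measure R) mD (gw_ge0 r) (measurable_gw r))) mx.
by exists P => B _; rewrite -QE.
Qed.

End gamma_existence.

Section affine_substitution.
Context {R : realType}.
Local Notation mu := (@lebesgue_measure R).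

Lemma lebesgue_affine (z c : R) (A : set R) : 0 < z -> measurable A ->
  (z%:E * mu [set t | A (z * t + c)%R])%E = mu A.
Proof.
move=> z0 mA.
pose phi : measurableTypeR R -> measurableTypeR R := fun t => z * t + c.
have mphi : measurable_fun setT phi.
  by apply: measurable_funD => //; exact: measurable_funM.
pose Q : {measure set (measurableTypeR R) -> \bar R} :=
  mscale (NngNum (ltW z0)) (pushforward mu phi).
rewrite -[LHS]/(Q mphi A).
apply/esym; apply: (@lebesgue_measure_unique R (Q mphi)) => // _ [[a b]] _ <-.
rewrite /Q/= /mscale/= /pushforward/=.
have -> : phi @^-1` `]a, b] = `](a - c) / z, (b - c) / z]%classic.
  apply/seteqP; split=> t /=; rewrite !in_itv/= /phi.
    by move=> /andP[h1 h2]; rewrite ltr_pdivrMr// ler_pdivlMr//; lra.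
  by move=> /andP[]; rewrite ltr_pdivrMr// ler_pdivlMr// => h1 h2; lra.
rewrite !lebesgue_measure_itv/= !lte_fin ltr_pM2r ?invr_gt0// ltrD2r.
case: ifPn => ab; last by rewrite mule0.
rewrite -!EFinB -EFinM; congr EFin; field.
by rewrite gt_eqF.
Qed.

Lemma ge0_integral_affine (z c : R) (F : R -> \bar R) : 0 < z ->
  measurable_fun [set: R] F -> (forall x, 0 <= F x)%E ->
  (\int[mu]_x F x = z%:E * \int[mu]_t F (z * t + c)%R)%E.
Proof.
move=> z0 mF F0.
pose phi : measurableTypeR R -> measurableTypeR R := fun t => z * t + c.
have mphi : measurable_fun setT phi.
  by apply: measurable_funD => //; exact: measurable_funM.
have := @ge0_integral_pushforward _ _ _ _ R phi mphi mu setT F measurableT mF (fun y _ => F0 y).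
rewrite preimage_setT => <-.
pose Q : {measure set (measurableTypeR R) -> \bar R} :=
  mscale (NngNum (ltW z0)) (pushforward mu phi).
have -> : (\int[mu]_x F x = \int[Q mphi]_x F x)%E.
  apply: eq_measure_integral => A mA _.
  by apply/esym; exact: lebesgue_affine.
by rewrite ge0_integral_mscale.
Qed.

End affine_substitution.

Section gamma_convolution.
Context {R : realType}.
Local Notation mu := (@lebesgue_measure R).
Implicit Types a b x y z t : R.

Definition gW a x : R := if 0 < x then gw a x else 0.

Lemma gW_ge0 a x : 0 <= gW a x.
Proof. by rewrite /gW; case: ifP => // _; exact: gw_ge0. Qed.

Lemma measurable_gW a : measurable_fun [set: R] (gW a).
Proof.
apply: measurable_fun_if => //.
  exact: measurable_fun_ltr.
by apply: measurable_funTS; exact: measurable_gw.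
Qed.

Lemma integral_gW a (h : R -> R) :
  (\int[mu]_(s in `]0%R, +oo[) (h s * gw a s)%:E = \int[mu]_s (h s * gW a s)%:E)%E.
Proof.
rewrite [LHS]integral_mkcond; apply: eq_integral => x _.
rewrite patchE /gW; case: ifPn; rewrite ?inE/= ?in_itv/= ?andbT.
  by move=> ->.
by rewrite notin_setE/= in_itv/= andbT => /negP/negbTE ->; rewrite mulr0.
Qed.

Lemma gW_scale a b z t : 0 < z ->
  z * (gW a (z * t) * gW b (z - z * t)) =
  gW (a + b) z * (if 0 < t < 1 then powR t (a - 1) * powR (1 - t) (b - 1) else 0).
Proof.
move=> z0; have -> : z - z * t = z * (1 - t) by ring.
rewrite /gW z0 !pmulr_rgt0// subr_gt0.
have [t0|] /= := boolP (0 < t); last by rewrite mul0r !mulr0.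
have [t1|] /= := boolP (t < 1); last by rewrite !mulr0.
have t1' : 0 < 1 - t by rewrite subr_gt0.
rewrite /gw !powRM ?ltW//.
have -> : powR z (a + b - 1) = z * powR z (a - 1) * powR z (b - 1).
  rewrite -[X in X * _ * _](powRr1 (ltW z0)) -!powRD ?(gt_eqF z0) ?implybT//.
  by congr powR; ring.
have -> : expR (- z) = expR (- (z * t)) * expR (- (z * (1 - t))).
  by rewrite -expRD; congr expR; ring.
by ring.
Qed.

Definition beta_mass a b : \bar R :=
  (\int[mu]_t (if (0 < t < 1)%R then powR t (a - 1) * powR (1 - t) (b - 1) else 0)%R%:E)%E.

Lemma gW_convolution a b (h : R -> R) : measurable_fun [set: R] h -> (forall x, 0 <= h x) ->
  (\int[mu]_x \int[mu]_y (h (x + y) * gW a x * gW b y)%:E =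
   beta_mass a b * \int[mu]_z (h z * gW (a + b) z)%:E)%E.
Proof.
move=> mh h0.
have W0 := gW_ge0; have mW := measurable_gW.
have inner x : (\int[mu]_y (h (x + y) * gW a x * gW b y)%:E =
    \int[mu]_z (h z * gW a x * gW b (z - x))%:E)%E.
  rewrite [RHS](@ge0_integral_affine R 1 x)//.
  - rewrite mul1e; apply: eq_integral => y _; rewrite mul1r.
    by rewrite addrK (addrC x).
  - apply/measurable_EFinP; apply: measurable_funM; first exact: measurable_funM.
    by apply: measurableT_comp => //; exact: measurable_funB.
  - by move=> z; rewrite lee_fin; exact: mulr_ge0 (mulr_ge0 (h0 _) (W0 _ _)) (W0 _ _).
under eq_integral do rewrite inner.
pose F (xz : measurableTypeR R * measurableTypeR R) : \bar R := (h xz.2 * gW a xz.1 * gW b (xz.2 - xz.1))%:E.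
have mF : measurable_fun setT F.
  apply/measurable_EFinP; apply: measurable_funM; first apply: measurable_funM.
  - exact: (measurableT_comp mh measurable_snd).
  - exact: (measurableT_comp (mW a) measurable_fst).
  - apply: (measurableT_comp (mW b)).
    by apply: measurable_funB; [exact: measurable_snd|exact: measurable_fst].
have F0 xz : (0 <= F xz)%E.
  by rewrite /F lee_fin; exact: mulr_ge0 (mulr_ge0 (h0 _) (W0 _ _)) (W0 _ _).
rewrite (@fubini_tonelli _ _ _ _ R mu mu F mF F0) /F /=.
have B0 : (0 <= beta_mass a b)%E.
  apply: integral_ge0 => t _; rewrite lee_fin; case: ifP => // _.
  by rewrite mulr_ge0 ?powR_ge0.
rewrite -ge0_integralZl//; last 2 first.
- by apply/measurable_EFinP; apply: measurable_funM => //; exact: mW.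
- by move=> z _; rewrite lee_fin; exact: mulr_ge0 (h0 _) (W0 _ _).
apply: eq_integral => z _.
have [z0|z0] := ltP 0 z; last first.
  rewrite /gW ltNge z0/= mulr0 mule0; apply: integral0_eq => x _.
  case: ifPn => x0; last by rewrite mulr0 mul0r.
  by rewrite subr_gt0 ltNge (le_trans z0 (ltW x0))/= mulr0.
rewrite (@ge0_integral_affine R z 0)//; last 2 first.
- apply/measurable_EFinP; apply: measurable_funM; first exact: measurable_funM.
  by apply: (measurableT_comp (mW b)); exact: measurable_funB.
- by move=> x; rewrite lee_fin; exact: mulr_ge0 (mulr_ge0 (h0 _) (W0 _ _)) (W0 _ _).
have mbeta : measurable_fun [set: R] (fun t => if 0 < t < 1 then powR t (a - 1) * powR (1 - t) (b - 1) else 0).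
  apply: measurable_fun_if => //.
    by apply: measurable_and; exact: measurable_fun_ltr.
  apply: measurable_funTS; apply: measurable_funM; first exact: measurable_powR.
  apply: (measurableT_comp (measurable_powR (b - 1))).
  exact: measurable_funB.
have -> : (beta_mass a b * (h z * gW (a + b) z)%:E)%E =
    (\int[mu]_t ((h z * gW (a + b) z)%:E *
      (if (0 < t < 1)%R then powR t (a - 1) * powR (1 - t) (b - 1) else 0)%R%:E))%E.
  rewrite muleC /beta_mass -ge0_integralZl//.
  - exact/measurable_EFinP.
  - by move=> t _; rewrite lee_fin; case: ifP => // _; rewrite mulr_ge0 ?powR_ge0.
  - by rewrite lee_fin; exact: mulr_ge0 (h0 _) (W0 _ _).
rewrite -ge0_integralZl//; last 3 first.
- apply/measurable_EFinP; apply: measurable_funM.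
    apply: measurable_funM => //; apply: (measurableT_comp (mW a)).
    by apply: measurable_funD => //; exact: measurable_funM.
  apply: (measurableT_comp (mW b)); apply: measurable_funB => //.
  by apply: measurable_funD => //; exact: measurable_funM.
- by move=> x _; rewrite lee_fin; exact: mulr_ge0 (mulr_ge0 (h0 _) (W0 _ _)) (W0 _ _).
- by rewrite lee_fin ltW.
apply: eq_integral => t _; rewrite -!EFinM addr0; congr EFin.
transitivity (h z * (z * (gW a (z * t) * gW b (z - z * t)))); first by ring.
by rewrite gW_scale// mulrA.
Qed.

End gamma_convolution.

Section gamma_lsi.
Context {R : realType}.
Local Notation mu := (@lebesgue_measure R).
Local Notation TR := (measurableTypeR R).
Implicit Types (a r C : R) (P : probability TR R).

Definition energy P (f' : R -> R) : \bar R := (\int[P]_x (`|x| * f' x ^+ 2)%:E)%E.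

Definition has_poincare P C := forall (f f' : R -> R) K, (forall x, dv f x (f' x)) ->
  (forall x, ct f' x) -> (forall x, `|f x| <= K) ->
  ((bvariance P f)%:E <= C%:E * energy P f')%E.

Definition has_lsi P C := forall (f f' : R -> R) K, (forall x, dv f x (f' x)) ->
  (forall x, ct f' x) -> (forall x, `|f x| <= K) ->
  ((entropy P (fun x => f x ^+ 2))%:E <= C%:E * energy P f')%E.

Lemma energy_ge0 P f' : (0 <= energy P f')%E.
Proof.
by apply: integral_ge0 => x _; rewrite lee_fin; exact: mulr_ge0 (normr_ge0 _) (sqr_ge0 _).
Qed.

Lemma has_lsiW P C C' : C <= C' -> has_lsi P C -> has_lsi P C'.
Proof.
move=> CC lsi f f' K df cf' fK; apply: (le_trans (lsi f f' K df cf' fK)).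
by rewrite lee_wpmul2r ?lee_fin// energy_ge0.
Qed.

Lemma gamma_sum a b (Pa Pb P : probability TR R) (h : R -> R) : 0 < a -> 0 < b ->
  (forall B, measurable B -> Pa B = gamma_law a B) ->
  (forall B, measurable B -> Pb B = gamma_law b B) ->
  (forall B, measurable B -> P B = gamma_law (a + b) B) ->
  measurable_fun [set: R] h -> (forall x, 0 <= h x) ->
  (\int[Pa]_x \int[Pb]_y (h (x + y))%:E = \int[P]_z (h z)%:E)%E.
Proof.
move=> a0 b0 PaE PbE PE.
have ab0 : 0 < a + b by exact: addr_gt0.
pose Ia := (fine (Gw a))^-1; pose Ib := (fine (Gw b))^-1.
have Ia0 : 0 <= Ia by rewrite invr_ge0 ltW// fine_Gw_gt0.
have Ib0 : 0 <= Ib by rewrite invr_ge0 ltW// fine_Gw_gt0.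
have W0 := gW_ge0; have mW := measurable_gW.
have step (h' : R -> R) : measurable_fun [set: R] h' -> (forall x, 0 <= h' x) ->
    (\int[Pa]_x \int[Pb]_y (h' (x + y))%:E =
     ((Ib%:E * (Ia%:E * (beta_mass b a * (fine (Gw (a + b)))%:E))) * \int[P]_z (h' z)%:E))%E.
  move=> mh h0.
  have intb x : (\int[Pb]_y (h' (x + y))%:E = (Ib%:E * \int[mu]_y (h' (x + y) * gW b y)%:E))%E.
    rewrite (@integral_gamma_law _ Pb b (fun y => h' (x + y)) b0 PbE)//; last first.
      by apply: (measurableT_comp mh); exact: measurable_funD.
    by rewrite -/Ib (integral_gW b (fun y => h' (x + y))).
  pose F (z : TR * TR) := (h' (z.1 + z.2) * gW b z.2)%:E.
  have mF : measurable_fun setT F.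
    apply/measurable_EFinP; apply: measurable_funM.
      apply: (measurableT_comp mh).
      by apply: measurable_funD; [exact: measurable_fst|exact: measurable_snd].
    exact: (measurableT_comp (mW _ b) measurable_snd).
  have F0 z : (0 <= F z)%E by rewrite /F lee_fin; exact: mulr_ge0 (h0 _) (W0 _ _ _).
  have inta y : (\int[Pa]_x F (x, y) = Ia%:E * \int[mu]_x (h' (y + x) * gW b y * gW a x)%:E)%E.
    rewrite /F (@integral_gamma_law _ Pa a (fun x => h' (x + y) * gW b y) a0 PaE)//.
    - rewrite -/Ia (integral_gW a (fun x => h' (x + y) * gW b y)).
      by congr (_ * _)%E; apply: eq_integral => x _; rewrite (addrC y).
    - apply: measurable_funM => //.
      by apply: (measurableT_comp mh); exact: measurable_funD.
    - by move=> x; exact: mulr_ge0 (h0 _) (W0 _ _ _).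
  under eq_integral do rewrite intb.
  rewrite ge0_integralZl//; last 2 first.
  - exact: (measurable_fun_fubini_tonelli_F (m2 := mu) F mF F0).
  - by move=> x _; apply: integral_ge0 => y _; exact: (F0 (x, y)).
  rewrite (fubini_tonelli (m1 := Pa) (m2 := mu) F mF F0).
  under eq_integral do rewrite inta.
  pose F' (z : TR * TR) := (h' (z.1 + z.2) * gW b z.1 * gW a z.2)%:E.
  have mF' : measurable_fun setT F'.
    apply/measurable_EFinP; apply: measurable_funM; last first.
      exact: (measurableT_comp (mW _ a) measurable_snd).
    apply: measurable_funM; last exact: (measurableT_comp (mW _ b) measurable_fst).
    apply: (measurableT_comp mh).
    by apply: measurable_funD; [exact: measurable_fst|exact: measurable_snd].
  have F'0 z : (0 <= F' z)%E.
    by rewrite /F' lee_fin; exact: mulr_ge0 (mulr_ge0 (h0 _) (W0 _ _ _)) (W0 _ _ _).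
  rewrite ge0_integralZl//; last 2 first.
  - exact: (measurable_fun_fubini_tonelli_F (m2 := mu) F' mF' F'0).
  - by move=> x _; apply: integral_ge0 => y _; exact: (F'0 (x, y)).
  rewrite (gW_convolution b a mh h0) -!muleA; congr (_ * (_ * (_ * _)))%E.
  rewrite (@integral_gamma_law _ P (a + b) h' ab0 PE)// (integral_gW (a + b) h') muleA -EFinM.
  by rewrite divff ?gt_eqF ?fine_Gw_gt0// mul1e (addrC b).
move=> mh h0; rewrite (step h mh h0).
have := step (fun=> 1) (measurable_cst _) (fun=> ler01).
under eq_integral do rewrite integral_prob1.
by rewrite !integral_prob1 mule1 => <-; rewrite mul1e.
Qed.

Lemma Ex_gamma_sum a b (Pa Pb P : probability TR R) (h : R -> R) : 0 < a -> 0 < b ->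
  (forall B, measurable B -> Pa B = gamma_law a B) ->
  (forall B, measurable B -> Pb B = gamma_law b B) ->
  (forall B, measurable B -> P B = gamma_law (a + b) B) ->
  bm (h : TR -> R) -> Ex (Pa \x Pb)%E (fun z => h (z.1 + z.2)) = Ex P h.
Proof.
move=> a0 b0 PaE PbE PE bh; have [mh [K hK]] := bh.
have madd : measurable_fun setT (fun z : TR * TR => z.1 + z.2 : R).
  by apply: measurable_funD; [exact: measurable_fst|exact: measurable_snd].
have bhs : bm (fun z : TR * TR => h (z.1 + z.2)).
  by split; [exact: (measurableT_comp mh madd)|exists K => z].
have b1 := bmD bh (bm_cst K); have b2 := bmD bhs (bm_cst K).
suff : Ex (Pa \x Pb)%E (fun z => h (z.1 + z.2) + K) = Ex P (fun x => h x + K).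
  by rewrite (ExD _ bhs (bm_cst K)) (ExD _ bh (bm_cst K)) !Ex_cst => /addIr.
have hK0 x : 0 <= h x + K by have := hK x; rewrite ler_norml => /andP[]; lra.
apply: EFin_inj; rewrite (EFin_Ex _ b1) (EFin_Ex _ b2) -(gamma_sum a0 b0 PaE PbE PE)//; last by case: b1.
rewrite (@fubini_tonelli1 _ _ _ _ R Pa Pb (fun z => (h (z.1 + z.2) + K)%:E))//.
- by apply/measurable_EFinP; case: b2.
- by move=> z; rewrite lee_fin.
Qed.

Lemma gamma_ae_gt0 a (Pa : probability TR R) : 0 < a ->
  (forall B, measurable B -> Pa B = gamma_law a B) -> {ae Pa, forall x, 0 < x}.
Proof.
move=> a0 PaE; exists (`]-oo, 0%R]%classic : set TR); split.
- exact: measurable_itv.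
- rewrite PaE; last exact: measurable_itv.
  rewrite /gamma_law gt_eqF// (_ : _ `&` _ = [set 0]) ?integral_set1 ?mule0//.
  apply/seteqP; split=> x /=; rewrite in_itv/=.
    by move=> [x0 x0']; apply/eqP; rewrite eq_le x0.
  by move=> ->.
- by move=> x /=; rewrite in_itv/= leNgt => /negP.
Qed.

(* [gamma_2a] is the law of [x + y] under [gamma_a \x gamma_a], and the weight is additive:
   [|x + y| = |x| + |y|] almost surely; hence the constant is not increased. *)
Lemma has_lsi_gamma_double a (Pa P : probability TR R) C : 0 < a -> 0 <= C ->
  (forall B, measurable B -> Pa B = gamma_law a B) ->
  (forall B, measurable B -> P B = gamma_law (a + a) B) ->
  has_lsi Pa C -> has_lsi P C.
Proof.
move=> a0 C0 PaE PE lsi f f' K df cf' fK.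
have mf : measurable_fun [set: R] f.
  by apply: continuous_measurable_fun => x; exact: (dv_ct (df x)).
have mf' : measurable_fun [set: R] f'.
  by apply: continuous_measurable_fun => x; exact: cf'.
have bf : bm (f : TR -> R) by split => //; exists K.
have bf2 := bm_sqr bf; have f20 (x : TR) : 0 <= f x ^+ 2 by exact: sqr_ge0.
have bxf2 := bm_xlnx bf2 f20.
have madd : measurable_fun setT (fun z : TR * TR => z.1 + z.2 : R).
  by apply: measurable_funD; [exact: measurable_fst|exact: measurable_snd].
pose phi (z : TR * TR) := f (z.1 + z.2) ^+ 2.
have bphi : bm phi.
  by apply: bm_sqr; split; [exact: (measurableT_comp mf madd)|exists K => z].
have phi0 z : 0 <= phi z by exact: sqr_ge0.
have -> : entropy P (fun x => f x ^+ 2) = entropy (Pa \x Pa)%E phi.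
  by rewrite /entropy -(Ex_gamma_sum a0 a0 PaE PaE PE bf2) -(Ex_gamma_sum a0 a0 PaE PaE PE bxf2).
have df1 y x : dv (fun x => f (x + y)) x (f' (x + y)).
  apply: dv_eq.
    apply: (@dv_comp _ f (fun x => x + y)); first exact: df.
    by apply: dvD; [exact: dv_id|exact: dv_cst].
  by rewrite addr0 mulr1.
have cf1 y x : ct (fun x => f' (x + y)) x.
  have c1 : ct (fun x => x + y) x by apply: ctD; [exact: ct_id|exact: ct_cst].
  by apply: continuous_comp; [exact: c1|exact: cf'].
have lsi1 y : ((entropy Pa (fun x => phi (x, y)))%:E <=
    C%:E * \int[Pa]_x (`|x| * f' (x + y) ^+ 2)%:E)%E.
  exact: (lsi (fun x => f (x + y)) (fun x => f' (x + y)) K (df1 y) (cf1 y)).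
have mn : measurable_fun [set: R] (fun x : R => `|x|) by exact: measurableT_comp.
have mG1 : measurable_fun setT (fun z : TR * TR => (`|z.1| * f' (z.1 + z.2) ^+ 2)%:E).
  apply/measurable_EFinP; apply: measurable_funM.
    exact: (measurableT_comp mn measurable_fst).
  by apply: measurable_funX; exact: (measurableT_comp mf' madd).
have mG2 : measurable_fun setT (fun z : TR * TR => (`|z.2| * f' (z.1 + z.2) ^+ 2)%:E).
  apply/measurable_EFinP; apply: measurable_funM.
    exact: (measurableT_comp mn measurable_snd).
  by apply: measurable_funX; exact: (measurableT_comp mf' madd).
have nn (u v : R) : (0 <= (`|u| * v ^+ 2)%:E)%E.
  by rewrite lee_fin; exact: mulr_ge0 (normr_ge0 _) (sqr_ge0 _).
have mI1 : measurable_fun setT (fun y : TR => \int[Pa]_x (`|x| * f' (x + y) ^+ 2)%:E)%E.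
  exact: (measurable_fun_fubini_tonelli_G (m1 := Pa) _ mG1 (fun z => nn _ _)).
have mI2 : measurable_fun setT (fun y : TR => \int[Pa]_x (`|y| * f' (x + y) ^+ 2)%:E)%E.
  exact: (measurable_fun_fubini_tonelli_G (m1 := Pa) _ mG2 (fun z => nn _ _)).
have I1_ge0 (y : TR) : (0 <= \int[Pa]_x (`|x| * f' (x + y) ^+ 2)%:E)%E by exact: integral_ge0.
have I2_ge0 (y : TR) : (0 <= \int[Pa]_x (`|y| * f' (x + y) ^+ 2)%:E)%E by exact: integral_ge0.
have T1 : ((Ex Pa (fun y => entropy Pa (fun x => phi (x, y))))%:E <=
    C%:E * \int[Pa]_y \int[Pa]_x (`|x| * f' (x + y) ^+ 2)%:E)%E.
  rewrite (EFin_Ex _ (bm_entropy1 Pa Pa bphi phi0)) -ge0_integralZl//.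
  apply: ge0_le_integral => //.
  - move=> y _; rewrite lee_fin; apply: entropy_ge0 => //; exact: bm_pair1.
  - by apply/measurable_EFinP; case: (bm_entropy1 Pa Pa bphi phi0).
  - exact: measurable_funeM.
have T2 : ((Ex Pa (fun x => entropy Pa (fun y => phi (x, y))))%:E <=
    C%:E * \int[Pa]_y \int[Pa]_x (`|y| * f' (x + y) ^+ 2)%:E)%E.
  have -> : (fun x => entropy Pa (fun y => phi (x, y))) = (fun y => entropy Pa (fun x => phi (x, y))).
    apply/funext => x; congr entropy; apply/funext => y.
    by rewrite /phi/= addrC.
  apply: (le_trans T1); rewrite lee_wpmul2l ?lee_fin//.
  rewrite le_eqVlt; apply/orP; left; apply/eqP.
  rewrite -[RHS](fubini_tonelli (m1 := Pa) (m2 := Pa) _ mG2 (fun z => nn _ _))/=.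
  by apply: eq_integral => y _; apply: eq_integral => x _; rewrite (addrC x).
have h := entropy_tensor Pa Pa bphi phi0.
apply: (@le_trans _ _ (Ex Pa (fun y => entropy Pa (fun x => phi (x, y))) +
  Ex Pa (fun x => entropy Pa (fun y => phi (x, y))))%:E); first by rewrite lee_fin.
rewrite EFinD; apply: (le_trans (leeD T1 T2)).
rewrite -ge0_muleDr ?integral_ge0// lee_wpmul2l ?lee_fin//.
rewrite -ge0_integralD// /energy.
rewrite -(@gamma_sum a a Pa Pa P (fun x => `|x| * f' x ^+ 2) a0 a0 PaE PaE PE); last 2 first.
- by apply: measurable_funM; [exact: mn|exact: measurable_funX].
- by move=> x; have := nn x (f' x); rewrite lee_fin.
have mG : measurable_fun setT (fun z : TR * TR => (`|z.1 + z.2| * f' (z.1 + z.2) ^+ 2)%:E).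
  apply/measurable_EFinP; apply: measurable_funM.
    exact: (measurableT_comp mn madd).
  by apply: measurable_funX; exact: (measurableT_comp mf' madd).
rewrite le_eqVlt; apply/orP; left; apply/eqP.
rewrite [RHS](fubini_tonelli (m1 := Pa) (m2 := Pa) _ mG (fun z => nn _ _)).
have ae0 := gamma_ae_gt0 a0 PaE.
have mI : measurable_fun setT (fun y : TR => \int[Pa]_x (`|x + y| * f' (x + y) ^+ 2)%:E)%E.
  exact: (measurable_fun_fubini_tonelli_G (m1 := Pa) _ mG (fun z => nn _ _)).
apply: ge0_ae_eq_integral => //.
- exact: emeasurable_funD.
- by move=> y _; apply: adde_ge0.
- by move=> y _; apply: integral_ge0.
apply: (@filterS _ _ (ae_filter_ringOfSetsType Pa) _ _ _ ae0) => y y0 _ /=.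
have mp1 (g : TR * TR -> \bar R) (v : TR) : measurable_fun setT g -> measurable_fun setT (fun x => g (x, v)).
  exact: measurable_fun_pair1.
rewrite -ge0_integralD//; [|exact: (mp1 _ y mG1)|exact: (mp1 _ y mG2)].
apply: ge0_ae_eq_integral => //.
- by apply: emeasurable_funD; [exact: (mp1 _ y mG1)|exact: (mp1 _ y mG2)].
- exact: (mp1 _ y mG).
- by move=> x _; apply: adde_ge0.
apply: (@filterS _ _ (ae_filter_ringOfSetsType Pa) _ _ _ ae0) => x x0 _ /=.
by rewrite -EFinD -mulrDl !gtr0_norm// addr_gt0.
Qed.

Lemma gamma_has_lsi r (P : probability TR R) : 0 < r ->
  (forall B, measurable B -> P B = gamma_law r B) -> has_lsi P (2 * lsi_cst / Num.min 1 r).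
Proof.
move=> r0 PE.
have c0 := lsi_cst_gt0 R.
have small s (Q : probability TR R) : 0 < s -> s <= 1 ->
    (forall B, measurable B -> Q B = gamma_law s B) -> has_lsi Q (lsi_cst / s).
  move=> s0 s1 QE f f' K df cf' fK.
  exact: (gamma_lsi_small s0 QE df cf' fK s1).
suff big n s (Q : probability TR R) : 1 < s -> s <= 2 ^+ n ->
    (forall B, measurable B -> Q B = gamma_law s B) -> has_lsi Q (2 * lsi_cst).
  have [r1|r1] := leP 1 r; last first.
    apply: (has_lsiW _ (small _ _ r0 (ltW r1) PE)).
    by rewrite ler_wpM2r ?invr_ge0 ?(ltW r0)//; lra.
  rewrite divr1; move: r1; rewrite le_eqVlt => /predU1P[r1|r1].
    apply: (has_lsiW _ (small r P r0 _ PE)); last by rewrite -r1.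
    by rewrite -r1 divr1; lra.
  have [n rn] : exists n, r <= 2 ^+ n.
    exists (Num.trunc r).+1; apply: (le_trans (ltW (truncnS_gt r))).
    by rewrite -natrX ler_nat ltnW// ltn_expl.
  exact: (big n r P r1 rn PE).
elim: n s Q => [|n IH] s Q s1 sn QE; first by move: sn; rewrite expr0; lra.
have s20 : 0 < s / 2 by lra.
have [Q2 Q2E] := ex_gamma_prob s20.
have sE : s = s / 2 + s / 2 by field.
rewrite sE in QE.
apply: (has_lsi_gamma_double s20 _ Q2E QE); first by lra.
have [s2|s2] := leP (s / 2) 1; last first.
  by apply: IH Q2E => //; move: sn; rewrite exprS; lra.
apply: (has_lsiW _ (small _ _ s20 s2 Q2E)).
rewrite ler_pdivrMr//; nra.
Qed.

Lemma gamma_has_poincare r (P : probability TR R) : 0 < r ->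
  (forall B, measurable B -> P B = gamma_law r B) -> has_poincare P 1.
Proof.
move=> r0 PE f f' K df cf' fK; rewrite mul1e.
exact: (gamma_poincare r0 PE df cf' fK).
Qed.

Lemma Ex_gamma0 (P : probability TR R) (f : R -> R) :
  (forall B, measurable B -> P B = gamma_law 0 B) -> bm (f : TR -> R) -> Ex P f = f 0.
Proof.
move=> PE [mf [K hK]]; rewrite /Ex /Rintegral.
pose z : TR := (0 : R).
have -> : (\int[P]_x (f x)%:E = \int[\d_z]_x (f x)%:E)%E.
  apply: eq_measure_integral => A mA _.
  by transitivity (gamma_law 0 A); [exact: PE|rewrite /gamma_law eqxx].
rewrite integral_dirac//; last exact/measurable_EFinP.
by rewrite diracE in_setT mul1e.
Qed.

Lemma gamma0_has_poincare (P : probability TR R) C : 0 <= C ->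
  (forall B, measurable B -> P B = gamma_law 0 B) -> has_poincare P C.
Proof.
move=> C0 PE f f' K df cf' fK.
have mf : measurable_fun [set: R] f.
  by apply: continuous_measurable_fun => x; exact: (dv_ct (df x)).
have bf : bm (f : TR -> R) by split => //; exists K.
rewrite /bvariance (Ex_gamma0 PE bf) (Ex_gamma0 PE (bm_sqr bf)) subrr.
by rewrite mule_ge0 ?lee_fin// energy_ge0.
Qed.

Lemma gamma0_has_lsi (P : probability TR R) C : 0 <= C ->
  (forall B, measurable B -> P B = gamma_law 0 B) -> has_lsi P C.
Proof.
move=> C0 PE f f' K df cf' fK.
have mf : measurable_fun [set: R] f.
  by apply: continuous_measurable_fun => x; exact: (dv_ct (df x)).
have bf : bm (f : TR -> R) by split => //; exists K.
have bf2 := bm_sqr bf.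
rewrite /entropy (Ex_gamma0 PE bf2) (Ex_gamma0 PE (bm_xlnx bf2 _)); last by move=> x; exact: sqr_ge0.
by rewrite subrr mule_ge0 ?lee_fin// energy_ge0.
Qed.

End gamma_lsi.

(** * Functions of several independent variables *)

Section expectation_extra.
Context {d} {T : measurableType d} {R : realType} (P : probability T R).

Lemma bm_sum (I : Type) (s : seq I) (Q : pred I) (f : I -> T -> R) :
  (forall i, bm (f i)) -> bm (fun x => \sum_(i <- s | Q i) f i x).
Proof.
move=> bf; elim: s => [|i s IH].
  by under eq_fun do rewrite big_nil; exact: bm_cst.
under eq_fun do rewrite big_cons.
by case: (Q i) => //; apply: bmD.
Qed.

Lemma Ex_sum (I : Type) (s : seq I) (f : I -> T -> R) : (forall i, bm (f i)) ->
  Ex P (fun x => \sum_(i <- s) f i x) = \sum_(i <- s) Ex P (f i).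
Proof.
move=> bf; elim: s => [|i s IH].
  by under eq_Ex do rewrite big_nil; rewrite big_nil Ex_cst.
under eq_Ex do rewrite big_cons.
by rewrite big_cons -IH ExD//; exact: bm_sum.
Qed.

Lemma bm_indic (A : set T) : measurable A -> bm (\1_A : T -> R).
Proof.
move=> mA; split; first exact: measurable_indic.
by exists 1 => x; rewrite indicE; case: (_ \in _); rewrite ?normr1 ?normr0.
Qed.

Lemma Ex_indic (A : set T) : measurable A -> Ex P (\1_A : T -> R) = fine (P A).
Proof.
by move=> mA; rewrite /Ex /Rintegral integral_indic// setIT.
Qed.

Lemma Ex_cvg_dominated (h : nat -> T -> R) (f g : T -> R) :
  (forall k, measurable_fun setT (h k)) -> P.-integrable setT (EFin \o g) ->
  (forall k x, `|h k x| <= g x) -> (forall x, h k x @[k --> \oo] --> f x) ->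
  measurable_fun setT f -> Ex P (h k) @[k --> \oo] --> Ex P f.
Proof.
move=> mh ig hg hf mf.
have [] := @dominated_convergence _ _ _ P setT measurableT (fun k => EFin \o h k)
  (EFin \o f) (EFin \o g).
- by move=> k; exact/measurable_EFinP.
- exact/measurable_EFinP.
- apply: aeW => x _; apply: cvg_EFin; last exact: hf.
  by apply: nearW.
- exact: ig.
- by apply: aeW => x k _; rewrite /= lee_fin.
move=> fi _ /=; have -> : (\int[P]_x (f x)%:E = (Ex P f)%:E)%E.
  by rewrite /Ex /Rintegral fineK//; exact: integrable_fin_num fi.
by move=> h1; exact: (fine_cvg h1).
Qed.

Lemma Ex_cvg_bounded (h : nat -> T -> R) f K : (forall k, bm (h k)) ->
  (forall k x, `|h k x| <= K) -> (forall x, h k x @[k --> \oo] --> f x) ->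
  bm f /\ Ex P (h k) @[k --> \oo] --> Ex P f.
Proof.
move=> bh hK hf.
have mf : measurable_fun setT f.
  by apply: (measurable_fun_cvg (h := h)) => [m|x _]; [case: (bh m)|exact: hf].
split.
  split=> //; exists K => x.
  rewrite -(cvg_lim _ (cvg_norm (hf x)))//; apply: limr_le.
    by apply: cvgP; exact: cvg_norm (hf x).
  by apply: nearW => k; exact: hK.
by apply: (Ex_cvg_dominated (fun k => (bh k).1) (bm_integrable P (bm_cst K))).
Qed.

End expectation_extra.

Section step_functions.
Context {R : realType}.

Definition cell (m : nat) (j : nat) : set R :=
  [set x | j%:R <= m%:R * x + m%:R ^+ 2 < j.+1%:R].

Definition cell_pt (m j : nat) : R := (j%:R - m%:R ^+ 2) / m%:R.

Lemma measurable_cell m j : measurable (cell m j).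
Proof.
have -> : cell m j = (fun x : R => m%:R * x + m%:R ^+ 2) @^-1` `[j%:R, j.+1%:R[.
  by apply/seteqP; split => x /=; rewrite in_itv.
rewrite -[X in measurable X]setTI.
have : measurable_fun [set: R] (fun x : R => m%:R * x + m%:R ^+ 2).
  by apply: measurable_funD => //; apply: measurable_funM.
exact.
Qed.

Lemma cell_inj m j k x : cell m j x -> cell m k x -> j = k.
Proof.
rewrite /cell/= => /truncn_def <- /truncn_def <-//.
Qed.

Lemma cell_near m j x : (0 < m)%N -> cell m j x -> `|cell_pt m j - x| <= m%:R^-1.
Proof.
move=> m0 /andP[h1 h2]; have m0' : 0 < m%:R :> R by rewrite ltr0n.
rewrite -natr1 in h2.
have -> : cell_pt m j - x = (j%:R - (m%:R * x + m%:R ^+ 2)) / m%:R.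
  by rewrite /cell_pt; field; rewrite gt_eqF.
have i0 : 0 <= m%:R^-1 :> R by rewrite invr_ge0 ltW.
by rewrite normrM (ger0_norm i0) -[leRHS]mul1r ler_wpM2r// ler_norml; lra.
Qed.

Lemma cell_cover m x : `|x| < m%:R -> exists2 j, (j < 2 * m ^ 2)%N & cell m j x.
Proof.
move=> xm; have m0 : 0 < m%:R :> R by apply: le_lt_trans xm.
have /andP[h1 h2] : - m%:R < x < m%:R by rewrite -ltr_norml.
have t0 : 0 <= m%:R * x + m%:R ^+ 2 by nra.
exists (Num.trunc (m%:R * x + m%:R ^+ 2)); last exact: trunc_itv.
rewrite truncn_lt_nat// natrM natrX; nra.
Qed.

End step_functions.

Section transfer.
Context {R : realType} {n : nat}.
Implicit Types (F : 'rV[R]_n -> R) (J : nat).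

Definition cell_idx m := {ffun 'I_n -> 'I_(2 * m ^ 2)}.

Definition rvec {T : Type} (X : 'I_n -> T -> R) (w : T) : 'rV[R]_n := \row_i X i w.

Definition step {T : Type} (X : 'I_n -> T -> R) F m (w : T) : R :=
  \sum_(j : cell_idx m) F (\row_i cell_pt m (j i)) * \1_[set w | forall i : 'I_n, cell m (j i) (X i w)] w.

Lemma stepE T (X : 'I_n -> T -> R) F m w (j : cell_idx m) :
  (forall i : 'I_n, cell m (j i) (X i w)) -> step X F m w = F (\row_i cell_pt m (j i)).
Proof.
move=> jw; rewrite /step (bigD1 j)//= big1 ?addr0.
  by rewrite indicE mem_set// mulr1.
move=> k kj; rewrite indicE memNset ?mulr0//= => kw.
move: kj; rewrite (_ : k = j) ?eqxx//; apply/ffunP => i; apply/val_inj.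
exact: cell_inj (kw i) (jw i).
Qed.

Lemma step_le T (X : 'I_n -> T -> R) F K m w : 0 <= K -> (forall v, `|F v| <= K) ->
  `|step X F m w| <= K.
Proof.
move=> K0 FK; have [[j jw]|nj] := pselect (exists j : cell_idx m, forall i : 'I_n, cell m (j i) (X i w)).
  by rewrite (stepE F jw).
rewrite /step big1 ?normr0// => j _; rewrite indicE memNset ?mulr0//= => jw.
by apply: nj; exists j.
Qed.

Lemma step_cvg T (X : 'I_n -> T -> R) F w : continuous F ->
  step X F m w @[m --> \oo] --> F (rvec X w).
Proof.
move=> cF; apply/cvgrPdist_lt => e e0.
have := cF (rvec X w); move=> /cvgrPdist_lt /(_ e e0).
rewrite -filter_from_ballE /filter_from => -[d/= d0 dF].
near=> m.
have m0 : (0 < m)%N by near: m; exact: nbhs_infty_gt.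
have md : (m%:R^-1 < d :> R).
  rewrite invf_plt ?posrE ?ltr0n//.
  by near: m; exact: nbhs_infty_gtr.
have wm i : `|X i w| < m%:R.
  apply: (@le_lt_trans _ _ (\sum_k `|X k w|)).
    by rewrite (bigD1 i)//= lerDl sumr_ge0.
  by near: m; exact: nbhs_infty_gtr.
have [j jw] : exists j : cell_idx m, forall i : 'I_n, cell m (j i) (X i w).
  pose jj i := cid2 (cell_cover (wm i)).
  exists [ffun i => Ordinal (s2valP (jj i))] => i; rewrite ffunE/=.
  exact: (s2valP' (jj i)).
rewrite (stepE F jw); apply: dF => //; split=> // a b; rewrite !mxE.
rewrite /ball/= distrC; apply: le_lt_trans md; exact: cell_near.
Unshelve. all: by end_near.
Qed.

Section laws.
Context {d} {T : measurableType d} (P : probability T R) (X : 'I_n -> T -> R).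
Hypothesis mX : forall i, measurable_fun setT (X i).

Lemma measurable_rect (B : 'I_n -> set R) : (forall i, measurable (B i)) ->
  measurable [set w | forall i, B i (X i w)].
Proof.
move=> mB; have -> : [set w | forall i, B i (X i w)] = \bigcap_(i in [set: 'I_n]) (X i @^-1` B i).
  by apply/seteqP; split => [w h i _|w h i]; exact: h.
apply: fin_bigcap_measurable => // i _; rewrite -[X in measurable X]setTI.
exact: mX.
Qed.

Lemma bm_step F m : bm (step X F m).
Proof.
rewrite /step; apply: bm_sum => j; apply: bmM; first exact: bm_cst.
by apply: bm_indic; apply: (@measurable_rect (fun i => cell m (j i))) => i; exact: measurable_cell.
Qed.

Lemma Ex_step F m : Ex P (step X F m) = \sum_(j : cell_idx m)
  F (\row_i cell_pt m (j i)) * fine (P [set w | forall i : 'I_n, cell m (j i) (X i w)]).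
Proof.
have mr (j : cell_idx m) : measurable [set w | forall i : 'I_n, cell m (j i) (X i w)].
  by apply: (@measurable_rect (fun i => cell m (j i))) => i; exact: measurable_cell.
rewrite /step Ex_sum; last first.
  by move=> j; apply: bmM; [exact: bm_cst|exact: bm_indic].
by apply: eq_bigr => j _; rewrite (ExZ P _ (bm_indic (mr j))) Ex_indic.
Qed.

Lemma bm_rvec F K : continuous F -> (forall v, `|F v| <= K) -> bm (fun w => F (rvec X w)) /\
  Ex P (step X F k) @[k --> \oo] --> Ex P (fun w => F (rvec X w)).
Proof.
move=> cF FK; have K0 : 0 <= K by apply: le_trans (FK 0).
apply: (@Ex_cvg_bounded _ _ _ P (step X F) _ K) => [k|k x|x].
- exact: bm_step.
- exact: step_le.
- exact: step_cvg.
Qed.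

End laws.

(* The values of [F] at cell points times the probabilities of the cells sum up to a
   Riemann sum, which only sees the probabilities of rectangles. *)
Lemma Ex_transfer d1 d2 (T1 : measurableType d1) (T2 : measurableType d2)
    (P1 : probability T1 R) (P2 : probability T2 R) (X1 : 'I_n -> T1 -> R) (X2 : 'I_n -> T2 -> R) F K :
  (forall i, measurable_fun setT (X1 i)) -> (forall i, measurable_fun setT (X2 i)) ->
  (forall B : 'I_n -> set R, (forall i, measurable (B i)) ->
    P1 [set w | forall i, B i (X1 i w)] = P2 [set w | forall i, B i (X2 i w)]) ->
  continuous F -> (forall v, `|F v| <= K) ->
  Ex P1 (fun w => F (rvec X1 w)) = Ex P2 (fun w => F (rvec X2 w)).
Proof.
move=> m1 m2 PP cF FK.
have [_ c1] := bm_rvec P1 m1 cF FK; have [_ c2] := bm_rvec P2 m2 cF FK.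
rewrite -(cvg_lim _ c1)// -(cvg_lim _ c2)//; congr (lim (_ @ \oo)).
apply/funext => k; rewrite !Ex_step//; apply: eq_bigr => j _.
by rewrite (PP (fun i => cell k (j i)))// => i; exact: measurable_cell.
Qed.

End transfer.

Section cons_row.
Context {R : realType} {n : nat}.
Implicit Types (v : 'rV[R]_n) (x : R).

Definition cons_rv x v : 'rV[R]_n.+1 := \row_i oapp (fun j => v ord0 j) x (unlift ord0 i).

Lemma cons_rvS x v i : cons_rv x v ord0 (lift ord0 i) = v ord0 i.
Proof. by rewrite mxE liftK. Qed.

Lemma cons_rv_shift0 x v : cons_rv x v = cons_rv 0 v + x *: delta_mx 0 ord0.
Proof.
apply/rowP => i; rewrite !mxE eqxx/=; case: (unliftP ord0 i) => [j ->|->]/=.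
  by rewrite mulr0 addr0.
by rewrite mulr1 add0r.
Qed.

Lemma cons_rv_shiftS x v t i :
  cons_rv x (v + t *: delta_mx 0 i) = cons_rv x v + t *: delta_mx 0 (lift ord0 i).
Proof.
apply/rowP => k; rewrite !mxE eqxx/=; case: (unliftP ord0 k) => [j ->|->]/=.
  by rewrite !mxE eqxx/= (inj_eq lift_inj).
by rewrite mulr0 addr0.
Qed.

Lemma continuous_cons_rv1 v : continuous (fun x => cons_rv x v).
Proof.
move=> x; apply/cvg_ballP => e e0.
apply: (@filterS _ _ (nbhs_filter x) _ _ _ (nbhsx_ballx x e e0)) => y xy.
split=> // a b; rewrite !mxE; case: (unlift ord0 b) => [j|]//=; exact: ballxx.
Qed.

Lemma continuous_cons_rv2 x : continuous (fun v => cons_rv x v).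
Proof.
move=> v; apply/(@cvg_ballP _ _ _ _ (nbhs_filter v)) => e e0.
apply: (@filterS _ _ (nbhs_filter v) _ _ _ (nbhsx_ballx v e e0)) => y [_ vy].
split=> // a b; rewrite !mxE; case: (unlift ord0 b) => [j|]/=; last exact: ballxx.
exact: vy.
Qed.

End cons_row.

Lemma xlnx_sqr_ge_norm (R : realType) (t : R) : - (2 * `|t|) <= xlnx (t ^+ 2).
Proof.
have [->|t0] := eqVneq t 0; first by rewrite normr0 mulr0 oppr0 expr0n/= /xlnx mul0r.
by rewrite -real_normK ?num_real//; apply: xlnx_sqr_ge; rewrite normr_gt0.
Qed.

Lemma continuous_xlnx_sqr (R : realType) : continuous (fun t : R => xlnx (t ^+ 2)).
Proof.
move=> t; have [->|t0] := eqVneq t 0; last first.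
  apply: cvgM; first exact: exprn_continuous.
  apply: (continuous_comp (f := fun t : R => t ^+ 2) (g := @ln R)); first exact: exprn_continuous.
  by apply: continuous_ln; rewrite lt_neqAle eq_sym sqrf_eq0 t0 sqr_ge0.
apply/cvgrPdist_lt => e e0;
have x0 : xlnx ((0 : R) ^+ 2) = 0 by rewrite expr0n/= /xlnx mul0r.
have d0 : 0 < Num.min 1 (e / 2) by rewrite lt_min ltr01 divr_gt0.
apply: (@filterS _ _ (nbhs_filter (0:R)) _ _ _ (nbhsx_ballx (0:R) _ d0)) => y.
rewrite /ball/= x0 !sub0r !normrN lt_min => /andP[y1 y2].
have := xlnx_le_sqr (sqr_ge0 y); have := xlnx_sqr_ge_norm y.
have -> : (y ^+ 2) ^+ 2 = `|y| ^+ 4 by rewrite -exprM -normrX ger0_norm ?exprn_even_ge0.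
have y0 := normr_ge0 y.
have : `|y| ^+ 4 <= `|y|.
  by rewrite -[leRHS]expr1 ler_wiXn2l// ltW.
by rewrite ltr_norml; lra.
Qed.

Section multidimensional.
Context {R : realType}.
Local Notation TR := (measurableTypeR R).

(* [Hfun true] is the entropy of the square and [Hfun false] the variance: both tensorize,
   so that the two inequalities are lifted to several variables simultaneously. *)
Definition Hfun (ent : bool) d (T : measurableType d) (P : probability T R) (f : T -> R) : R :=
  if ent then entropy P (fun x => f x ^+ 2) else bvariance P f.

Definition has_ineq ent (P : probability TR R) C := forall (f f' : R -> R) K,
  (forall x, dv f x (f' x)) -> (forall x, ct f' x) -> (forall x, `|f x| <= K) ->
  ((Hfun ent P f)%:E <= C%:E * energy P f')%E.

Record C1b n (f : 'rV[R]_n -> R) (g : 'I_n -> 'rV[R]_n -> R) K : Prop := {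
  C1b_cont : continuous f ;
  C1b_dcont : forall i, continuous (g i) ;
  C1b_dv : forall i v t, dv (fun t => f (v + t *: delta_mx 0 i)) t (g i (v + t *: delta_mx 0 i)) ;
  C1b_bound : forall v, `|f v| <= K ;
  C1b_dbound : forall i (v : 'rV[R]_n), `| `|v ord0 i| * g i v ^+ 2| <= K }.

Lemma Hfun_tensor ent d1 d2 (T1 : measurableType d1) (T2 : measurableType d2)
    (P1 : probability T1 R) (P2 : probability T2 R) (f : T1 * T2 -> R) : bm f ->
  [/\ bm (fun y => Hfun ent P1 (fun x => f (x, y))),
      bm (fun x => Hfun ent P2 (fun y => f (x, y))) &
      Hfun ent (P1 \x P2)%E f <= Ex P2 (fun y => Hfun ent P1 (fun x => f (x, y))) +
                          Ex P1 (fun x => Hfun ent P2 (fun y => f (x, y)))].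
Proof.
move=> bf; rewrite /Hfun; case: ent; last first.
  by split; [exact: bm_variance1|exact: bm_variance2|exact: variance_tensor].
have b2 := bm_sqr bf; have f2 z : 0 <= f z ^+ 2 by exact: sqr_ge0.
split; [exact: (bm_entropy1 P1 P2 b2 f2)|exact: (bm_entropy2 P1 P2 b2 f2)|exact: entropy_tensor].
Qed.

Lemma Hfun_cst ent d (T : measurableType d) (P : probability T R) c : Hfun ent P (fun=> c) = 0.
Proof. by rewrite /Hfun /entropy /bvariance; case: ent; rewrite !Ex_cst subrr. Qed.

Lemma Hfun_transfer ent n d1 d2 (T1 : measurableType d1) (T2 : measurableType d2)
    (P1 : probability T1 R) (P2 : probability T2 R) (X1 : 'I_n -> T1 -> R) (X2 : 'I_n -> T2 -> R)
    (F : 'rV[R]_n -> R) K :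
  (forall i, measurable_fun setT (X1 i)) -> (forall i, measurable_fun setT (X2 i)) ->
  (forall B : 'I_n -> set R, (forall i, measurable (B i)) ->
    P1 [set w | forall i, B i (X1 i w)] = P2 [set w | forall i, B i (X2 i w)]) ->
  continuous F -> (forall v, `|F v| <= K) ->
  Hfun ent P1 (fun w => F (rvec X1 w)) = Hfun ent P2 (fun w => F (rvec X2 w)).
Proof.
move=> m1 m2 PP cF FK.
have c2 : continuous (fun v => F v ^+ 2).
  by move=> v; apply: (continuous_comp (f := F) (g := fun t => t ^+ 2)); [exact: cF|exact: exprn_continuous].
have F2 v : `|F v ^+ 2| <= K ^+ 2.
  by rewrite normrX lerXn2r// ?nnegrE// (le_trans _ (FK 0)).
rewrite /Hfun /entropy /bvariance (Ex_transfer m1 m2 PP c2 F2).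
case: ent; last by rewrite (Ex_transfer m1 m2 PP cF FK).
have cx : continuous (fun v => xlnx (F v ^+ 2)).
  by move=> v; apply: (continuous_comp (f := F) (g := fun t => xlnx (t ^+ 2)));
    [exact: cF|exact: continuous_xlnx_sqr].
have Fx v : `|xlnx (F v ^+ 2)| <= 2 * K + K ^+ 4.
  have := F2 v; rewrite ger0_norm ?sqr_ge0// => Fv.
  have := xlnx_le_sqr (sqr_ge0 (F v)); have := xlnx_sqr_ge_norm (F v).
  have F4 : F v ^+ 2 ^+ 2 <= K ^+ 4.
    have -> : K ^+ 4 = K ^+ 2 ^+ 2 by rewrite -exprM.
    by rewrite lerXn2r// nnegrE sqr_ge0.
  have K4 : 0 <= K ^+ 4 by apply: le_trans F4; exact: sqr_ge0.
  by have := FK v; have := normr_ge0 (F v); rewrite (ler_norml (xlnx _)); lra.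
by rewrite (Ex_transfer m1 m2 PP cx Fx).
Qed.

Lemma C1b_slice0 n (f : 'rV[R]_n.+1 -> R) g K v : C1b f g K ->
  [/\ forall x, dv (fun x => f (cons_rv x v)) x (g ord0 (cons_rv x v)),
      forall x, ct (fun x => g ord0 (cons_rv x v)) x & forall x, `|f (cons_rv x v)| <= K].
Proof.
move=> [cf cg df fK gK]; split => [x|x|x].
- rewrite cons_rv_shift0.
  have -> : (fun x => f (cons_rv x v)) = (fun x => f (cons_rv 0 v + x *: delta_mx 0 ord0)).
    by apply/funext => y; rewrite cons_rv_shift0.
  exact: df.
- by apply: (continuous_comp (f := fun x => cons_rv x v)); [exact: continuous_cons_rv1|exact: cg].
- exact: fK.
Qed.

Lemma C1b_slice n (f : 'rV[R]_n.+1 -> R) g K x : C1b f g K ->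
  C1b (fun v => f (cons_rv x v)) (fun i v => g (lift ord0 i) (cons_rv x v)) K.
Proof.
move=> [cf cg df fK gK]; split => [v|i v|i v t|v|i v].
- by apply: (continuous_comp (f := fun v => cons_rv x v)); [exact: continuous_cons_rv2|exact: cf].
- by apply: (continuous_comp (f := fun v => cons_rv x v)); [exact: continuous_cons_rv2|exact: cg].
- rewrite cons_rv_shiftS.
  have -> : (fun t => f (cons_rv x (v + t *: delta_mx 0 i))) =
      (fun t => f (cons_rv x v + t *: delta_mx 0 (lift ord0 i))).
    by apply/funext => y; rewrite cons_rv_shiftS.
  exact: df.
- exact: fK.
- by have := gK (lift ord0 i) (cons_rv x v); rewrite cons_rvS.
Qed.

Lemma continuous_weight n (g : 'rV[R]_n -> R) i : continuous g ->
  continuous (fun v : 'rV[R]_n => `|v ord0 i| * g v ^+ 2).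
Proof.
move=> cg v.
have c1 : {for v, continuous (fun v : 'rV[R]_n => `|v ord0 i|)}.
  apply: (@continuous_comp _ _ _ (fun v : 'rV[R]_n => v ord0 i) Num.norm v).
    exact: coord_continuous.
  exact: norm_continuous.
have c2 : {for v, continuous (fun v : 'rV[R]_n => g v ^+ 2)}.
  by apply: (continuous_comp (f := g) (g := fun t => t ^+ 2)); [exact: cg|exact: exprn_continuous].
exact: (continuousM c1 c2).
Qed.

Definition cons_fun n d (T : measurableType d) (X : 'I_n -> T -> R) (i : 'I_n.+1) (z : TR * T) : R :=
  oapp (fun j => X j z.2) z.1 (unlift ord0 i).

Lemma rvec_cons n d (T : measurableType d) (X : 'I_n -> T -> R) z :
  rvec (cons_fun X) z = cons_rv z.1 (rvec X z.2).
Proof.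
apply/rowP => i; rewrite !mxE /cons_fun.
by case: (unliftP ord0 i) => [j _|_]//=; rewrite mxE.
Qed.

(* The probability space of [X_0, ..., X_n] is replaced by its product with the law of the
   first coordinate, which does not change the joint law. *)
Theorem multidimensional_ineq ent C : 0 <= C ->
  forall n d (T : measurableType d) (P : probability T R) (X : 'I_n -> T -> R)
    (mu : 'I_n -> probability TR R) (f : 'rV[R]_n -> R) g K,
  (forall i, measurable_fun setT (X i)) ->
  (forall B : 'I_n -> set R, (forall i, measurable (B i)) ->
    P [set w | forall i, B i (X i w)] = \prod_i mu i (B i))%E ->
  (forall i, has_ineq ent (mu i) C) -> C1b f g K ->
  Hfun ent P (fun w => f (rvec X w)) <= C * \sum_i Ex P (fun w => `|X i w| * g i (rvec X w) ^+ 2).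
Proof.
move=> C0; elim=> [|n IH] d T P X mu f g K mX PX Hmu fg.
  have -> : (fun w => f (rvec X w)) = (fun=> f 0).
    by apply/funext => w; congr f; apply/rowP; case.
  by rewrite Hfun_cst big_ord0 mulr0.
have [cf cg df fK gK] := fg.
pose Xr (i : 'I_n) := X (lift ord0 i).
have mXr i : measurable_fun setT (Xr i) by exact: mX.
have PXr (B : 'I_n -> set R) : (forall i, measurable (B i)) ->
    (P [set w | forall i, B i (Xr i w)] = \prod_i mu (lift ord0 i) (B i))%E.
  move=> mB; pose B' i := oapp B setT (unlift ord0 i).
  have mB' i : measurable (B' i) by rewrite /B'; case: unlift => /=.
  have := PX B' mB'; rewrite big_ord_recl/= {1 2}/B' unlift_none/= probability_setT mul1e.
  under eq_bigr do rewrite /B' liftK/=.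
  move=> <-; congr (P _); apply/seteqP; split => [w h i|w h i].
    by rewrite /B'; case: (unliftP ord0 i) => [j ->|->]//=; exact: h.
  by have := h (lift ord0 i); rewrite /B' liftK.
pose P' : probability (TR * T)%type R := (mu ord0 \x P)%E.
pose X' := cons_fun Xr.
have mX' i : measurable_fun setT (X' i).
  rewrite /X' /cons_fun; case: (unlift ord0 i) => [j|]/=; last exact: measurable_fst.
  by apply: (measurableT_comp (mXr j)); exact: measurable_snd.
have PP (B : 'I_n.+1 -> set R) : (forall i, measurable (B i)) ->
    P [set w | forall i, B i (X i w)] = P' [set w | forall i, B i (X' i w)].
  move=> mB; rewrite PX// big_ord_recl -(PXr (fun i => B (lift ord0 i)))//.
  have mr := @measurable_rect _ _ _ _ Xr mXr (fun i => B (lift ord0 i)) (fun i => mB _).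
  transitivity (P' (B ord0 `*` [set w | forall i, B (lift ord0 i) (Xr i w)])).
    by apply/esym; exact: (product_measure1E (mu ord0) P (mB ord0) mr).
  congr (P' _); apply/seteqP; split => [[x w] /= [h1 h2] i|[x w] h/=].
    by rewrite /X' /cons_fun; case: (unliftP ord0 i) => [j ->|->]//=; exact: h2.
  split; first by have := h ord0; rewrite /X' /cons_fun unlift_none.
  by move=> i; have := h (lift ord0 i); rewrite /X' /cons_fun liftK.
have bf' : bm (fun z => f (cons_rv z.1 (rvec Xr z.2)) : R).
  have [+ _] := bm_rvec P' mX' cf fK.
  by under eq_fun do rewrite rvec_cons.
have HE : Hfun ent P (fun w => f (rvec X w)) = Hfun ent P' (fun z => f (cons_rv z.1 (rvec Xr z.2))).
  rewrite (Hfun_transfer ent mX mX' PP cf fK); congr Hfun.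
  by apply/funext => z; rewrite rvec_cons.
pose G i (z : TR * T) := `|X' i z| * g i (cons_rv z.1 (rvec Xr z.2)) ^+ 2.
have bG i : bm (G i).
  have [+ _] := bm_rvec P' mX' (@continuous_weight _ _ i (cg i)) (gK i).
  by under eq_fun do rewrite mxE rvec_cons.
have GE i : Ex P (fun w => `|X i w| * g i (rvec X w) ^+ 2) = Ex P' (G i).
  have := Ex_transfer mX mX' PP (@continuous_weight _ _ i (cg i)) (gK i).
  under eq_Ex do rewrite mxE.
  by under [X in _ = X -> _]eq_Ex do rewrite mxE rvec_cons.
rewrite HE; under eq_bigr do rewrite GE.
have [b1 b2 hT] := Hfun_tensor ent (mu ord0) P bf'.
apply: (le_trans hT); rewrite /= big_ord_recl mulrDr; apply: lerD.
  rewrite Ex_prod21// -ExZ; last exact: bm_Ex1.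
  apply: le_Ex => //; first by apply: bmM; [exact: bm_cst|exact: bm_Ex1].
  move=> w /=; have [s1 s2 s3] := C1b_slice0 (rvec Xr w) fg.
  have := Hmu ord0 _ _ _ s1 s2 s3; rewrite /energy.
  have bGw : bm (fun x : TR => G ord0 (x, w)) by exact: bm_pair1.
  rewrite -lee_fin EFinM (EFin_Ex _ bGw) /G/=.
  have X'0 x : X' ord0 (x, w) = x by rewrite /X' /cons_fun unlift_none.
  by under [X in _ -> (_ <= _ * X)%E]eq_integral do rewrite X'0.
have bGS (i : 'I_n) : bm (G (lift ord0 i)) by [].
have bGE (i : 'I_n) : bm (fun x => Ex P (fun y => G (lift ord0 i) (x, y))).
  exact: (bm_Ex2 (mu ord0) P (bGS i)).
have bS := bm_sum (index_enum 'I_n) predT bGE.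
have -> : \sum_(i < n) Ex P' (G (lift ord0 i)) =
    Ex (mu ord0) (fun x => \sum_(i < n) Ex P (fun y => G (lift ord0 i) (x, y))).
  by rewrite Ex_sum//; apply: eq_bigr => i _; exact: Ex_prod12.
rewrite -ExZ//; apply: le_Ex => //; first by apply: bmM => //; exact: bm_cst.
move=> x /=; have := IH _ _ P Xr _ _ _ _ mXr PXr (fun i => Hmu (lift ord0 i)) (C1b_slice x fg).
move=> /le_trans; apply; rewrite ler_wpM2l// le_eqVlt; apply/orP; left; apply/eqP.
by apply: eq_bigr => i _; apply: eq_Ex => w; rewrite /G/= /X' /cons_fun liftK.
Qed.

End multidimensional.

(** * Cylinder functions and the closed form *)

Section smooth_cylinder.
Context {R : realType} {n : nat}.
Implicit Types (f : 'rV[R]_n -> R).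

Definition pd f (i : 'I_n) : 'rV[R]_n -> R := 'D_(delta_mx 0 i) f.

Lemma smooth_dv f : smooth_fun f -> forall (i : 'I_n) (v : 'rV[R]_n) (t : R),
  dv (fun t => f (v + t *: delta_mx 0 i)) t (pd f i (v + t *: delta_mx 0 i)).
Proof.
move=> sf i v t; have [_ /(_ (delta_mx 0 i) (v + t *: delta_mx 0 i)) df] := sf [::].
have E : (fun h : R => h^-1 *: (((fun t => f (v + t *: delta_mx 0 i)) \o shift t) (h *: (1:R)) -
    f (v + t *: delta_mx 0 i))) =
   (fun h => h^-1 *: ((f \o shift (v + t *: delta_mx 0 i)) (h *: delta_mx 0 i) - f (v + t *: delta_mx 0 i))).
  apply/funext => h /=; congr (_ *: (f _ - _)).
  by rewrite [h *: 1]mulr1 scalerDl addrCA.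
by split; rewrite /derivable /derive /pd /derive E.
Qed.

Lemma bounded_of_compact f S : continuous f -> compact S -> (forall v, ~ S v -> f v = 0) ->
  exists K, forall v, `|f v| <= K.
Proof.
move=> cf cS f0.
have cfS : compact (f @` S) by apply: continuous_compact => //; exact: continuous_subspaceT.
have [M [_ hM]] := compact_bounded cfS.
exists (Num.max 0 (M + 1)) => v; have [Sv|Sv] := pselect (S v).
  by rewrite le_max (hM (M + 1)) ?orbT ?ltrDl//; exists v.
by rewrite f0// normr0 le_max lexx.
Qed.

Lemma smooth_C1b f : smooth_fun f -> compact_support f -> exists K, C1b f (pd f) K.
Proof.
rewrite /compact_support; set S := closure _ => sf cS.
have cf : continuous f by have [] := sf [::].
have cg i : continuous (pd f i) by have [] := sf [:: delta_mx 0 i].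
have f0 v : ~ S v -> f v = 0.
  by move=> Sv; apply: contrapT => /eqP fv; apply: Sv; exact: subset_closure.
have g0 i v : ~ S v -> pd f i v = 0.
  move=> Sv; have -> : pd f i v = 'D_(delta_mx 0 i) (fun=> 0 : R) v; last exact: derive_cst.
  apply: near_eq_derive.
  have : nbhs v (~` S) by apply: open_nbhs_nbhs; split => //; apply: closed_openC; exact: closed_closure.
  by apply: (@filterS _ _ (nbhs_filter v)) => u /f0.
have [K hK] := bounded_of_compact cf cS f0.
have c1 i : continuous (fun v : 'rV[R]_n => `|v ord0 i| * pd f i v ^+ 2).
  exact: continuous_weight (cg i).
have w0 i v : ~ S v -> `|v ord0 i| * pd f i v ^+ 2 = 0.
  by move=> /(g0 i) ->; rewrite expr0n mulr0.
have hL i : exists L, forall v : 'rV[R]_n, `| `|v ord0 i| * pd f i v ^+ 2| <= L.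
  exact: (bounded_of_compact (c1 i) cS (w0 i)).
pose L i := projT1 (cid (hL i)).
have hL' i (v : 'rV[R]_n) : `| `|v ord0 i| * pd f i v ^+ 2| <= L i by exact: (projT2 (cid (hL i))).
have L0 i : 0 <= L i by apply: le_trans (hL' i 0).
have K0 : 0 <= K by apply: le_trans (hK 0).
exists (K + \sum_i L i); split => //.
- exact: smooth_dv.
- by move=> v; apply: (le_trans (hK v)); rewrite lerDl sumr_ge0.
- move=> i v; apply: (le_trans (hL' i v)); rewrite (bigD1 i)//= addrCA lerDl.
  by rewrite addr_ge0// sumr_ge0.
Qed.

End smooth_cylinder.

Section cylinder_form.
Context {R : realType} {E : completePseudoMetricType R}.
Local Notation TR := (measurableTypeR R).
Local Notation M := (@MT R E).
Local Notation EB := (@EB R E).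
Implicit Types (nu eta : @fmeas R E) (A : set EB).

Definition mass A (eta : M) : R := fine (fm eta A).

Lemma measurable_mass A : measurable A -> measurable_fun [set: M] (mass A).
Proof.
move=> mA _ B mB; rewrite setTI; apply: sub_sigma_algebra.
by exists A, B.
Qed.

Lemma fm_lty eta A : measurable A -> (fm eta A < +oo)%E.
Proof.
move=> mA; apply: le_lt_trans (fm_fin eta); apply: le_measure => //; rewrite inE//.
Qed.

Lemma massK A eta : measurable A -> (mass A eta)%:E = fm eta A.
Proof. by move=> mA; rewrite fineK// ge0_fin_numE// fm_lty. Qed.

Lemma mass_ge0 A eta : 0 <= mass A eta.
Proof. exact: fine_ge0. Qed.

Lemma mass_shift A eta (s : R) (x : EB) : measurable A ->
  mass A (Defs.shift eta s x) = mass A eta + `|s| * \1_A x.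
Proof.
move=> mA.
rewrite /mass (_ : fm (Defs.shift eta s x) A = fm eta A + `|s|%:E * \d_x A)%E; last first.
  rewrite (_ : fm _ A = measure_add (fm eta) (mscale (nnabs s) (@dirac _ EB x R)) A)//.
  by rewrite measure_addE.
rewrite diracE fineD ?ge0_fin_numE ?fm_lty//=; last first.
  by case: (_ \in _); rewrite ?mule1 ?mule0 ?ltry.
Qed.

Lemma gap_cvg (F : @fmeas R E -> R) eta (x : EB) (phi : R -> R) l :
  (forall s, 0 < s -> F (Defs.shift eta s x) = phi s) -> F eta = phi 0 -> dv phi 0 l ->
  grad_ext F eta x = l.
Proof.
move=> Fs F0 [d1 d2]; rewrite /grad_ext.
have c1 : (phi s - phi 0) / s @[s --> 0^'] --> l.
  rewrite -d2; apply: cvg_trans d1; apply: near_eq_cvg; apply: nearW => h /=.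
  by rewrite [h *: 1]mulr1 addr0 mulrC.
apply: cvg_lim => //; apply: cvg_trans (cvg_dnbhs_at_right c1).
apply: near_eq_cvg; near=> h; rewrite F0 Fs//.
Unshelve. all: by end_near. Qed.

Section fixed_cylinder.
Context {n : nat} (A : 'I_n -> set EB) (f : 'rV[R]_n -> R).
Hypotheses (mA : forall i, measurable (A i)) (tA : forall i j, i != j -> A i `&` A j = set0).
Hypotheses (cA : \bigcup_i A i = setT) (sf : smooth_fun f) (kf : compact_support f).
Let X i : M -> R := mass (A i).
Let F (eta : @fmeas R E) : R := f (rvec X eta).

Lemma grad_ext_cylinder eta (x : EB) i : A i x -> grad_ext F eta x = pd f i (rvec X eta).
Proof.
move=> Aix; apply: (gap_cvg (phi := fun s => f (rvec X eta + s *: delta_mx 0 i))).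
- move=> s s0; rewrite /F; congr f; apply/rowP => j; rewrite !mxE eqxx/=.
  rewrite /X mass_shift// gtr0_norm//; congr (_ + _ * _); rewrite indicE.
  have [->|ji] := eqVneq j i; first by rewrite mem_set.
  rewrite memNset// => Ajx; have : (A j `&` A i) x by split.
  by rewrite tA.
- by rewrite scale0r addr0.
- have := smooth_dv sf i (rvec X eta) 0; by rewrite scale0r addr0.
Qed.

Lemma form0_inner eta :
  (\int[fm eta]_x ((grad_ext F eta x) ^+ 2)%:E = (\sum_i `|X i eta| * pd f i (rvec X eta) ^+ 2)%:E)%E.
Proof.
transitivity (\int[fm eta]_x (\sum_i (pd f i (rvec X eta) ^+ 2 * \1_(A i) x)%:E))%E.
  apply: eq_integral => x _; rewrite sumEFin; congr (_%:E).
  have [i _ Aix] : (\bigcup_i A i) x by rewrite cA.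
  rewrite (grad_ext_cylinder eta Aix) (bigD1 i)//= indicE mem_set// mulr1 big1 ?addr0//.
  move=> j ji; rewrite indicE memNset ?mulr0// => Ajx; have : (A j `&` A i) x by split.
  by rewrite tA.
rewrite ge0_integral_sum//; last first.
- by move=> i x _; rewrite lee_fin mulr_ge0 ?sqr_ge0.
- move=> i; apply/measurable_EFinP; apply: measurable_funM => //; exact: measurable_indic.
rewrite -sumEFin; apply: eq_bigr => i _.
rewrite (integralZl_indic measurableT (fun=> A i))//; last first.
  by move=> h; move: (sqr_ge0 (pd f i (rvec X eta))); rewrite leNgt h.
rewrite integral_indic// setIT EFinM muleC -(massK eta (mA i)).
by rewrite ger0_norm ?mass_ge0.
Qed.

Lemma form0_cylinder (G : probability M R) : form0 G F =
  (\sum_i Ex G (fun eta => `|X i eta| * pd f i (rvec X eta) ^+ 2))%:E.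
Proof.
have [K C1] := smooth_C1b sf kf.
have mX i : measurable_fun setT (X i) by exact: measurable_mass.
have bw i : bm (fun eta : M => `|X i eta| * pd f i (rvec X eta) ^+ 2).
  have [+ _] := bm_rvec G mX (@continuous_weight R n (pd f i) i (C1b_dcont C1 (i := i))) (C1b_dbound C1 i).
  by under eq_fun do rewrite mxE.
rewrite /form0; under eq_integral do rewrite form0_inner.
by rewrite -Ex_sum// EFin_Ex//; exact: bm_sum.
Qed.

Lemma cylinder_bm (G : probability M R) : bm (F : M -> R).
Proof.
have [K C1] := smooth_C1b sf kf.
have mX i : measurable_fun setT (X i) by exact: measurable_mass.
by have [] := bm_rvec G mX (C1b_cont C1) (C1b_bound C1).
Qed.

Lemma gamma_law_prob r : 0 <= r -> exists P : probability TR R,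
  forall B, measurable B -> P B = gamma_law r B.
Proof.
rewrite le_eqVlt => /predU1P[<-|]; last exact: ex_gamma_prob.
pose z : TR := (0 : R); exists (\d_z) => B mB.
by rewrite /gamma_law eqxx.
Qed.

Lemma fixed_cylinder_ineq ent C nu (G : probability M R) : 0 <= C -> is_gamma_distribution nu G ->
  (forall i (mu : probability TR R),
     (forall B, measurable B -> mu B = gamma_law (fine (fm nu (A i))) B) -> has_ineq ent mu C) ->
  ((Hfun ent G (F : M -> R))%:E <= C%:E * form0 G F)%E.
Proof.
move=> C0 GG H.
have [K C1] := smooth_C1b sf kf.
have mX i : measurable_fun setT (X i) by exact: measurable_mass.
pose mu i := projT1 (cid (gamma_law_prob (mass_ge0 (A i) nu))).
have muE i : forall B, measurable B -> mu i B = gamma_law (fine (fm nu (A i))) B.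
  exact: (projT2 (cid (gamma_law_prob (mass_ge0 (A i) nu)))).
rewrite form0_cylinder -EFinM lee_fin.
apply: (multidimensional_ineq C0 mX (mu := mu) _ _ C1).
  move=> B mB; rewrite (GG _ _ _ mA tA mB).
  by apply: eq_bigr => i _; apply/esym; apply: muE; exact: mB.
by move=> i; exact: H (muE i).
Qed.

End fixed_cylinder.

Lemma cylinder_ineq ent C nu (G : probability M R) (F : @fmeas R E -> R) :
  0 <= C -> is_gamma_distribution nu G ->
  (forall A (mu : probability TR R), measurable A ->
     (forall B, measurable B -> mu B = gamma_law (fine (fm nu A)) B) -> has_ineq ent mu C) ->
  is_cylinder F -> bm (F : M -> R) /\ ((Hfun ent G (F : M -> R))%:E <= C%:E * form0 G F)%E.
Proof.
move=> C0 GG H [n [A [f [_ [mA [tA [cA [sf [kf FE]]]]]]]]].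
have -> : F = fun eta => f (rvec (fun i => mass (A i)) eta) by apply/funext.
split; first exact: cylinder_bm.
by apply: (fixed_cylinder_ineq mA tA cA sf kf C0 GG) => i mu; exact: H.
Qed.

End cylinder_form.

Section square_integrable_limits.
Context {d} {T : measurableType d} {R : realType} (P : probability T R).
Implicit Types f g u : T -> R.

Definition L1 f := P.-integrable setT (EFin \o f).

Lemma L1_dom f g : measurable_fun [set: T] f -> L1 g -> (forall x, `|f x| <= g x) -> L1 f.
Proof.
move=> mf ig fg; apply: (le_integrable measurableT _ _ ig); first exact/measurable_EFinP.
by move=> x _ /=; rewrite lee_fin (le_trans (fg x)) ?ler_norm.
Qed.

Lemma EFin_Ex_L1 f : L1 f -> (Ex P f)%:E = (\int[P]_x (f x)%:E)%E.
Proof. by move=> L1f; rewrite /Ex /Rintegral fineK//; exact: integrable_fin_num L1f. Qed.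

Lemma L1_bm f : bm f -> L1 f. Proof. exact: bm_integrable. Qed.

Lemma L1D f g : L1 f -> L1 g -> L1 (fun x => f x + g x).
Proof. by move=> h1 h2; exact: (integrableD measurableT h1 h2). Qed.

Lemma L1Z c f : L1 f -> L1 (fun x => c * f x).
Proof. by move=> h1; exact: (integrableZl measurableT c h1). Qed.

Lemma ExD_L1 f g : L1 f -> L1 g -> Ex P (fun x => f x + g x) = Ex P f + Ex P g.
Proof. by move=> ? ?; exact: RintegralD. Qed.

Lemma ExZ_L1 c f : L1 f -> Ex P (fun x => c * f x) = c * Ex P f.
Proof. by move=> ?; exact: RintegralZl. Qed.

Lemma le_Ex_L1 f g : L1 f -> L1 g -> (forall x, f x <= g x) -> Ex P f <= Ex P g.
Proof. by move=> ? ? fg; apply: le_Rintegral. Qed.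

Lemma L1_cst c : L1 (fun=> c). Proof. exact/L1_bm/bm_cst. Qed.

Lemma L1_nneg f : measurable_fun [set: T] f -> (forall x, 0 <= f x) ->
  (\int[P]_x (f x)%:E < +oo)%E -> L1 f.
Proof.
move=> mf f0 fi; apply/integrableP; split; first exact/measurable_EFinP.
by under eq_integral do rewrite /= ger0_norm//.
Qed.

Variable F : T -> R.
Hypotheses (mF : measurable_fun [set: T] F) (F2 : L1 (fun x => F x ^+ 2)).

Lemma L1_F : L1 F.
Proof.
apply: (L1_dom mF (L1D (L1_cst 1) F2)) => x.
by rewrite ler_norml; nra.
Qed.

Lemma L1_dist u : bm u -> L1 (fun x => (u x - F x) ^+ 2).
Proof.
move=> bu; have iu : L1 (fun x => 2 * u x ^+ 2 + 2 * F x ^+ 2).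
  by apply: L1D; apply: L1Z => //; exact/L1_bm/bm_sqr.
have [mu _] := bu.
apply: (L1_dom _ iu); first by apply: measurable_funX; exact: measurable_funB.
by move=> x; rewrite ger0_norm ?sqr_ge0//; have := sqr_ge0 (u x + F x); lra.
Qed.

Lemma variance_approx u (a : R) : 0 < a -> bm u ->
  Ex P (fun x => F x ^+ 2) - (Ex P F) ^+ 2 <=
    (1 + a) * bvariance P u + (1 + a^-1) * Ex P (fun x => (u x - F x) ^+ 2).
Proof.
move=> a0 bu; set c := Ex P u.
have i1 : L1 (fun x => (- (2 * c)) * F x) by exact/L1Z/L1_F.
have i2 := L1D F2 i1.
have E1 : Ex P (fun x => (F x - c) ^+ 2) = Ex P (fun x => F x ^+ 2) - 2 * c * Ex P F + c ^+ 2.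
  rewrite -mulNr -(ExZ_L1 _ L1_F) -(ExD_L1 F2 i1) -[X in _ + X](Ex_cst P) -(ExD_L1 i2 (L1_cst _)).
  by apply: eq_Ex => x; ring.
have b1 : bm (fun x => - (2 * c) * u x) by apply: bmM => //; exact: bm_cst.
have E2 : Ex P (fun x => (u x - c) ^+ 2) = bvariance P u.
  transitivity (Ex P (fun x => u x ^+ 2) - 2 * c * Ex P u + c ^+ 2); last first.
    by rewrite /bvariance -/c; ring.
  rewrite -mulNr -(ExZ P _ bu) -(ExD P (bm_sqr bu) b1) -[X in _ + X](Ex_cst P).
  rewrite -(ExD P (bmD (bm_sqr bu) b1) (bm_cst _)).
  by apply: eq_Ex => x; ring.
have iF : L1 (fun x => (F x - c) ^+ 2).
  have := L1D i2 (L1_cst (c ^+ 2)); congr L1; apply/funext => x; ring.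
have iuc : L1 (fun x => (1 + a) * (u x - c) ^+ 2).
  by apply/L1Z/L1_bm/bm_sqr/bmB => //; exact: bm_cst.
have iuF : L1 (fun x => (1 + a^-1) * (u x - F x) ^+ 2) by exact/L1Z/L1_dist.
apply: (@le_trans _ _ (Ex P (fun x => (F x - c) ^+ 2))).
  by rewrite E1; have := sqr_ge0 (Ex P F - c); nra.
rewrite -E2 -!ExZ_L1; [|exact: L1_dist|by apply/L1_bm/bm_sqr/bmB => //; exact: bm_cst].
rewrite -ExD_L1//; apply: le_Ex_L1 => //; first exact: L1D.
move=> x; have aa : a * a^-1 = 1 by rewrite divff ?gt_eqF.
have ai : 0 < a^-1 by rewrite invr_gt0.
have h (p q : R) : (p - q) ^+ 2 <= (1 + a) * p ^+ 2 + (1 + a^-1) * q ^+ 2.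
  have -> : (1 + a) * p ^+ 2 + (1 + a^-1) * q ^+ 2 =
    (p - q) ^+ 2 + a^-1 * (a * p + q) ^+ 2 + (1 - a * a^-1) * (a * p ^+ 2 + 2 * p * q) by ring.
  by rewrite aa subrr mul0r addr0 lerDl mulr_ge0 ?sqr_ge0 ?ltW.
by have := h (u x - c) (u x - F x); have -> : u x - c - (u x - F x) = F x - c by ring.
Qed.

Definition approximable ent L := forall e : R, 0 < e -> exists u,
  [/\ bm u, Hfun ent P u <= L + e & Ex P (fun x => (u x - F x) ^+ 2) <= e].

Lemma variance_limit L : 0 <= L -> approximable false L ->
  Ex P (fun x => F x ^+ 2) - (Ex P F) ^+ 2 <= L.
Proof.
move=> L0 ap; apply/ler_addgt0Pr => e e0.
pose a := Num.min 1 (e / (4 * (L + 1))).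
have L1_ : 0 < 4 * (L + 1) by lra.
have a0 : 0 < a by rewrite lt_min ltr01 divr_gt0.
have aL : a * (4 * (L + 1)) <= e by rewrite -ler_pdivlMr// ge_min lexx orbT.
have a1 : a <= 1 by rewrite ge_min lexx.
have ai : 0 < a^-1 by rewrite invr_gt0.
pose s := Num.min (e / 8) (e / (4 * (1 + a^-1))).
have s0 : 0 < s by rewrite lt_min !divr_gt0//; lra.
have s1 : s <= e / 8 by rewrite ge_min lexx.
have s2 : s * (4 * (1 + a^-1)) <= e by rewrite -ler_pdivlMr ?ge_min ?lexx ?orbT//; lra.
have [u [bu Hu Du]] := ap _ s0.
apply: (le_trans (variance_approx a0 bu)).
rewrite /Hfun in Hu.
have h1 : (1 + a) * bvariance P u <= (1 + a) * (L + s) by rewrite ler_wpM2l//; lra.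
have h2 : (1 + a^-1) * Ex P (fun x => (u x - F x) ^+ 2) <= (1 + a^-1) * s by rewrite ler_wpM2l//; lra.
have h3 : a * s <= s by rewrite -[leRHS]mul1r ler_wpM2r// ltW.
nra.
Qed.

Section clamp.
Variables (e M : R).
Hypotheses (e0 : 0 < e) (e1 : e <= 1) (M1 : 1 <= M) (F1 : Ex P (fun x => F x ^+ 2) = 1).
Definition clamp x := Num.max e (Num.min (F x ^+ 2) M).
Definition ln_clamp x := ln (clamp x).
Definition ln_range := ln M - ln e.
Local Notation cl := clamp.
Local Notation psi := ln_clamp.
Local Notation Lam := ln_range.

Lemma clamp_bounds x : e <= cl x <= M.
Proof. by rewrite /clamp le_max lexx/= ge_max (le_trans e1 M1) ge_min lexx orbT. Qed.

Lemma bm_clamp : bm cl.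
Proof.
split; last by exists M => x; have /andP[h1 h2] := clamp_bounds x; rewrite ger0_norm// (le_trans (ltW e0)).
apply: measurable_maxr => //; apply: measurable_minr => //; exact: measurable_funX.
Qed.

Lemma bm_psi : bm psi.
Proof. by apply: (bm_ln e0 bm_clamp) => x; have /andP[] := clamp_bounds x. Qed.

Lemma psi_le x : `|psi x| <= Lam.
Proof.
have /andP[h1 h2] := clamp_bounds x.
have c0 : 0 < cl x by apply: lt_le_trans h1.
have M0 : 0 < M by lra.
have l1 : ln (cl x) <= ln M by rewrite ler_ln ?posrE.
have l2 : ln e <= ln (cl x) by rewrite ler_ln ?posrE.
have l3 : 0 <= ln M by rewrite ln_ge0.
have l4 : ln e <= 0 by rewrite ln_le0.
by rewrite /ln_clamp /ln_range ler_norml; lra.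
Qed.

Lemma L1_F2psi : L1 (fun x => F x ^+ 2 * psi x).
Proof.
apply: (L1_dom _ (L1Z Lam F2)).
  by apply: measurable_funM; [exact: measurable_funX|case: bm_psi].
move=> x; rewrite normrM (ger0_norm (sqr_ge0 _)) mulrC.
by rewrite ler_wpM2r ?sqr_ge0// psi_le.
Qed.

(* The Gibbs variational inequality applied to [u^2] and the bounded function [ln_clamp]. *)
Lemma entropy_approx u (a B : R) : 0 < a -> bm u ->
  B = a + (1 + a^-1) * Ex P (fun x => (u x - F x) ^+ 2) ->
  Ex P (fun x => F x ^+ 2 * psi x) <= entropy P (fun x => u x ^+ 2) + (1 + B) * e + Lam * B.
Proof.
move=> a0 bu BE.
have Lam0 : 0 <= Lam by apply: le_trans (psi_le point).
have iB : L1 (fun x => a * F x ^+ 2 + (1 + a^-1) * (u x - F x) ^+ 2).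
  by apply: L1D; apply: L1Z => //; exact: L1_dist.
have EB : Ex P (fun x => a * F x ^+ 2 + (1 + a^-1) * (u x - F x) ^+ 2) = B.
  by rewrite BE ExD_L1 ?ExZ_L1 ?F1 ?mulr1//; [exact: L1_dist|exact: L1Z|apply: L1Z; exact: L1_dist].
have aa : a * a^-1 = 1 by rewrite divff ?gt_eqF.
have ai : 0 < a^-1 by rewrite invr_gt0.
have key (p q : R) : `|p ^+ 2 - q ^+ 2| <= a * q ^+ 2 + (1 + a^-1) * (p - q) ^+ 2.
  have e1' : a * q ^+ 2 + (1 + a^-1) * (p - q) ^+ 2 =
    (p ^+ 2 - q ^+ 2) + a^-1 * (a * q - (p - q)) ^+ 2 + (1 - a * a^-1) * (a * q ^+ 2 - 2 * q * (p - q)) by ring.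
  have e2' : a * q ^+ 2 + (1 + a^-1) * (p - q) ^+ 2 =
    - (p ^+ 2 - q ^+ 2) + 2 * (p - q) ^+ 2 + a^-1 * (a * q + (p - q)) ^+ 2 +
    (1 - a * a^-1) * (a * q ^+ 2 + 2 * q * (p - q)) by ring.
  rewrite aa subrr mul0r addr0 in e1' e2'.
  have s1 : 0 <= a^-1 * (a * q - (p - q)) ^+ 2 by rewrite mulr_ge0 ?sqr_ge0 ?ltW.
  have s2 : 0 <= a^-1 * (a * q + (p - q)) ^+ 2 by rewrite mulr_ge0 ?sqr_ge0 ?ltW.
  have s3 := sqr_ge0 (p - q).
  by rewrite ler_norml; apply/andP; split; lra.
have b2 := bm_sqr bu; have bp := bm_psi; have b2p := bmM b2 bp.
have h1 : Ex P (fun x => F x ^+ 2 * psi x) <= Ex P (fun x => u x ^+ 2 * psi x) + Lam * B.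
  rewrite -EB -ExZ_L1// -ExD_L1; [|exact: L1_bm|exact: L1Z].
  apply: le_Ex_L1; [exact: L1_F2psi|by apply: L1D; [exact: L1_bm|exact: L1Z]|move=> x].
  rewrite -lerBlDl -mulrBl (le_trans (ler_norm _))// normrM mulrC distrC.
  by apply: ler_pM => //; exact: psi_le.
have h2 : Ex P (fun x => u x ^+ 2) <= 1 + B.
  rewrite -[X in X + B]F1 -EB -ExD_L1//; apply: le_Ex_L1 => [||x]; [exact: L1_bm|exact: L1D|].
  by rewrite -lerBlDl (le_trans (ler_norm _))//; exact: key.
have u20 x : 0 <= u x ^+ 2 by exact: sqr_ge0.
have h3 := gibbs P b2 u20 bp.
have h4 : ln (Ex P (fun x => expR (psi x))) <= e.
  have -> : Ex P (fun x => expR (psi x)) = Ex P cl.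
    apply: eq_Ex => x; rewrite lnK// posrE; have /andP[h _] := clamp_bounds x.
    exact: lt_le_trans h.
  have hc : Ex P cl <= 1 + e.
    rewrite -F1 -[X in _ + X](Ex_cst P) -(ExD_L1 F2 (L1_cst _)).
    apply: le_Ex_L1; [exact/L1_bm/bm_clamp|exact: L1D F2 (L1_cst _)|move=> x].
    rewrite /clamp ge_max lerDr sqr_ge0/= (@le_trans _ _ (F x ^+ 2))//; first by rewrite ge_min lexx.
    by rewrite lerDl ltW.
  have hc0 : 0 < Ex P cl.
    apply: (lt_le_trans e0); rewrite -{1}(Ex_cst P e); apply: le_Ex_L1; [exact: L1_cst|exact/L1_bm/bm_clamp|].
    by move=> x; have /andP[] := clamp_bounds x.
  by have := ln_le_subr1 hc0; lra.
have h5 : Ex P (fun x => u x ^+ 2) * ln (Ex P (fun x => expR (psi x))) <= (1 + B) * e.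
  apply: (@le_trans _ _ (Ex P (fun x => u x ^+ 2) * e)).
    by rewrite ler_wpM2l// Ex_ge0.
  by rewrite ler_wpM2r// ltW.
lra.
Qed.

Lemma clamped_entropy_limit L : approximable true L -> Ex P (fun x => F x ^+ 2 * psi x) <= L + e.
Proof.
move=> ap; apply/ler_addgt0Pr => t t0.
have Lam0 : 0 <= Lam by apply: le_trans (psi_le point).
pose b := t / (1 + e + Lam).
have q0 : 0 < 1 + e + Lam by rewrite ltr_wpDr// addr_gt0.
have b0 : 0 < b by rewrite divr_gt0.
have bE : b * (1 + e + Lam) = t by rewrite divfK// gt_eqF.
pose a := b / 2; have a0 : 0 < a by rewrite divr_gt0.
have ai : 0 < a^-1 by rewrite invr_gt0.
pose s := Num.min b (b / (2 * (1 + a^-1))).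
have s0 : 0 < s by rewrite lt_min b0/= divr_gt0//; lra.
have sb : s <= b by rewrite ge_min lexx.
have s2 : s * (2 * (1 + a^-1)) <= b by rewrite -ler_pdivlMr ?ge_min ?lexx ?orbT//; lra.
have [u [bu Hu Du]] := ap _ s0.
apply: (le_trans (entropy_approx a0 bu erefl)).
rewrite /Hfun in Hu.
have h2 : (1 + a^-1) * Ex P (fun x => (u x - F x) ^+ 2) <= (1 + a^-1) * s by rewrite ler_wpM2l//; lra.
set B := a + _ * _; have hB : B <= b by rewrite /B /a; rewrite /a in h2 s2; lra.
have h3 : B * e <= b * e by rewrite ler_wpM2r// ltW.
have h4 : Lam * B <= Lam * b by rewrite ler_wpM2l.
lra.
Qed.

End clamp.

Lemma xlnx_limit L : Ex P (fun x => F x ^+ 2) = 1 -> approximable true L ->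
  (\int[P]_x (xlnx (F x ^+ 2))%:E <= L%:E)%E.
Proof.
move=> F1 ap.
pose h (k : nat) x := F x ^+ 2 * ln (Num.min (F x ^+ 2) k.+1%:R).
have mF2 : measurable_fun setT (fun x => F x ^+ 2) by exact: measurable_funX.
have mh k : measurable_fun setT (h k).
  apply: measurable_funM => //; apply: (measurableT_comp (@measurable_ln R)).
  exact: measurable_minr.
have k1 k : 1 <= k.+1%:R :> R by rewrite ler1n.
have k0 k : 0 < k.+1%:R :> R by rewrite ltr0n.
have h_ge k x : -1 <= h k x.
  rewrite /h; have [Fk|kF] := leP (F x ^+ 2) k.+1%:R; first by apply: xlnx_ge; exact: sqr_ge0.
  by apply: (@le_trans _ _ 0); rewrite ?lerN10// mulr_ge0 ?sqr_ge0// ln_ge0.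
have h_le k x : h k x <= ln k.+1%:R * F x ^+ 2.
  rewrite /h mulrC; have [->|Fx] := eqVneq (F x ^+ 2) 0; first by rewrite !mulr0.
  rewrite ler_wpM2r ?sqr_ge0// ler_ln ?posrE ?lt_min ?k0 ?andbT//; first by rewrite ge_min lexx orbT.
  by rewrite lt_neqAle eq_sym Fx sqr_ge0.
have ih k : L1 (h k).
  apply: (L1_dom (mh k) (L1D (L1_cst 1) (L1Z (ln k.+1%:R) F2))) => x.
  have := h_ge k x; have := h_le k x; rewrite ler_norml.
  have : 0 <= ln k.+1%:R * F x ^+ 2 by rewrite mulr_ge0 ?sqr_ge0 ?ln_ge0.
  by lra.
have hL k : Ex P (h k) <= L.
  apply/ler_addgt0Pr => e e0; pose e' := Num.min 1 e.
  have e'0 : 0 < e' by rewrite lt_min ltr01.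
  have e'1 : e' <= 1 by rewrite ge_min lexx.
  have e'e : e' <= e by rewrite ge_min lexx orbT.
  apply: (@le_trans _ _ (L + e')); last by rewrite lerD2l.
  apply: le_trans (clamped_entropy_limit e'0 e'1 (k1 k) F1 ap).
  apply: le_Ex_L1; [exact: ih|exact: L1_F2psi|move=> x].
  rewrite /h; have [->|Fx] := eqVneq (F x ^+ 2) 0; first by rewrite !mul0r.
  have Fx0 : 0 < F x ^+ 2 by rewrite lt_neqAle eq_sym Fx sqr_ge0.
  rewrite ler_wpM2l ?sqr_ge0// ler_ln ?posrE ?lt_max ?lt_min ?Fx0 ?k0 ?orbT//.
  by rewrite le_max lexx orbT.
have cvgh x : (h k x + 1)%:E @[k --> \oo] --> (xlnx (F x ^+ 2) + 1)%:E.
  apply: cvg_near_cst; near=> k; rewrite /h min_l//.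
  by rewrite -natr1 ltW// ltr_wpDr//; near: k; exact: nbhs_infty_gtr.
have I1 : (\int[P]_x (xlnx (F x ^+ 2) + 1)%:E <= (L + 1)%:E)%E.
  have H : (\int[P]_x (h k x + 1)%:E @[k --> \oo] --> \int[P]_x (xlnx (F x ^+ 2) + 1)%:E)%E.
    have -> : (\int[P]_x (xlnx (F x ^+ 2) + 1)%:E = \int[P]_x limn (fun k => (h k x + 1)%:E))%E.
      by apply: eq_integral => x _; apply/esym/cvg_lim => //; exact: cvgh.
    apply: cvg_monotone_convergence => //.
    - by move=> k; apply/measurable_EFinP; exact: measurable_funD.
    - by move=> k x _; rewrite lee_fin; have := h_ge k x; lra.
    - move=> x _ m n mn; rewrite lee_fin lerD2r /h.
      have [->|Fx] := eqVneq (F x ^+ 2) 0; first by rewrite !mul0r.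
      have Fx0 : 0 < F x ^+ 2 by rewrite lt_neqAle eq_sym Fx sqr_ge0.
      rewrite ler_wpM2l ?sqr_ge0// ler_ln ?posrE ?lt_min ?Fx0 ?k0//.
      by rewrite le_min ge_min lexx/= ge_min ler_nat ltnS mn orbT.
  apply: (cvge_le _ H).
  apply: nearW => k; rewrite -EFin_Ex_L1; last exact: L1D (ih k) (L1_cst 1).
  by rewrite lee_fin ExD_L1// ?Ex_cst ?lerD2r//; exact: L1_cst.
have mx : measurable_fun setT (fun x => xlnx (F x ^+ 2)) by exact: (measurableT_comp measurable_xlnx).
have i1 : L1 (fun x => xlnx (F x ^+ 2) + 1).
  apply: L1_nneg; first exact: measurable_funD.
    by move=> x; have := xlnx_ge (sqr_ge0 (F x)); lra.
  exact: le_lt_trans I1 (ltry _).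
have i2 : L1 (fun x => xlnx (F x ^+ 2)).
  by have := L1D i1 (L1_cst (-1)); congr L1; apply/funext => x; rewrite addrK.
rewrite -EFin_Ex_L1// lee_fin; move: I1; rewrite -EFin_Ex_L1// lee_fin ExD_L1//; last exact: L1_cst.
by rewrite Ex_cst lerD2r.
Unshelve. all: by end_near. Qed.

End square_integrable_limits.

Section closed_form.
Context {R : realType} {E : completePseudoMetricType R}.
Local Notation TR := (measurableTypeR R).
Local Notation M := (@MT R E).
Implicit Types (nu : @fmeas R E) (G : probability M R) (F : @fmeas R E -> R).

Lemma form0_ge0 G F : (0 <= form0 G F)%E.
Proof.
apply: integral_ge0 => eta _; apply: integral_ge0 => x _.
by rewrite lee_fin sqr_ge0.
Qed.

Lemma in_L2_L1 G F : in_L2 G F -> L1 G (fun eta : M => F eta ^+ 2).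
Proof.
move=> [mF iF]; apply: L1_nneg => //; first exact: measurable_funX.
by move=> x; exact: sqr_ge0.
Qed.

Definition laws_ineq ent nu C := forall (A : set (@EB R E)) (mu : probability TR R), measurable A ->
  (forall B, measurable B -> mu B = gamma_law (fine (fm nu A)) B) -> has_ineq ent mu C.

Lemma cylinder_approximable ent C nu G F u l : 0 <= C -> is_gamma_distribution nu G ->
  laws_ineq ent nu C -> in_L2 G F -> approx_seq G u F -> (form0 G (u k) @[k --> \oo] --> l%:E)%E ->
  0 <= l /\ approximable G (F : M -> R) ent (C * l).
Proof.
move=> C0 GG H L2F [cu du _] ul.
have l0 : 0 <= l.
  by rewrite -lee_fin; apply: (cvge_ge _ ul); apply: nearW => k; exact: form0_ge0.
split => // e e0.
have e1 : 0 < e / (C + 1) by rewrite divr_gt0// ltr_wpDl.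
have [N1 _ hN1] : \forall k \near \oo, (form0 G (u k) <= (l + e / (C + 1))%:E)%E.
  have /fine_cvgP[+ /cvgrPdist_lt /(_ _ e1)] := ul.
  apply: filterS2 => k /= fk; rewrite distrC ltr_norml => /andP[_ hk].
  by rewrite -(fineK fk) lee_fin; lra.
have [N2 hN2] := du _ e0.
set k := maxn N1 N2.
have [bu Hu] := cylinder_ineq C0 GG H (cu k).
exists (u k : M -> R); split => //.
  rewrite -lee_fin; apply: (le_trans Hu).
  apply: (@le_trans _ _ (C%:E * (l + e / (C + 1))%:E)%E).
    by rewrite lee_wpmul2l ?lee_fin//; apply: hN1; rewrite /= leq_maxl.
  rewrite -EFinM lee_fin mulrDr lerD2l mulrA ler_pdivrMr ?ltr_wpDl//; nra.
have [mF _] := L2F.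
rewrite -lee_fin EFin_Ex_L1; last exact: (@L1_dist _ _ _ G F mF (in_L2_L1 L2F) (u k) bu).
by apply: hN2; rewrite leq_maxr.
Qed.

Lemma ereal_inf_affine (S : set R) (c a b : R) : 0 < c -> (forall l, S l -> a <= c * l + b) ->
  (a%:E <= c%:E * ereal_inf [set l%:E | l in S] + b%:E)%E.
Proof.
move=> c0 h; have : ((c^-1 * (a - b))%:E <= ereal_inf [set l%:E | l in S])%E.
  apply/ereal_infP => _ [l Sl <-]; rewrite lee_fin mulrC ler_pdivrMr//.
  by have := h l Sl; lra.
case: (ereal_inf _) => [x| |]//=; last by move=> _; rewrite gt0_muley ?lte_fin//= leey.
rewrite lee_fin -EFinM -EFinD lee_fin mulrC ler_pdivrMr//; lra.
Qed.

Lemma gamma_laws_poincare nu : laws_ineq false nu 1.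
Proof.
move=> A mu mA muE; have := @mass_ge0 _ _ A nu.
rewrite /mass le_eqVlt => /predU1P[A0|A0].
  apply: (gamma0_has_poincare ler01) => B mB.
  by transitivity (gamma_law (fine (fm nu A)) B); [exact: muE|congr gamma_law].
exact: gamma_has_poincare A0 muE.
Qed.

Theorem poincare_gamma nu G : is_gamma_distribution nu G -> poincare G 1.
Proof.
move=> GG F [L2F _]; have [mF _] := L2F; have F2 := in_L2_L1 L2F.
have F1 := L1_F mF F2.
rewrite /Gint -(EFin_Ex_L1 F2) -(EFin_Ex_L1 F1) -EFinM invr1.
apply: ereal_inf_affine => // l [u [ua ul]].
have [l0 ap] := cylinder_approximable ler01 GG (@gamma_laws_poincare nu) L2F ua ul.
rewrite mul1r in ap *; have := variance_limit mF F2 l0 ap.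
by rewrite expr2; lra.
Qed.

Theorem log_sobolev_gamma nu G C F : 0 < C -> is_gamma_distribution nu G -> laws_ineq true nu C ->
  in_domain G F -> Gint G (fun eta => F eta ^+ 2) = 1%E ->
  (Gint G (fun eta => F eta ^+ 2 * ln (F eta ^+ 2))%R <= C%:E * form_closure G F)%E.
Proof.
move=> C0 GG H [L2F _] F1; have [mF _] := L2F; have F2 := in_L2_L1 L2F.
have E1 : Ex G (fun eta : M => F eta ^+ 2) = 1.
  by apply: EFin_inj; rewrite EFin_Ex_L1.
have key l : (exists u, approx_seq G u F /\ (form0 G (u k) @[k --> \oo] --> l%:E)%E) ->
    (Gint G (fun eta => F eta ^+ 2 * ln (F eta ^+ 2))%R <= (C * l)%:E)%E.
  move=> [u [ua ul]].
  have [l0 ap] := cylinder_approximable (ltW C0) GG H L2F ua ul.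
  exact: (xlnx_limit mF F2 E1 ap).
rewrite -lee_pdivrMl//; apply/ereal_infP => _ [l Sl <-].
by rewrite lee_pdivrMl//; exact: key.
Qed.

End closed_form.

(** * Sharpness *)

Section gamma_moments.
Context {R : realType}.
Local Notation mu := (@lebesgue_measure R).
Implicit Types r : R.

Lemma gwS r s : 0 < r -> 0 < s -> gw (r + 1) s = s * gw r s.
Proof. by move=> r0 s0; rewrite -(guE r0 s0) /gw addrK. Qed.

Lemma lee_shift (x K : \bar R) (c e : R) : (x + c%:E <= K)%E -> - c <= e -> (x <= K + e%:E)%E.
Proof.
move=> h ce; have := leeD2r (- c)%:E h; rewrite -addeA -EFinD subrr adde0 => /le_trans; apply.
by rewrite leeD2l// lee_fin.
Qed.

Lemma Gw_succ r : 0 < r -> Gw (r + 1) = (r%:E * Gw r)%E.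
Proof.
move=> r0.
have pos (a b x : R) : 0 < a -> a <= x <= b -> 0 < x by move=> a0 /andP[+ _]; exact: lt_le_trans.
have sub (p : R -> R) (a b : R) : 0 < a -> measurable_fun [set: R] p -> (forall x, 0 <= p x) ->
    (\int[mu]_(x in `[a, b]) (p x)%:E <= \int[mu]_(x in `]0%R, +oo[) (p x)%:E)%E.
  move=> a0 mp p0; apply: ge0_subset_integral => //.
  - by apply/measurable_EFinP; exact: measurable_funTS.
  - by move=> x _; rewrite lee_fin.
  - by move=> x /=; rewrite !in_itv/= andbT => /(pos _ _ _ a0).
have cu s : 0 < s -> ct (fun s => (r - s) * gw r s) s.
  move=> s0; apply: ctM; last exact: ct_gw.
  by apply: ctB; [exact: (@ct_cst R _ _)|exact: (@ct_id R _)].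
have mw q : measurable_fun [set: R] (gw q) by exact: measurable_gw.
have m2 : measurable_fun [set: R] (fun s => r * gw r s) by exact: measurable_funM.
have p2 s : 0 <= r * gw r s by exact: mulr_ge0 (ltW r0) (gw_ge0 r s).
have E2 : (r%:E * Gw r = \int[mu]_(s in `]0%R, +oo[) (r * gw r s)%:E)%E.
  rewrite /Gw -ge0_integralZl//; last by rewrite lee_fin ltW.
  - by apply/measurable_EFinP; exact: (measurable_funTS (mw r)).
  - by move=> s _; rewrite lee_fin gw_ge0.
apply/eqP; rewrite eq_le; apply/andP; split.
  rewrite {1}/Gw; apply: exhaust_oy; first exact: measurable_funTS.
    by move=> x _; exact: gw_ge0.
  move=> a b e a0 ab e0; have [d d0 hd] := gu_small r0 e0.
  pose a' := Num.min a d; have a'0 : 0 < a' by rewrite lt_min a0.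
  have a'a : a' <= a by rewrite ge_min lexx.
  have a'b : a' < b by exact: le_lt_trans ab.
  exists a', b; split=> //.
  have ua : gu r a' <= e by apply: hd => //; rewrite ge_min lexx orbT.
  have := @ftc_le R (gw (r + 1)) (fun s => r * gw r s) (gu r) _ a' b a'b
    (fun s h => dv_gu r0 (pos _ _ _ a'0 h)) (fun s h => cu s (pos _ _ _ a'0 h))
    (fun s h => @ct_gw R _ _ (pos _ _ _ a'0 h)).
  have c2 s : a' <= s <= b -> ct (fun s => r * gw r s) s.
    by move=> h; apply: ctM; [exact: (@ct_cst R _ _)|exact: ct_gw (pos _ _ _ a'0 h)].
  move=> /(_ c2) H; apply: (@lee_shift _ _ (gu r b - gu r a')); last by have := gu_ge0 r b; lra.
  rewrite E2; apply: le_trans (sub _ a' b a'0 m2 p2); apply: H => s h.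
  by rewrite (gwS r0 (pos _ _ _ a'0 h)) -mulrDl addrCA subrr addr0.
rewrite E2; apply: exhaust_oy; [exact: measurable_funTS|by move=> x _; exact: p2|].
move=> a b e a0 ab e0; have [b' bb' [b'0 hb]] := gu_large r0 b e0.
have ab' : a < b' by exact: lt_le_trans bb'.
exists a, b'; split=> //.
have := @ftc_le R (fun s => r * gw r s) (gw (r + 1)) (fun s => - gu r s) _ a b' ab'
  (fun s h => dvN (dv_gu r0 (pos _ _ _ a0 h))) (fun s h => ctN (cu _ (pos _ _ _ a0 h))).
have c2 s : a <= s <= b' -> ct (fun s => r * gw r s) s.
  by move=> h; apply: ctM; [exact: (@ct_cst R _ _)|exact: ct_gw (pos _ _ _ a0 h)].
move=> /(_ c2 (fun s h => @ct_gw R _ _ (pos _ _ _ a0 h))) H.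
apply: (@lee_shift _ _ (- gu r b' - - gu r a)); last by have := gu_ge0 r a; lra.
apply: le_trans (sub _ a b' a0 (mw _) (gw_ge0 _)); apply: H => s h.
by rewrite (gwS r0 (pos _ _ _ a0 h)) le_eqVlt; apply/orP; left; apply/eqP; ring.
Qed.

Lemma gamma_moment (nu : {measure set (measurableTypeR R) -> \bar R}) r : 0 < r ->
  (forall B, measurable B -> nu B = gamma_law r B) ->
  (\int[nu]_x `|x|%:E = r%:E)%E /\ (\int[nu]_x (x ^+ 2)%:E = (r + r ^+ 2)%:E)%E.
Proof.
move=> r0 nuE; have G0 := fine_Gw_gt0 r0; have r1 : 0 < r + 1 by lra.
have E1 := Gw_succ r0; have E2 := Gw_succ r1.
rewrite -(fine_Gw r0) -EFinM in E1; rewrite E1 -EFinM in E2.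
split; rewrite (integral_gamma_law r0 nuE)//.
- have -> : (\int[mu]_(s in `]0%R, +oo[) (`|s| * gw r s)%:E = Gw (r + 1))%E.
    apply: eq_integral => s; rewrite inE/= in_itv/= andbT => s0.
    by rewrite (gwS r0 s0) gtr0_norm.
  by rewrite E1 -EFinM; congr (_%:E); field; rewrite gt_eqF.
- have -> : (\int[mu]_(s in `]0%R, +oo[) (s ^+ 2 * gw r s)%:E = Gw (r + 1 + 1))%E.
    apply: eq_integral => s; rewrite inE/= in_itv/= andbT => s0.
    by rewrite (gwS r1 s0) (gwS r0 s0) mulrA.
  by rewrite E2 -EFinM; congr (_%:E); field; rewrite gt_eqF.
- by move=> x; exact: sqr_ge0.
Qed.

End gamma_moments.

Section mass_moments.
Context {R : realType} {E : completePseudoMetricType R}.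
Local Notation TR := (measurableTypeR R).
Local Notation M := (@MT R E).
Variables (nu : @fmeas R E) (G : probability M R) (A : set (@EB R E)).
Hypotheses (GG : is_gamma_distribution nu G) (mA : measurable A).

Lemma mass_law (B : set R) : measurable B ->
  G (mass A @^-1` B) = gamma_law (fine (fm nu A)) B.
Proof.
move=> mB; have := GG (fun _ : 'I_1 => mA) _ (fun _ : 'I_1 => mB).
rewrite big_ord1 => <-; last by move=> i j; rewrite !ord1.
by congr (G _); apply/seteqP; split => [eta h i|eta /(_ ord0)].
Qed.

Lemma mass_integral (h : R -> R) : measurable_fun [set: R] h -> (forall x, 0 <= h x) ->
  exists nu' : {measure set TR -> \bar R},
    (forall B, measurable B -> nu' B = gamma_law (fine (fm nu A)) B) /\
    (\int[G]_eta (h (mass A eta))%:E = \int[nu']_x (h x)%:E)%E.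
Proof.
move=> mh h0; have mm : measurable_fun [set: M] (mass A : M -> TR) by exact: measurable_mass.
have I := @ge0_integral_pushforward _ _ M TR R (mass A) mm G setT (EFin \o h) measurableT.
exists (measure_function_pushforward__canonical__measure_function_Measure G mm); split.
  by move=> B mB; exact: mass_law.
apply/esym; apply: I; first exact/measurable_EFinP.
by move=> x _; rewrite lee_fin.
Qed.

Lemma mass_moments : (0 < fm nu A)%E -> let r := fine (fm nu A) in
  [/\ 0 < r, L1 G (mass A), L1 G (fun eta => mass A eta ^+ 2), Ex G (mass A) = r &
      Ex G (fun eta => mass A eta ^+ 2) = r + r ^+ 2].
Proof.
move=> A0 r; have r0 : 0 < r by rewrite fine_gt0// A0 fm_lty.
have mn : measurable_fun [set: R] (fun x : R => `|x|) by exact: measurableT_comp.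
have [n1 [n1E I1]] := mass_integral mn (@normr_ge0 _ _).
have ms : measurable_fun [set: R] (fun x : R => x ^+ 2) by exact: measurable_funX.
have [n2 [n2E I2]] := mass_integral ms (@sqr_ge0 R).
have {}I1 : (\int[G]_eta (mass A eta)%:E = r%:E)%E.
  rewrite -(proj1 (gamma_moment r0 n1E)) -I1.
  by apply: eq_integral => eta _; rewrite ger0_norm// mass_ge0.
rewrite (proj2 (gamma_moment r0 n2E)) in I2.
have L1m : L1 G (mass A).
  apply: L1_nneg; [exact: measurable_mass|by move=> eta; exact: mass_ge0|by rewrite I1 ltry].
have L1s : L1 G (fun eta => mass A eta ^+ 2).
  apply: L1_nneg; [by apply: measurable_funX; exact: measurable_mass|by move=> eta; exact: sqr_ge0|].
  by rewrite I2 ltry.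
by split=> //; apply: EFin_inj; rewrite EFin_Ex_L1.
Qed.

End mass_moments.

Section flat_exponential.
Context {R : realType}.
Implicit Types (x t : R) (k : nat).

Definition flatexp k x : R := if 0 < x then x^-1 ^+ k * expR (- x^-1) else 0.

Lemma flatexp_mul k x : flatexp k x = x * flatexp k.+1 x.
Proof.
rewrite /flatexp; case: ifPn => [x0|_]; last by rewrite mulr0.
by rewrite exprS !mulrA divff ?gt_eqF// mul1r.
Qed.

Lemma flatexp_ge0 k x : 0 <= flatexp k x.
Proof.
rewrite /flatexp; case: ifPn => // x0; rewrite mulr_ge0 ?expR_ge0//.
by rewrite exprn_ge0// invr_ge0 ltW.
Qed.

Lemma flatexp_bounded k : exists2 C, 0 < C & forall x, flatexp k x <= C.
Proof.
have k0 : 0 < k.+1%:R :> R by rewrite ltr0n.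
suff [C C0 HC] : exists2 C, 0 < C & forall y : R, 0 < y -> y ^+ k * expR (- y) <= C.
  exists C => // x; rewrite /flatexp; case: ifPn => [x0|_]; last exact: ltW.
  by apply: HC; rewrite invr_gt0.
have [C C0 HC] := powR_le_expR k0.
exists (C + 1) => [|y y0]; first by rewrite addr_gt0.
have ee : expR y * expR (- y) = 1 by rewrite -expRD subrr expR0.
have e1 : expR (y / 2) <= expR y by rewrite ler_expR; lra.
have e0 := expR_ge0 (- y).
have h : y ^+ k <= C * expR y + expR y.
  have [y1|y1] := leP y 1.
    have : y ^+ k <= 1 by rewrite exprn_ile1// ltW.
    have : 1 <= expR y by rewrite -expR0 ler_expR ltW.
    have := mulr_ge0 (ltW C0) (expR_ge0 y); lra.
  have : y ^+ k <= y ^+ k.+1 by rewrite ler_eXn2l// ltW.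
  have := HC _ y0; rewrite powR_mulrn ?(ltW y0)// => h1 h2.
  have := expR_ge0 y; have := ler_wpM2l (ltW C0) e1; lra.
have := ler_wpM2r e0 h; rewrite mulrDl -mulrA ee; lra.
Qed.

Lemma ct_flatexp0 k : ct (flatexp k) 0.
Proof.
have [C C0 HC] := flatexp_bounded k.+1.
have b0 : flatexp k 0 = 0 by rewrite /flatexp ltxx.
apply/cvgrPdist_lt => e e0.
have d0 : 0 < e / C by rewrite divr_gt0.
apply: (@filterS _ _ (nbhs_filter (0:R)) _ _ _ (nbhsx_ballx (0:R) _ d0)) => y.
rewrite /ball/= b0 !sub0r !normrN => yd.
rewrite flatexp_mul normrM (ger0_norm (flatexp_ge0 _ _)).
apply: (@le_lt_trans _ _ (`|y| * C)); first by rewrite ler_wpM2l.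
by rewrite -ltr_pdivlMr.
Qed.

Lemma dv_near (f g : R -> R) x a : (\near x, f x = g x) -> dv f x a -> dv g x a.
Proof. exact: near_eq_is_derive. Qed.

Lemma dv_exprn (f : R -> R) x a k : dv f x a -> dv (fun t => f t ^+ k.+1) x (k.+1%:R * f x ^+ k * a).
Proof.
move=> df; elim: k => [|k IH].
  by apply: dv_eq; first exact: df; rewrite expr0 !mul1r.
have -> : (fun t => f t ^+ k.+2) = (fun t => f t * f t ^+ k.+1) by apply/funext => t; rewrite exprS.
apply: dv_eq; first exact: (dvM df IH).
by rewrite /= (exprS _ k) -(natr1 k.+1); ring.
Qed.

Lemma dv_flatexp k x : dv (flatexp k) x (- k%:R * flatexp k.+1 x + flatexp k.+2 x).
Proof.
have [x0|x0|->] := ltgtP x 0.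
- have -> : - k%:R * flatexp k.+1 x + flatexp k.+2 x = 0.
    by rewrite /flatexp ltNge (ltW x0)/= mulr0 addr0.
  apply: (@dv_near (fun=> 0)); last exact: dv_cst.
  have : nbhs x [set y | y < 0] by apply: open_nbhs_nbhs; split => //; exact: open_lt.
  by apply: (@filterS _ _ (nbhs_filter x)) => y /= y0; rewrite /flatexp ltNge (ltW y0).
- apply: (@dv_near (fun t => t^-1 ^+ k * expR (- t^-1))).
    have : nbhs x [set y | 0 < y] by apply: open_nbhs_nbhs; split => //; exact: open_gt.
    by apply: (@filterS _ _ (nbhs_filter x)) => y /= y0; rewrite /flatexp y0.
  have xn0 : x != 0 by rewrite gt_eqF.
  have dV : dv (fun t : R => t^-1) x (- x^-1 ^+ 2).
    by apply: (dv_eq (@dvV R id x 1 xn0 (dv_id x))); rewrite /= mulN1r exprVn.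
  have dE : dv (fun t => expR (- t^-1)) x (x^-1 ^+ 2 * expR (- x^-1)).
    have := @dv_comp _ expR (fun t => - t^-1) x _ _ (is_derive_expR _) (dvN dV).
    by rewrite opprK mulrC.
  rewrite /flatexp x0; case: k => [|k].
    have -> : (fun t => t^-1 ^+ 0 * expR (- t^-1)) = (fun t => expR (- t^-1)).
      by apply/funext => t; rewrite mul1r.
    by apply: dv_eq; first exact: dE; rewrite oppr0 mul0r add0r.
  apply: dv_eq; first exact: (dvM (dv_exprn k dV) dE).
  by rewrite !exprS; ring.
- have -> : - k%:R * flatexp k.+1 0 + flatexp k.+2 0 = 0.
    by rewrite /flatexp ltxx mulr0 addr0.
  apply/is_derive1_caratheodory; exists (flatexp k.+1); split => [z||]; last by rewrite /flatexp ltxx.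
    by rewrite subr0 [flatexp k z]flatexp_mul {2}/flatexp ltxx subr0 mulrC.
  exact: ct_flatexp0.
Qed.

End flat_exponential.

Section smooth_class.
Context {R : realType} {n : nat}.
Local Notation V := 'rV[R]_n.
Implicit Types (f g : V -> R) (v x : V).

Inductive smc : (V -> R) -> Prop :=
| smc_cst c : smc (fun=> c)
| smc_coord i : smc (fun v => v ord0 i)
| smc_add f g : smc f -> smc g -> smc (fun v => f v + g v)
| smc_mul f g : smc f -> smc g -> smc (fun v => f v * g v)
| smc_flatexp k f : smc f -> smc (fun v => flatexp k (f v)).

Lemma smc_continuous f : smc f -> continuous f.
Proof.
elim=> [c|i|{}f g _ cf _ cg|{}f g _ cf _ cg|k {}f _ cf] x.
- exact: cst_continuous.
- exact: coord_continuous.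
- exact: (continuousD (cf x) (cg x)).
- exact: (continuousM (cf x) (cg x)).
- by apply: (continuous_comp (f := f) (g := flatexp k)); [exact: cf|exact: dv_ct (dv_flatexp k (f x))].
Qed.

Lemma smc_line f v : smc f -> exists2 f', smc f' &
  forall x, dv (fun t : R => f (x + t *: v)) 0 (f' x).
Proof.
elim=> [c|i|{}f g _ [f' sf' df] _ [g' sg' dg]|{}f g sf [f' sf' df] sg [g' sg' dg]|k {}f sf [f' sf' df]].
- by exists (fun=> 0) => [|x]; [exact: smc_cst|exact: dv_cst].
- exists (fun=> v ord0 i) => [|x]; first exact: smc_cst.
  have -> : (fun t : R => (x + t *: v) ord0 i) = (fun t : R => x ord0 i + t * v ord0 i).
    by apply/funext => t; rewrite !mxE.
  apply: dv_eq.
    by apply: dvD; [exact: dv_cst|apply: dvM; [exact: dv_id|exact: dv_cst]].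
  by rewrite /=; ring.
- exists (fun x => f' x + g' x) => [|x]; first exact: smc_add.
  exact: dvD.
- exists (fun x => f' x * g x + f x * g' x) => [|x]; first by apply: smc_add; exact: smc_mul.
  apply: dv_eq; first exact: (dvM (df x) (dg x)).
  by rewrite /= scale0r addr0.
- exists (fun x => (- k%:R * flatexp k.+1 (f x) + flatexp k.+2 (f x)) * f' x) => [|x].
    apply: smc_mul => //; apply: smc_add; last exact: smc_flatexp.
    by apply: smc_mul; [exact: smc_cst|exact: smc_flatexp].
  apply: (@dv_comp _ (flatexp k)); last exact: df.
  by rewrite scale0r addr0; exact: dv_flatexp.
Qed.

Lemma line_derive f v x a : dv (fun t : R => f (x + t *: v)) 0 a -> is_derive x v f a.
Proof.
have E : (fun h : R => h^-1 *: (((fun t : R => f (x + t *: v)) \o shift 0) (h *: (1:R)) - f (x + 0 *: v))) =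
   (fun h => h^-1 *: ((f \o shift x) (h *: v) - f x)).
  apply/funext => h /=; congr (_ *: (f _ - f _)); last by rewrite scale0r addr0.
  by rewrite [h *: 1]mulr1 addr0 addrC.
by move=> [d1 d2]; move: d1 d2; rewrite /derivable /derive E => d1 d2; split.
Qed.

Lemma smc_smooth f : smc f -> smooth_fun f.
Proof.
have key g : smc g -> forall v, smc ('D_v g) /\ forall x, derivable g x v.
  move=> sg v; have [g' sg' dg] := smc_line v sg.
  have dg' x := line_derive (dg x).
  split=> [|x]; last by have [] := dg' x.
  have -> // : 'D_v g = g'; apply/funext => x; have [_ //] := dg' x.
move=> sf vs; have sD : smc (iter_dir_deriv vs f).
  by elim: vs => [|v vs IH] //=; have [] := key _ IH v.
split; first exact: smc_continuous.
by move=> v; have [] := key _ sD v.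
Qed.

End smooth_class.

Lemma dv_unique (R : realType) (f : R -> R) x a b : dv f x a -> dv f x b -> a = b.
Proof. by move=> [_ <-] [_ <-]. Qed.

Section cutoff.
Context {R : realType}.
Implicit Types (t x : R).

Definition chi t : R := expR 1 * flatexp 0 (1 - t ^+ 2).
Definition chi' t : R := expR 1 * (flatexp 2 (1 - t ^+ 2) * (- (2 * t))).

Lemma dv_chi t : dv chi t (chi' t).
Proof.
have d1 : dv (fun t => 1 - t ^+ 2) t (- (2 * t)).
  apply: dv_eq; first by apply: dvB; [exact: (@dv_cst R _ 1)|apply: dv_sqr; exact: dv_id].
  by rewrite sub0r mulr1.
have d2 := @dv_comp R (flatexp 0) (fun t => 1 - t ^+ 2) t _ _ (dv_flatexp 0 _) d1.
apply: dv_eq; first exact: (dvM (@dv_cst R t (expR 1)) d2).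
by rewrite mul0r add0r oppr0 mul0r add0r.
Qed.

Lemma ct_chi t : ct chi t. Proof. exact: dv_ct (dv_chi t). Qed.

Lemma ct_chi' t : ct chi' t.
Proof.
have d1 : ct (fun t => 1 - t ^+ 2) t.
  by apply: ctB; [exact: (@ct_cst R _ _)|apply: ct_sqr; exact: (@ct_id R _)].
apply: ctM; first exact: (@ct_cst R _ _).
apply: ctM.
  by apply: (continuous_comp (g := flatexp 2)); [exact: d1|exact: dv_ct (dv_flatexp 2 _)].
by apply: ctN; apply: ctM; [exact: (@ct_cst R _ _)|exact: (@ct_id R _)].
Qed.

Lemma chi0 : chi 0 = 1.
Proof.
by rewrite /chi /flatexp expr0n/= subr0 ltr01 expr0 mul1r invr1 -expRD subrr expR0.
Qed.

Lemma chi'0 : chi' 0 = 0. Proof. by rewrite /chi' mulr0 oppr0 !mulr0. Qed.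

Lemma chi_ge0 t : 0 <= chi t.
Proof. by rewrite mulr_ge0 ?expR_ge0 ?flatexp_ge0. Qed.

Lemma chi_le1 t : chi t <= 1.
Proof.
rewrite /chi /flatexp; case: ifPn => [x0|_]; last by rewrite mulr0.
rewrite expr0 mul1r -expRD -[leRHS]expR0 ler_expR subr_le0.
by rewrite invf_ge1//; have := sqr_ge0 t; lra.
Qed.

Lemma sqr_lt1 t : 0 < 1 - t ^+ 2 -> `|t| < 1.
Proof.
move=> h; rewrite ltNge; apply/negP => t1.
by have : 1 <= t ^+ 2; [rewrite -real_normK ?num_real// exprn_ege1|lra].
Qed.

Lemma chi_support t : chi t != 0 -> `|t| <= 1.
Proof.
rewrite /chi /flatexp; case: ifPn => [/sqr_lt1/ltW//|_]; by rewrite mulr0 eqxx.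
Qed.

Lemma chi_mul_le t : `|t * chi t| <= 1.
Proof.
have [->|h] := eqVneq (chi t) 0; first by rewrite mulr0 normr0.
by rewrite normrM (ger0_norm (chi_ge0 t)) mulr_ile1// ?chi_le1 ?chi_ge0 ?chi_support.
Qed.

Lemma chi'_bounded : exists2 c, 0 <= c & forall t, `|chi' t| <= c /\ `|t * chi' t| <= c.
Proof.
have [C C0 HC] := @flatexp_bounded R 2.
have c0 : 0 <= expR 1 * (C * 2) :> R by rewrite !mulr_ge0 ?expR_ge0// ltW.
exists (expR 1 * (C * 2)) => // t.
have [t1|t1] := leP (1 - t ^+ 2) 0.
  by rewrite /chi' /flatexp ltNge t1/= mul0r !mulr0 normr0.
have {}t1 := ltW (sqr_lt1 t1).
have h : `|chi' t| <= expR 1 * (C * 2).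
  rewrite /chi' normrM (ger0_norm (expR_ge0 _)) ler_wpM2l ?expR_ge0//.
  rewrite normrM (ger0_norm (flatexp_ge0 _ _)) normrN normrM (@ger0_norm _ 2)//.
  apply: ler_pM => //; first exact: flatexp_ge0.
  by rewrite -[leRHS]mulr1 ler_wpM2l.
split=> //; rewrite normrM; apply: le_trans h.
by rewrite -[leRHS]mul1r ler_wpM2r.
Qed.

Definition tf (a : R) (v : 'rV[R]_2) : R :=
  v ord0 ord0 * (chi (a * v ord0 ord0) * chi (a * v ord0 ord_max)).

Lemma tf_smooth a : smooth_fun (tf a).
Proof.
apply: smc_smooth.
have sc i : smc (fun v : 'rV[R]_2 => chi (a * v ord0 i)).
  have -> : (fun v : 'rV[R]_2 => chi (a * v ord0 i)) =
      (fun v : 'rV[R]_2 => expR 1 * flatexp 0 (1 + (- a ^+ 2) * (v ord0 i * v ord0 i))).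
    by apply/funext => v; rewrite /chi; congr (_ * flatexp 0 _); ring.
  apply: smc_mul; first exact: smc_cst.
  apply: smc_flatexp; apply: smc_add; first exact: smc_cst.
  by apply: smc_mul; [exact: smc_cst|apply: smc_mul; exact: smc_coord].
by apply: smc_mul; [exact: smc_coord|exact: smc_mul].
Qed.

Lemma tf_compact a : 0 < a -> compact_support (tf a).
Proof.
move=> a0; rewrite /compact_support.
pose B := [set v : 'rV[R]_2 | forall i, `[- a^-1, a^-1]%classic (v ord0 i)].
have cB : compact B.
  by apply: (@rV_compact R 2 (fun=> `[- a^-1, a^-1]%classic)) => i; exact: segment_compact.
have hB : closed B by apply: compact_closed => //; exact: norm_hausdorff.
apply: (subclosed_compact _ cB); first exact: closed_closure.
rewrite [X in _ `<=` X](closure_id B).1//; apply: closure_subset => v /=.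
rewrite /tf mulf_eq0 (mulf_eq0 (chi _)) !negb_or => /and3P[_ n1 n2] i.
have h1 := chi_support n1; have h2 := chi_support n2.
have {}h : `|a * v ord0 i| <= 1.
  by case: i => [[|[|//]] ilt]; [move: h1|move: h2]; congr (`|a * v ord0 _| <= 1); exact/val_inj.
rewrite /= in_itv/= -ler_norml.
by move: h; rewrite normrM (gtr0_norm a0) -[a^-1]mul1r ler_pdivlMr// mulrC.
Qed.

Definition tf0 (a x y : R) : R := (chi (a * x) + a * x * chi' (a * x)) * chi (a * y).
Definition tf1 (a x y : R) : R := a * x * chi (a * x) * chi' (a * y).

Lemma pd_tf0 a v : pd (tf a) ord0 v = tf0 a (v ord0 ord0) (v ord0 ord_max).
Proof.
have h := smooth_dv (tf_smooth a) ord0 v 0; rewrite scale0r addr0 in h.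
apply: (dv_unique h); rewrite /tf.
set x := v ord0 ord0; set y := v ord0 ord_max.
have -> : (fun t : R => (v + t *: delta_mx 0 ord0) ord0 ord0 * (chi (a * (v + t *: delta_mx 0 ord0) ord0 ord0)
   * chi (a * (v + t *: delta_mx 0 ord0) ord0 ord_max))) =
   (fun t : R => (x + t) * (chi (a * (x + t)) * chi (a * y))).
  by apply/funext => t; rewrite !mxE/= mulr1 mulr0 addr0.
have d1 : dv (fun t => x + t) 0 (0 + 1) by apply: dvD; [exact: dv_cst|exact: dv_id].
have d2 := dvM (@dv_cst R 0 a) d1.
have d3 := @dv_comp R chi (fun t => a * (x + t)) 0 _ _ (dv_chi _) d2.
apply: dv_eq; first exact: (dvM d1 (dvM d3 (@dv_cst R 0 (chi (a * y))))).
by rewrite /= !addr0 /tf0; ring.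
Qed.

Lemma pd_tf1 a v : pd (tf a) ord_max v = tf1 a (v ord0 ord0) (v ord0 ord_max).
Proof.
have h := smooth_dv (tf_smooth a) ord_max v 0; rewrite scale0r addr0 in h.
apply: (dv_unique h); rewrite /tf.
set x := v ord0 ord0; set y := v ord0 ord_max.
have -> : (fun t : R => (v + t *: delta_mx 0 ord_max) ord0 ord0 *
    (chi (a * (v + t *: delta_mx 0 ord_max) ord0 ord0) * chi (a * (v + t *: delta_mx 0 ord_max) ord0 ord_max))) =
   (fun t : R => x * chi (a * x) * chi (a * (y + t))).
  by apply/funext => t; rewrite !mxE/= mulr1 mulr0 addr0 mulrA.
have d1 : dv (fun t => y + t) 0 (0 + 1) by apply: dvD; [exact: dv_cst|exact: dv_id].
have d2 := dvM (@dv_cst R 0 a) d1.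
have d3 := @dv_comp R chi (fun t => a * (y + t)) 0 _ _ (dv_chi _) d2.
apply: dv_eq; first exact: (dvM (@dv_cst R 0 (x * chi (a * x))) d3).
by rewrite /= !addr0 /tf1; ring.
Qed.

Lemma harmonic_mul_cvg x : k.+1%:R^-1 * x @[k --> \oo] --> (0 : R).
Proof. by rewrite -[X in _ --> X](mul0r x); apply: cvgMl; exact: cvg_harmonic. Qed.

Lemma chi_cvg x : chi (k.+1%:R^-1 * x) @[k --> \oo] --> (1 : R).
Proof. by have := cvg_comp _ _ (harmonic_mul_cvg x) (@ct_chi 0); rewrite chi0. Qed.

Lemma chi'_cvg x : chi' (k.+1%:R^-1 * x) @[k --> \oo] --> (0 : R).
Proof. by have := cvg_comp _ _ (harmonic_mul_cvg x) (@ct_chi' 0); rewrite chi'0. Qed.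

Lemma tf0_cvg x y : tf0 k.+1%:R^-1 x y @[k --> \oo] --> (1 : R).
Proof.
rewrite [X in _ --> X](_ : 1 = (1 + 0 * 0) * 1); last by rewrite mulr0 addr0 mulr1.
apply: cvgM; last exact: chi_cvg.
apply: cvgD; first exact: chi_cvg.
apply: cvgM; last exact: chi'_cvg.
exact: harmonic_mul_cvg.
Qed.

Lemma tf1_cvg x y : tf1 k.+1%:R^-1 x y @[k --> \oo] --> (0 : R).
Proof.
rewrite [X in _ --> X](_ : 0 = 0 * 1 * 0); last by rewrite mulr0.
apply: cvgM; last exact: chi'_cvg.
apply: cvgM; last exact: chi_cvg.
exact: harmonic_mul_cvg.
Qed.

End cutoff.

Section test_functions.
Context {R : realType} {E : completePseudoMetricType R}.
Local Notation M := (@MT R E).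
Variables (nu : @fmeas R E) (G : probability M R) (A : set (@EB R E)).
Hypotheses (GG : is_gamma_distribution nu G) (mA : measurable A) (A0 : (0 < fm nu A)%E).

Definition bipart (i : 'I_2) : set (@EB R E) := if i == ord0 then A else ~` A.

Definition tF (k : nat) (eta : @fmeas R E) : R :=
  tf k.+1%:R^-1 (rvec (fun i => mass (bipart i)) eta).

Lemma bipart_measurable i : measurable (bipart i).
Proof. by rewrite /bipart; case: ifP => // _; exact: measurableC. Qed.

Lemma bipart_disjoint i j : i != j -> bipart i `&` bipart j = set0.
Proof.
case: i => [[|[|//]] ip]; case: j => [[|[|//]] jp] //= _; rewrite /bipart -!val_eqE/=.
  by rewrite setICr.
by rewrite setICl.
Qed.

Lemma bipart_cover : \bigcup_i bipart i = setT.
Proof.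
apply/seteqP; split => // x _; have [Ax|Ax] := pselect (A x).
  by exists ord0 => //; rewrite /bipart eqxx.
by exists ord_max.
Qed.

Lemma tF_cylinder k : is_cylinder (tF k).
Proof.
exists 2%N, bipart, (tf k.+1%:R^-1); split=> //; split; first exact: bipart_measurable.
split; first exact: bipart_disjoint.
split; first exact: bipart_cover.
split; first exact: tf_smooth.
by split=> //; apply: tf_compact; rewrite invr_gt0.
Qed.

Lemma tF_bm k : bm (tF k : M -> R).
Proof.
have kf : compact_support (@tf R k.+1%:R^-1) by apply: tf_compact; rewrite invr_gt0.
exact: (cylinder_bm bipart_measurable (@tf_smooth R _) kf G).
Qed.

Lemma tF_form0 k : form0 G (tF k) =
  (Ex G (fun eta => mass A eta * tf0 k.+1%:R^-1 (mass A eta) (mass (~` A) eta) ^+ 2) +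
   Ex G (fun eta => mass (~` A) eta * tf1 k.+1%:R^-1 (mass A eta) (mass (~` A) eta) ^+ 2))%:E.
Proof.
have kf : compact_support (@tf R k.+1%:R^-1) by apply: tf_compact; rewrite invr_gt0.
rewrite (form0_cylinder bipart_measurable bipart_disjoint bipart_cover (@tf_smooth R _) kf G).
rewrite big_ord_recl big_ord1; congr (_ + _)%:E; apply: eq_Ex => eta.
  by rewrite pd_tf0 !mxE ger0_norm// mass_ge0.
have -> : lift ord0 ord0 = ord_max :> 'I_2 by exact/val_inj.
by rewrite pd_tf1 !mxE ger0_norm// mass_ge0.
Qed.

Lemma approx_seq_cst F : is_cylinder F -> approx_seq G (fun=> F) F.
Proof.
move=> cF; split => // e e0; exists 0%N => k.
  move=> _; under eq_integral do rewrite subrr expr0n/=.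
  by rewrite integral0 lee_fin ltW.
move=> m _ _.
have -> : form0 G (fun eta => F eta - F eta) = 0%E; last by rewrite lee_fin ltW.
rewrite /form0; apply: integral0_eq => eta _; apply: integral0_eq => x _.
rewrite /grad_ext; under eq_fun do rewrite !subrr mul0r.
by rewrite lim_cst// expr0n.
Qed.

Lemma cylinder_in_domain F : bm (F : M -> R) -> is_cylinder F -> in_domain G F.
Proof.
move=> bF cF; split; last by exists (fun=> F); exact: approx_seq_cst.
split; first by case: bF.
by rewrite -(EFin_Ex G (bm_sqr bF)) ltry.
Qed.

Lemma form_closure_le_form0 F l : is_cylinder F -> form0 G F = l%:E -> (form_closure G F <= l%:E)%E.
Proof.
move=> cF Fl; apply: ereal_inf_lbound; exists l => //; exists (fun=> F).
by split; [exact: approx_seq_cst|rewrite Fl; exact: cvg_cst].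
Qed.

Let r := fine (fm nu A).
Let X : M -> R := mass A.
Let Y : M -> R := mass (~` A).

Lemma L1_mass_setC : L1 G Y.
Proof.
have T0 : (0 < fm nu setT)%E.
  by apply: (lt_le_trans A0); apply: le_measure; rewrite ?inE.
have [_ L1T _ _ _] := mass_moments GG measurableT T0.
apply: (L1_dom _ L1T); first exact: measurable_mass (measurableC mA).
have mAc := measurableC mA.
by move=> eta; rewrite ger0_norm ?mass_ge0// -lee_fin !massK//; apply: le_measure; rewrite ?inE.
Qed.

Lemma measurable_tf k :
  measurable_fun [set: M] (fun eta => X eta * tf0 k.+1%:R^-1 (X eta) (Y eta) ^+ 2) /\
  measurable_fun [set: M] (fun eta => Y eta * tf1 k.+1%:R^-1 (X eta) (Y eta) ^+ 2).
Proof.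
have mX : measurable_fun [set: M] X by exact: measurable_mass.
have mY : measurable_fun [set: M] Y by exact: measurable_mass (measurableC mA).
have mchi : measurable_fun [set: R] (@chi R) by apply: continuous_measurable_fun => t; exact: (@ct_chi R t).
have mchi' : measurable_fun [set: R] (@chi' R) by apply: continuous_measurable_fun => t; exact: (@ct_chi' R t).
have maX : measurable_fun [set: M] (fun eta => k.+1%:R^-1 * X eta) by exact: measurable_funM.
have maY : measurable_fun [set: M] (fun eta => k.+1%:R^-1 * Y eta) by exact: measurable_funM.
split; apply: measurable_funM => //; apply: measurable_funX; apply: measurable_funM.
- apply: measurable_funD; first exact: (measurableT_comp mchi).
  by apply: measurable_funM => //; exact: (measurableT_comp mchi').
- exact: (measurableT_comp mchi).
- by apply: measurable_funM => //; exact: (measurableT_comp mchi).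
- exact: (measurableT_comp mchi').
Qed.

Lemma tFE k eta : tF k eta = X eta * (chi (k.+1%:R^-1 * X eta) * chi (k.+1%:R^-1 * Y eta)).
Proof. by rewrite /tF /tf !mxE. Qed.

Lemma tF_ge0 k eta : 0 <= tF k eta.
Proof. rewrite tFE; exact: mulr_ge0 (mass_ge0 _ _) (mulr_ge0 (chi_ge0 _) (chi_ge0 _)). Qed.

Lemma tF_le k eta : tF k eta <= X eta.
Proof.
rewrite tFE -[leRHS]mulr1 ler_wpM2l ?mass_ge0// mulr_ile1 ?chi_ge0 ?chi_le1//.
Qed.

Lemma tF_cvg eta : tF k eta @[k --> \oo] --> X eta.
Proof.
rewrite (_ : tF^~ eta = fun k => X eta * (chi (k.+1%:R^-1 * X eta) * chi (k.+1%:R^-1 * Y eta))).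
  by have h := cvgM (cvg_cst (X eta)) (cvgM (chi_cvg (X eta)) (chi_cvg (Y eta))); rewrite !mulr1 in h; exact: h.
by apply/funext => k; rewrite tFE.
Qed.

Lemma tF_limits : [/\ 0 < r, Ex G (tF k : M -> R) @[k --> \oo] --> r,
  Ex G (fun eta : M => tF k eta ^+ 2) @[k --> \oo] --> r + r ^+ 2 &
  Ex G (fun eta => X eta * tf0 k.+1%:R^-1 (X eta) (Y eta) ^+ 2) +
   Ex G (fun eta => Y eta * tf1 k.+1%:R^-1 (X eta) (Y eta) ^+ 2) @[k --> \oo] --> r].
Proof.
have [r0 LX LX2 EX EX2] := mass_moments GG mA A0.
have mX : measurable_fun [set: M] X by exact: measurable_mass.
have mt k : measurable_fun [set: M] (tF k : M -> R) by case: (tF_bm k).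
have [c c0 hc] := @chi'_bounded R.
have b0 (a x y : R) : tf0 a x y ^+ 2 <= (1 + c) ^+ 2.
  rewrite -[leLHS]ger0_norm ?sqr_ge0// normrX lerXn2r ?nnegrE ?addr_ge0//.
  rewrite /tf0 normrM -[leRHS]mulr1; apply: ler_pM => //; last by rewrite ger0_norm ?chi_ge0 ?chi_le1.
  rewrite (le_trans (ler_normD _ _))// lerD// ?(hc _).2//.
  by rewrite ger0_norm ?chi_ge0 ?chi_le1.
have b1 (a x y : R) : tf1 a x y ^+ 2 <= c ^+ 2.
  rewrite -[leLHS]ger0_norm ?sqr_ge0// normrX lerXn2r ?nnegrE//.
  by rewrite /tf1 normrM -[leRHS]mul1r; apply: ler_pM; rewrite ?chi_mul_le// (hc _).1.
split => //.
- rewrite -[X in _ --> X]EX; apply: (Ex_cvg_dominated mt LX _ tF_cvg mX) => k eta.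
  by rewrite ger0_norm ?tF_ge0 ?tF_le.
- rewrite -[X in _ --> X]EX2; apply: (Ex_cvg_dominated _ LX2 _ _ (measurable_funX 2 mX)) => [k|k eta|eta].
  + exact: measurable_funX.
  + rewrite ger0_norm ?sqr_ge0// lerXn2r ?nnegrE ?tF_ge0 ?tF_le ?mass_ge0//.
  + by apply: cvgM; exact: tF_cvg.
- rewrite -[X in _ --> X]addr0; apply: cvgD.
    rewrite -[X in _ --> X]EX; apply: (Ex_cvg_dominated (fun k => (measurable_tf k).1)
      (L1Z ((1 + c) ^+ 2) LX) _ _ mX) => [k eta|eta].
      rewrite normrM (ger0_norm (mass_ge0 _ _)) (ger0_norm (sqr_ge0 _)) mulrC.
      by rewrite ler_wpM2r ?mass_ge0.
    have h := cvgM (cvg_cst (X eta)) (cvgM (tf0_cvg (X eta) (Y eta)) (tf0_cvg (X eta) (Y eta))).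
    by rewrite !mulr1 in h; exact: h.
  have LY := L1_mass_setC.
  rewrite -[X in _ --> X](Ex_cst G 0); apply: (Ex_cvg_dominated (fun k => (measurable_tf k).2)
    (L1Z (c ^+ 2) LY) _ _ (measurable_cst _)) => [k eta|eta].
    rewrite normrM (ger0_norm (mass_ge0 _ _)) (ger0_norm (sqr_ge0 _)) mulrC.
    by rewrite ler_wpM2r ?mass_ge0.
  have h := cvgM (cvg_cst (Y eta)) (cvgM (tf1_cvg (X eta) (Y eta)) (tf1_cvg (X eta) (Y eta))).
  by rewrite !mulr0 in h; exact: h.
Qed.

Theorem test_function (e : R) : 0 < e -> exists F, [/\ in_domain G F,
  (form_closure G F <= (r + e)%:E)%E,
  ((r + r ^+ 2 - e)%:E <= Gint G (fun eta => F eta ^+ 2)%R)%E,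
  exists2 m : R, Gint G F = m%:E & 0 <= m <= r + e & (forall eta, 0 <= F eta)].
Proof.
move=> e0; have [r0 c1 c2 c3] := tF_limits.
have [k [h1 h2 h3]] : exists k, [/\ Ex G (tF k : M -> R) <= r + e,
    r + r ^+ 2 - e <= Ex G (fun eta : M => tF k eta ^+ 2) &
    Ex G (fun eta => X eta * tf0 k.+1%:R^-1 (X eta) (Y eta) ^+ 2) +
   Ex G (fun eta => Y eta * tf1 k.+1%:R^-1 (X eta) (Y eta) ^+ 2) <= r + e].
  move/cvgrPdist_lt : c1 => /(_ _ e0) c1; move/cvgrPdist_lt : c2 => /(_ _ e0) c2.
  move/cvgrPdist_lt : c3 => /(_ _ e0) c3.
  have [N _ hN] := filterI c1 (filterI c2 c3).
  have [/= g1 [g2 g3]] := hN N (leqnn N); exists N.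
  have aux (x y : R) : `|x - y| < e -> y <= x + e /\ x - e <= y.
    by rewrite ltr_norml => /andP[? ?]; split; lra.
  by split; [exact: (aux _ _ g1).1|exact: (aux _ _ g2).2|exact: (aux _ _ g3).1].
exists (tF k); split.
- by apply: cylinder_in_domain; [exact: tF_bm|exact: tF_cylinder].
- apply: (le_trans (form_closure_le_form0 (tF_cylinder k) (tF_form0 k))).
  by rewrite lee_fin.
- by rewrite /Gint -(EFin_Ex G (bm_sqr (tF_bm k))) lee_fin.
- exists (Ex G (tF k : M -> R)); first by rewrite /Gint -(EFin_Ex G (tF_bm k)).
  by rewrite h1 andbT Ex_ge0// => eta; exact: tF_ge0.
- exact: tF_ge0.
Qed.

End test_functions.

Section sharpness.
Context {R : realType} {E : completePseudoMetricType R}.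
Local Notation M := (@MT R E).
Variables (nu : @fmeas R E) (G : probability M R).
Hypothesis GG : is_gamma_distribution nu G.

Theorem poincare_sharp (lam : R) : (0 < fm nu setT)%E -> 1 < lam -> ~ poincare G lam.
Proof.
move=> T0 lam1 H; have lam0 : 0 < lam by lra.
set r := fine (fm nu setT).
have r0 : 0 < r by rewrite fine_gt0// T0 fm_lty.
have li : lam^-1 < 1 by rewrite invf_lt1.
have li0 : 0 < lam^-1 by rewrite invr_gt0.
pose e := Num.min 1 (r * (1 - lam^-1) / (2 * (4 + 2 * r))).
have q0 : 0 < 2 * (4 + 2 * r) by lra.
have rl : 0 < r * (1 - lam^-1) by rewrite mulr_gt0// subr_gt0.
have e0 : 0 < e by rewrite lt_min ltr01 divr_gt0.
have e1 : e <= 1 by rewrite ge_min lexx.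
have e2 : e * (2 * (4 + 2 * r)) <= r * (1 - lam^-1) by rewrite -ler_pdivlMr ?ge_min ?lexx ?orbT.
have [F [dF cF F2 [m Fm /andP[m0 mr]] _]] := test_function GG measurableT T0 e0.
have := H F dF; rewrite Fm -EFinM => h.
have {}h := le_trans F2 h.
have : ((r + r ^+ 2 - e)%:E <= (lam^-1 * (r + e) + m * m)%:E)%E.
  apply: (le_trans h); rewrite EFinD leeD2r// EFinM lee_wpmul2l// lee_fin ltW//.
rewrite lee_fin.
have mm : m * m <= (r + e) * (r + e) by exact: ler_pM.
have ll : lam^-1 * e <= e by rewrite -[leRHS]mul1r; apply: ler_wpM2r; exact: ltW.
have ee : e * e <= e by rewrite -[leRHS]mulr1; apply: ler_wpM2l => //; exact: ltW.
move: rl e2 mm ll ee r0 e0; move: (lam^-1) (m * m) => b q.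
clearbody r e; clear => rl e2 mm ll ee r0 e0 h; nra.
Qed.

Theorem no_super_poincare : (forall e : R, 0 < e -> exists2 A : set (@EB R E), measurable A &
    (0 < fm nu A < e%:E)%E) -> ~ exists beta : R -> R, super_poincare G beta.
Proof.
move=> small [beta [b0 H]].
have h0 : (0 : R) < 2^-1 by rewrite invr_gt0.
have B0 := b0 _ h0; set B := beta 2^-1 in B0.
have i0 : 0 < (2 * B)^-1 by rewrite invr_gt0 mulr_gt0.
have [A mA /andP[A0 Ae]] := small _ i0.
set r := fine (fm nu A).
have r0 : 0 < r by rewrite fine_gt0// A0 fm_lty.
have rB : r * (2 * B) < 1.
  by rewrite -ltr_pdivlMr ?mulr_gt0// mul1r -lte_fin /r fineK// ge0_fin_numE ?fm_lty// ltW.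
pose e := Num.min 1 (r ^+ 2 / (2 * (2 + B * (2 * r + 1)))).
have q0 : 0 < 2 * (2 + B * (2 * r + 1)) by have := mulr_gt0 B0 r0; lra.
have r20 : 0 < r ^+ 2 by exact: exprn_gt0.
have e0 : 0 < e by rewrite lt_min ltr01 divr_gt0.
have e1 : e <= 1 by rewrite ge_min lexx.
have e2 : e * (2 * (2 + B * (2 * r + 1))) <= r ^+ 2 by rewrite -ler_pdivlMr ?ge_min ?lexx ?orbT.
have [F [dF cF F2 [m Fm /andP[m0 mr]] F0]] := test_function GG mA A0 e0.
have Fabs : Gint G (fun eta => `|F eta|)%R = m%:E.
  by rewrite -Fm; apply: eq_integral => eta _; rewrite ger0_norm.
have := H _ h0 F dF; rewrite Fabs -(EFinM m m) -/B -(EFinM B (m * m)) => h.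
have {}h := le_trans F2 h.
have : ((r + r ^+ 2 - e)%:E <= (2^-1 * (r + e) + B * (m * m))%:E)%E.
  apply: (le_trans h); rewrite EFinD leeD2r// EFinM lee_wpmul2l// lee_fin ltW//.
rewrite lee_fin.
have mm : B * (m * m) <= B * ((r + e) * (r + e)) by rewrite ler_wpM2l ?(ltW B0)//; exact: ler_pM.
have ee : B * (e * e) <= B * e.
  rewrite ler_wpM2l ?(ltW B0)// -[leRHS]mulr1; apply: ler_wpM2l => //; exact: ltW.
have rr : r * (r * (2 * B)) <= r * 1 by apply: ler_wpM2l; exact: ltW.
move: mm ee rr e2 r20 e0; move: (m * m) => q; clearbody r e; clear => mm ee rr e2 r20 e0 h; lra.
Qed.

End sharpness.

(** * The support of the intensity measure *)

Section support.
Context {R : realType} {E : completePseudoMetricType R}.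
Hypothesis hE : hausdorff_space E.
Local Notation EB := (@EB R E).
Implicit Types (nu : @fmeas R E) (x y : E).

Lemma open_measurable (U : set E) : open U -> measurable (U : set EB).
Proof. by move=> oU; exact: sub_sigma_algebra. Qed.

Lemma closed_set1 x : closed [set x].
Proof. by apply: accessible_closed_set1; exact: hausdorff_accessible. Qed.

Lemma set1_measurable x : measurable ([set x] : set EB).
Proof.
rewrite -[X in measurable X]setCK; apply: measurableC; apply: open_measurable.
exact: closed_openC (@closed_set1 x).
Qed.

Definition oball x (k : nat) : set E := interior (ball x k.+1%:R^-1).

Lemma oball_bigcap x : \bigcap_k oball x k = [set x].
Proof.
apply/seteqP; split => [y h|_ -> k _]; last first.
  by apply: nbhsx_ballx; rewrite invr_gt0.
apply/esym; apply: (close_eq hE); rewrite ball_close => e.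
have [k ke] : exists k, k.+1%:R^-1 < e%:num.
  exists (Num.trunc e%:num^-1); rewrite invf_plt ?posrE//; exact: truncnS_gt.
by apply: (le_ball (ltW ke)); exact: interior_subset (h k I).
Qed.

Lemma atom_ge nu x (e : \bar R) : (forall U : set E, open U -> U x -> (e <= fm nu U)%E) ->
  (e <= fm nu [set x])%E.
Proof.
move=> he; rewrite -oball_bigcap.
have mo k : measurable (oball x k : set EB) by apply: open_measurable; exact: open_interior.
have h := @nonincreasing_cvg_mu _ EB R (fm nu) (oball x) (fm_lty nu (mo 0%N)) mo.
apply: (cvge_ge _ (h _ _)).
- apply: nearW => k; apply: he; first exact: open_interior.
  by apply: nbhsx_ballx; rewrite invr_gt0.
- by rewrite oball_bigcap; exact: set1_measurable.
- move=> m n mn; apply/subsetPset => y.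
  by apply: (@filterS _ _ (nbhs_filter y)) => z; apply: le_ball; rewrite lef_pV2 ?posrE// ler_nat.
Qed.

Lemma atoms_le nu (e : R) (s : seq E) : uniq s -> (forall x, x \in s -> (e%:E <= fm nu [set x])%E) ->
  measurable ([set` s] : set EB) /\ (((size s)%:R * e)%:E <= fm nu [set` s])%E.
Proof.
elim: s => [|y s IH] /= => [_ _|/andP[ys us] h].
  by rewrite set_nil measure0 mul0r; split => //; exact: measurable0.
have [ms hs] := IH us (fun x xs => h x (mem_behead (s := y :: s) xs)).
have my := set1_measurable y.
have -> : [set` y :: s] = [set y] `|` [set` s].
  by apply/seteqP; split => x /=; rewrite in_cons => /predU1P.
split; first exact: measurableU.
rewrite measureU//; last first.
  by apply/seteqP; split => // x [/= ->]; rewrite (negbTE ys).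
by rewrite -natr1 mulrDl mul1r EFinD addeC leeD// h// mem_head.
Qed.

Lemma small_sets nu : infinite_set (msupport nu) -> forall e : R, 0 < e ->
  exists2 A : set EB, measurable A & (0 < fm nu A < e%:E)%E.
Proof.
move=> infS e e0; apply: contrapT => H.
have h x : msupport nu x -> (e%:E <= fm nu [set x])%E.
  move=> sx; apply: atom_ge => U oU Ux; rewrite leNgt; apply/negP => Ue.
  by apply: H; exists U; [exact: open_measurable|rewrite sx].
have T1 : (fm nu setT < +oo)%E by exact: fm_fin.
pose n := (Num.trunc (fine (fm nu setT) / e)).+1.
have [B sB nB] := infinite_set_fset n infS.
have [ms] := @atoms_le nu e (finmap.enum_fset B) (finmap.fset_uniq B) (fun x xB => h x (sB x xB)).
apply/negP; rewrite -ltNge; apply: (@le_lt_trans _ _ (fm nu setT)).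
  by apply: le_measure; rewrite ?inE.
rewrite -[X in (X < _)%E]fineK ?ge0_fin_numE// lte_fin.
apply: (@lt_le_trans _ _ (n%:R * e)).
  by rewrite -ltr_pdivrMr//; exact: truncnS_gt.
by apply: ler_wpM2r; [exact: ltW|rewrite ler_nat].
Qed.

Lemma support_conegligible nu : separable_space E ->
  (fm nu).-negligible (~` msupport nu : set EB).
Proof.
move=> [D [cD dD]].
have /countable_injP[f injf] := cD.
pose B d k := interior (ball d (2 * k.+1%:R^-1)) : set E.
pose N (n k : nat) : set EB := [set x | exists d, [/\ D d, f d = n, B d k x & fm nu (B d k) = 0%E]].
have NN n k : (fm nu).-negligible (N n k).
  have [[d [Dd fd n0]]|nd] := pselect (exists d, [/\ D d, f d = n & fm nu (B d k) = 0%E]); last first.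
    apply: (@negligibleS _ _ _ _ set0) => [x [d [Dd fd _ d0]]|]; last exact: negligible_set0.
    by apply: nd; exists d.
  exists (B d k); split => //; first by apply: open_measurable; exact: open_interior.
  move=> x [d' [Dd' fd' Bx _]]; suff -> : d = d' by [].
  by apply: injf; rewrite ?inE// fd.
apply: (@negligibleS _ _ _ _ (\bigcup_n \bigcup_k N n k)); last first.
  by apply: negligible_bigcup => n; apply: negligible_bigcup => k.
move=> x /= sx.
have [U [oU Ux U0]] : exists U : set E, [/\ open U, U x & fm nu U = 0%E].
  apply: contrapT => H; apply: sx => U oU Ux; rewrite lt0e measure_ge0 andbT.
  by apply/negP => /eqP U0; apply: H; exists U.
have /nbhs_ballP[r /= r0 rU] : nbhs x U by exact: open_nbhs_nbhs.
have [k ke] : exists k, 3 * k.+1%:R^-1 < r.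
  exists (Num.trunc (3 / r)); rewrite ltr_pdivrMr// mulrC -ltr_pdivrMr//; exact: truncnS_gt.
set e : R := k.+1%:R^-1 in ke.
have e0 : 0 < e by rewrite invr_gt0.
have [d [Dd xd]] : D `&` ball x e !=set0.
  have : closure D x by rewrite dD.
  by apply; exact: nbhsx_ballx.
exists (f d) => //; exists k => //; exists d; split => //.
  apply: (@filterS _ _ (nbhs_filter x) (ball x e)); last exact: nbhsx_ballx.
  move=> y xy; rewrite -/e (_ : 2 * e = e + e); last by ring.
  by apply: (ball_triangle _ xy); exact: ball_sym.
apply/eqP; rewrite eq_le measure_ge0 andbT -U0; apply: le_measure.
- by rewrite inE; apply: open_measurable; exact: open_interior.
- by rewrite inE; exact: open_measurable.
- move=> y /interior_subset; rewrite -/e => dy; apply: rU; apply: (le_ball (ltW ke)).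
  by rewrite (_ : 3 * e = e + 2 * e); [exact: ball_triangle xd dy|ring].
Qed.

Lemma finite_support_atoms nu : separable_space E -> (0 < fm nu setT)%E ->
  finite_set (msupport nu) ->
  0 < min_atom nu /\ forall A : set EB, measurable A -> fm nu A = 0%E \/ min_atom nu <= fine (fm nu A).
Proof.
move=> sE T0 fS; have neg := support_conegligible nu sE.
have [x0 sx0] : msupport nu !=set0.
  apply/set0P/eqP => S0; move: T0; rewrite (measure_negligible measurableT) ?ltxx//.
  by rewrite S0 setC0 in neg.
have atom_gt0 x : msupport nu x -> (0 < fm nu [set x])%E.
  move=> sx; pose U : set E := ~` (msupport nu `\ x).
  have oU : open U.
    apply: closed_openC; rewrite (_ : _ `\ x = \bigcup_(y in msupport nu `\ x) [set y]).
      apply: closed_bigcup; first exact: finite_setD.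
      by move=> y _; exact: closed_set1.
    by apply/seteqP; split => [y sy|y [z sz ->]//]; exists y.
  have Ux : U x by move=> [_ /(_ erefl)].
  have := sx U oU Ux; congr (_ < _)%E.
  have mU := open_measurable oU; have m1 := set1_measurable x.
  have mUx : measurable (U `\` [set x] : set EB) by exact: measurableD.
  have -> : (U : set EB) = [set x] `|` (U `\ x).
    apply/seteqP; split => [y Uy|y [->//|[]//]].
    by have [->|/eqP yx] := eqVneq y x; [left|right].
  rewrite measureU//; last by apply/seteqP; split => // y [/= ->] [_ /(_ erefl)].
  rewrite [X in (_ + X)%E](measure_negligible mUx) ?adde0//.
  apply: negligibleS neg => y [Uy yx] sy; apply: Uy; split => //.
have lower (s : seq E) : (forall x, x \in s -> (0 < fm nu [set x])%E) ->
    exists2 d : R, 0 < d & forall x, x \in s -> (d%:E <= fm nu [set x])%E.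
  elim: s => [_|y s IH h]; first by exists 1.
  have [|d d0 hd] := IH; first by move=> x xs; apply: h; rewrite in_cons xs orbT.
  have y0 := h y (mem_head _ _); have yoo := fm_lty nu (set1_measurable y).
  have yK : (fine (fm nu [set y]))%:E = fm nu [set y] by rewrite fineK// ge0_fin_numE.
  exists (Num.min d (fine (fm nu [set y]))).
    by rewrite lt_min d0/= -lte_fin yK.
  move=> x; rewrite in_cons => /predU1P[->|/hd]; first by rewrite -yK lee_fin ge_min lexx orbT.
  by apply: le_trans; rewrite lee_fin ge_min lexx.
have /finite_seqP[s sE'] := fS.
have [d d0 hd] : exists2 d : R, 0 < d & forall x, x \in s -> (d%:E <= fm nu [set x])%E.
  by apply: lower => x xs; apply: atom_gt0; rewrite sE'.
rewrite /min_atom; set I := ereal_inf _.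
have Id : (d%:E <= I)%E.
  by apply/ereal_infP => _ [x sx <-]; apply: hd; move: sx; rewrite sE'.
have Ix x : msupport nu x -> (I <= fm nu [set x])%E.
  by move=> sx; apply: ereal_inf_lbound; exists x.
have IK : (fine I)%:E = I.
  rewrite fineK// fin_numE; apply/andP; split.
    by apply/eqP => Ioo; move: Id; rewrite Ioo.
  apply/eqP => Ioo; have := le_lt_trans (Ix _ sx0) (fm_lty nu (set1_measurable x0)).
  by rewrite Ioo ltxx.
split; first by rewrite -lte_fin IK; exact: lt_le_trans Id.
move=> A mA; have [[x [Ax sx]]|nx] := pselect (A `&` msupport nu !=set0).
  right; rewrite -lee_fin IK fineK ?ge0_fin_numE ?fm_lty//.
  apply: (le_trans (Ix _ sx)); apply: le_measure; rewrite ?inE//; first exact: set1_measurable.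
  by move=> _ ->.
left; apply: measure_negligible => //; apply: negligibleS neg => x Ax sx.
by apply: nx; exists x.
Qed.

End support.

Theorem theorem2p1 (R : realType) (E : completePseudoMetricType R)
  (E_hausdorff : hausdorff_space E) (E_separable : separable_space E)
  (E_lc : locally_compact [set: E]) :
  (* (1) gap(L_{1,0}) = 1 *)
  (forall (nu : @fmeas R E) (G : probability MT R),
     (0 < fm nu setT)%E -> is_gamma_distribution nu G ->
     poincare G 1 /\ forall lam : R, 1 < lam -> ~ poincare G lam) /\
  (* (2) no super Poincare inequality when supp nu is infinite *)
  (forall (nu : @fmeas R E) (G : probability MT R),
     (0 < fm nu setT)%E -> is_gamma_distribution nu G ->
     infinite_set (msupport nu) ->
     ~ exists beta : R -> R, super_poincare G beta) /\
  (* (3) log-Sobolev inequality when supp nu is finite *)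
  (exists c0 : R, 0 < c0 /\
     forall (nu : @fmeas R E) (G : probability MT R),
       (0 < fm nu setT)%E -> is_gamma_distribution nu G ->
       finite_set (msupport nu) ->
       forall F : @fmeas R E -> R, in_domain G F ->
         Gint G (fun eta => F eta ^+ 2) = 1%E ->
         (Gint G (fun eta => F eta ^+ 2 * ln (F eta ^+ 2))%R <=
            (c0 / Num.min 1 (min_atom nu))%:E * form_closure G F)%E).
Proof.
split; first by move=> nu G T0 GG; split; [exact: poincare_gamma GG|move=> lam l1; exact: (poincare_sharp GG T0 l1)].
split.
  by move=> nu G T0 GG infS; apply: (no_super_poincare GG); exact: small_sets.
have l0 := lsi_cst_gt0 R; have l20 : 0 < 2 * lsi_cst :> R by rewrite mulr_gt0.
exists (2 * lsi_cst); split=> // nu G T0 GG finS F dF F1.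
have [d0 hA] := finite_support_atoms E_hausdorff E_separable T0 finS.
have m0 : 0 < Num.min 1 (min_atom nu) by rewrite lt_min ltr01.
have C0 : 0 < 2 * lsi_cst / Num.min 1 (min_atom nu) by rewrite divr_gt0.
apply: (log_sobolev_gamma C0 GG _ dF F1) => A P mA PE.
have [A0|Ad] := hA A mA.
  apply: (gamma0_has_lsi (ltW C0)) => B mB.
  by transitivity (gamma_law (fine (fm nu A)) B); [exact: PE|rewrite A0].
have A0 : 0 < fine (fm nu A) by exact: lt_le_trans Ad.
apply: has_lsiW (gamma_has_lsi A0 PE).
rewrite ler_wpM2l ?(ltW l20)// lef_pV2 ?posrE ?lt_min ?ltr01//.
by rewrite le_min !ge_min lexx Ad orbT.
Qed.
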